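(* Let $m:\mathbb{R}^c\to\mathbb{R}$ be Lipschitz continuous with respect to the supremum norm, i.e., there is $L>0$ with $|m(\mathbf{x})-m(\mathbf{y})|\le L\|\mathbf{x}-\mathbf{y}\|_\infty$ for all $\mathbf{x},\mathbf{y}\in\mathbb{R}^c$. Assume that $|b_k(\phi)|=O(k^{-(1+\delta)})$ as $k\to\infty$ for some $\delta>0$. Then, under $\mathcal{H}_0:\mathrm{P}_1=\cdots=\mathrm{P}_c$ and as $N\to\infty$, $$T_{N,c}^{\phi,m}\ \rightsquigarrow\ T_{\infty,c}^{\phi,m}:=m\bigg(\Big(\pi_\ell\sum_{k=1}^{\infty}\sum_{r=1}^{2}2^{-1}b_k(\phi)Z_{k,r,\ell}^2\Big)_{\ell=1}^{c}\bigg),$$ where $\{\mathbf{Z}_{k,r}=(Z_{k,r,1},\ldots,Z_{k,r,c})\sim\mathcal{N}_c(\mathbf{0},\mathbf{S}):k\ge1,\ r=1,2\}$ is a collection of mutually independent random vectors, with $\mathbf{S}:=\operatorname{diag}(1/\pi_1,\ldots,1/\pi_c)-\mathbf{1}_c\mathbf{1}_c^\top$ and $\mathbf{1}_c$ the all-ones vector of $\mathbb{R}^c$.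
   Context: Setting. Fix $c\ge2$. For $\ell=1,\ldots,c$, the $\ell$th sample consists of angles $\Theta_1^{(\ell)},\ldots,\Theta_{n_\ell}^{(\ell)}\in[0,2\pi)$, each distributed according to an absolutely continuous distribution $\mathrm{P}_\ell$ on the circle; all observations (within and across samples) are mutually independent. $n_\ell\ge2$ for all $\ell$ and $N:=\sum_{\ell=1}^c n_\ell$. Uniform scores. $r_i^{(\ell)}\in\{1,\ldots,N\}$ is the rank of $\Theta_i^{(\ell)}$ in the pooled sample of size $N$ (ties have probability zero) and $c_i^{(\ell)}:=2\pi r_i^{(\ell)}/N$ is its uniform score; $\mathbf{c}^{(\ell)}:=(c_1^{(\ell)},\ldots,c_{n_\ell}^{(\ell)})$. Kernel. $\phi:[-1,1]\to\mathbb{R}$ is square integrable with respect to the weight $(1-t^2)^{-1/2}$, with Chebyshev coefficients $b_k(\phi)=\frac{2}{\pi(1+\delta_{k0})}\int_{-1}^1\phi(t)\cos(k\cos^{-1}t)(1-t^2)^{-1/2}\,\mathrm{d}t$ satisfying $b_0(\phi)=0$ and $\sum_{k\ge1}|b_k(\phi)|<\infty$, and $\phi(\cos\theta)=\sum_{k\ge1}b_k(\phi)\cos(k\theta)$ for all $\theta$ (so $\phi$ is continuous). Statistics. $S_{n_\ell}^\phi(\mathbf{c}^{(\ell)}):=\frac1{n_\ell}\sum_{i,j=1}^{n_\ell}\phi(\cos(c_i^{(\ell)}-c_j^{(\ell)}))$ and $T_{N,c}^{\phi,m}:=m\big(S_{n_1}^\phi(\mathbf{c}^{(1)}),\ldots,S_{n_c}^\phi(\mathbf{c}^{(c)})\big)$.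 Asymptotic regime. $N\to\infty$ with $c$ fixed and $\pi_{\ell,N}:=n_\ell/N\to\pi_\ell\in(0,1)$ for all $\ell=1,\ldots,c$. The symbol $\rightsquigarrow$ denotes weak convergence (convergence in distribution). *)

(* Defs.v *)
From HB Require Import structures.
From mathcomp Require Import all_boot all_order all_algebra.
From mathcomp Require Import finmap.
From mathcomp Require Import all_classical all_reals all_analysis.

Set Implicit Arguments.
Unset Strict Implicit.
Unset Printing Implicit Defensive.

Import Order.TTheory GRing.Theory Num.Theory.
Import numFieldNormedType.Exports.

Local Open Scope classical_set_scope.
Local Open Scope ring_scope.

Definition has_law d d' (Omega : measurableType d) (E : measurableType d')
    (R : realType) (P : probability Omega R) (X : Omega -> E)
    (Q : set E -> \bar R) : Prop :=
  measurable_fun [set: Omega] X /\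
  forall A : set E, measurable A -> pushforward P X A = Q A.

Definition mutually_independent d d' (Omega : measurableType d)
    (E : measurableType d') (R : realType) (P : probability Omega R)
    (I : choiceType) (X : I -> Omega -> E) : Prop :=
  forall (J : {fset I}) (A : I -> set E),
    (forall i, measurable (A i)) ->
    P (\bigcap_(i in [set` J]) (X i @^-1` A i)) =
    (\prod_(i <- J) P (X i @^-1` A i))%E.

(* The variables [X nu] may live on different probability spaces. *)
Definition cvg_in_distribution (R : realType)
    (d : nat -> measure_display) (Omega : forall nu, measurableType (d nu))
    (P : forall nu, probability (Omega nu) R) (X : forall nu, Omega nu -> R)
    d' (Omega' : measurableType d') (P' : probability Omega' R)
    (Y : Omega' -> R) : Prop :=
  [/\ (forall nu, measurable_fun [set: Omega nu] (X nu)),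
      measurable_fun [set: Omega'] Y &
      forall f : R -> R, continuous f -> bounded_fun f ->
        ('E_(P nu)[f \o X nu])%E @[nu --> \oo] --> ('E_P'[f \o Y])%E].

(* Normal law with mean [mu] and variance [v >= 0].  The case [v = 0] has to be
   separated: [normal_prob mu 0] is the uniform law on [0, 1], not the Dirac
   mass at [mu]. *)
Definition normal_law (R : realType) (mu v : R) : set R -> \bar R :=
  if v == 0 then (\d_mu : set R -> \bar R)
  else normal_prob mu (Num.sqrt v).

(* [Z ~ N_c(mu, S)], with [S] possibly singular: every linear combination of
   the coordinates of [Z] has the corresponding univariate normal law. *)
Definition is_mvnormal (R : realType) d (Omega : measurableType d)
    (P : probability Omega R) (c : nat)
    (Z : Omega -> c.-tuple (measurableTypeR R))
    (mu : 'rV[R]_c) (S : 'M[R]_c) : Prop :=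
  forall a : 'rV[R]_c,
    has_law P (fun w => \sum_(l < c) a ord0 l * tnth (Z w) l : measurableTypeR R)
      (normal_law ((a *m mu^T) ord0 ord0) ((a *m S *m a^T) ord0 ord0)).

(* Angles are represented in [0, 2 pi[. *)
Definition ac_circular (R : realType)
    (Q : probability (measurableTypeR R) R) : Prop :=
  Q `[0, 2 * pi[%classic = 1%E /\ Q `<< (@lebesgue_measure R).

Definition chebyshev_coef (R : realType) (phi : R -> R) (k : nat) : R :=
  2 / (pi * (1 + (k == 0%N)%:R)) *
  \int[@lebesgue_measure R]_(t in `[-1, 1])
     (phi t * cos (k%:R * acos t) / Num.sqrt (1 - t ^+ 2)).

(* Only the values of [phi] on [-1, 1] are used. *)
Definition admissible_kernel (R : realType) (phi : R -> R) : Prop :=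
  [/\ measurable_fun `[(-1 : R), 1] phi,
      (@lebesgue_measure R).-integrable `[-1, 1]
        (fun t => (phi t ^+ 2 / Num.sqrt (1 - t ^+ 2))%:E),
      chebyshev_coef phi 0 = 0,
      cvgn (fun n => \sum_(1 <= k < n) `|chebyshev_coef phi k| : R) &
      forall theta : R,
        \sum_(1 <= k < n) chebyshev_coef phi k * cos (k%:R * theta)
          @[n --> \oo] --> phi (cos theta)].

Section Statistic.
Context (R : realType) (c : nat) (n : 'I_c -> nat).

Definition total_size : nat := (\sum_(l < c) n l)%N.

Variable theta : forall l : 'I_c, 'I_(n l) -> R.

(* Ties are not broken: this is the rank in [1, N] when the pooled sample has
   no ties, which holds almost surely for absolutely continuous laws. *)
Definition pooled_rank (l : 'I_c) (i : 'I_(n l)) : nat :=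
  (\sum_(l' < c) \sum_(j < n l') (theta j <= theta i)%R)%N.

Definition uniform_score (l : 'I_c) (i : 'I_(n l)) : R :=
  2 * pi * (pooled_rank i)%:R / total_size%:R.

Definition S_stat (phi : R -> R) (l : 'I_c) : R :=
  (n l)%:R^-1 * \sum_(i < n l) \sum_(j < n l)
    phi (cos (uniform_score i - uniform_score j)).

Definition T_stat (phi : R -> R) (m : 'rV[R]_c -> R) : R :=
  m (\row_(l < c) S_stat phi l).

End Statistic.

Definition limit_cov (R : realType) (c : nat) (p : 'I_c -> R) : 'M[R]_c :=
  diag_mx (\row_(l < c) (p l)^-1)
  - (const_mx 1 : 'cV[R]_c) *m (const_mx 1 : 'cV[R]_c)^T.

(* [z k r] is the realization of the vector [Z_{k, r}]; the two values of
   [r : 'I_2] stand for [r = 1, 2], and [z 0] is not used. *)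
Definition T_limit (R : realType) (c : nat) (p : 'I_c -> R) (phi : R -> R)
    (m : 'rV[R]_c -> R) (z : nat -> 'I_2 -> c.-tuple R) : R :=
  m (\row_(l < c) (p l * limn (fun K => \sum_(1 <= k < K) \sum_(r < 2)
       2^-1 * chebyshev_coef phi k * (tnth (z k r) l) ^+ 2))).

(* Main.v *)
Require Import Defs.
From HB Require Import structures.
From mathcomp Require Import all_boot all_order all_algebra.
From mathcomp Require Import all_fingroup.
From mathcomp Require Import finmap zify ring lra.
From mathcomp Require Import all_classical all_reals all_analysis.
From mathcomp Require Import measurable_realfun.

(** Under the null hypothesis the pooled observations are exchangeable and have
    almost surely no ties.  Hence the vector of ranks is a uniformly distributed
    permutation [s] of the pooled sample, and every expectation becomes an average
    [avg] over permutations ([Rintegral_rank]); the theorem is then a statement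
    about sums over a random permutation.

    The cosine expansion of the kernel turns the statistic of sample [l] into the
    series over [k] of [b k] times the sum of the squares of two waves
    ([sum_sqr_rank_wave]); the wave [rank_wave k r l s] is the normalised sum, over
    the observations of sample [l], of the cosine (for one value of [r]) or the
    sine (for the other) of [k] times the uniform score.  The proof lets [N]
    grow with finitely many frequencies and shows that the others contribute little.

    For finitely many frequencies the waves are jointly asymptotically normal.  A
    linear combination of waves is a combinatorial sum [perm_stat], and exchanging
    two values of the permutation gives an approximate differential equation
    A' = - v t A for its characteristic function, with the solution
    exp (- v t^2 / 2) ([avg_swap], [gaussian_ode], [perm_clt]).  The orthogonality
    of trigonometric functions on the [N]-th roots of unity computes the variance
    ([rank_wave_clt]); it agrees with the variance of the same combination of the
    variables [limit_var], the multiples of the coordinates of [Z k r] whose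
    squares enter the limit ([Rintegral_cos_limit_var]).  Approximation of locally
    Lipschitz functions by trigonometric polynomials, with an error controlled by
    second moments ([trig_poly_approx]), passes from characteristic functions to
    Lipschitz functions of the truncated statistics ([cvg_truncated]).

    The error of truncation is small uniformly in the sample sizes
    ([avg_truncation]).  A frequency that is not a multiple of [N] has waves with
    bounded second moments, and the coefficients are summable.  A multiple of [N]
    is aliased with the frequency zero, and the square of its wave is of order [N];
    the decay of the coefficients makes the total contribution of the multiples of
    [N] of order N^(- delta) ([multiples_tail]).  The limiting series converges
    almost surely ([ae_cvg_limit_series]), so that the two limits can be
    exchanged ([cvg_avg_rank_stat]).  Bounded Lipschitz test functions are enough
    ([portmanteau]), and composed with [m] they are Lipschitz functions of the row
    of statistics. *)

Set Implicit Arguments.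
Unset Strict Implicit.
Unset Printing Implicit Defensive.

Import Order.TTheory GRing.Theory Num.Theory.
Import numFieldNormedType.Exports.

Local Open Scope classical_set_scope.
Local Open Scope ring_scope.

(** * Trigonometric inequalities and the Gaussian differential equation *)

Section TrigBounds.
Context {R : realType}.
Implicit Types x y h : R.

Lemma sin_lipschitz x y : `|sin x - sin y| <= `|x - y|.
Proof.
wlog le_yx : x y / y <= x.
  move=> H; have [/H//|/ltW/H] := leP y x.
  by rewrite distrC (distrC x).
have [c _ ->] := MVT_segment le_yx (fun z _ => is_derive_sin z)
  (continuous_subspaceT (@continuous_sin R)).
by rewrite normrM ler_piMl// cos_max.
Qed.

Lemma cos_lipschitz x y : `|cos x - cos y| <= `|x - y|.
Proof.
have := sin_lipschitz (x + pi / 2) (y + pi / 2).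
by rewrite !sinDpihalf opprD addrACA subrr addr0.
Qed.

Lemma sin_taylor1 x h : `|sin (x + h) - sin x - h * cos x| <= h ^+ 2.
Proof.
pose f z : R := sin z - z * cos x.
have df (z : R) : is_derive z 1 f (cos z - cos x).
  by rewrite /f; apply: is_derive_eq; rewrite /GRing.scale/=; ring.
have cf : continuous f.
  by move=> z; apply/differentiable_continuous/derivable1_diffP; case: (df z).
have key a b : a <= b -> (x = a) \/ (x = b) -> `|f b - f a| <= (b - a) ^+ 2.
  move=> ab xab.
  have [c cab ->] := MVT_segment ab (fun z _ => df z) (continuous_subspaceT cf).
  rewrite normrM expr2 (ger0_norm (x := b - a)) ?subr_ge0//.
  apply: ler_wpM2r; first by rewrite subr_ge0.
  apply: le_trans (cos_lipschitz _ _) _.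
  move: cab; rewrite in_itv/= => /andP[ac cb].
  by case: xab => ->; rewrite ler_norml; apply/andP; split; lra.
have -> : sin (x + h) - sin x - h * cos x = f (x + h) - f x.
  by rewrite /f mulrDl; ring.
have [h0|h0] := leP 0 h.
  have := @key x (x + h) _ (or_introl erefl); rewrite lerDl => /(_ h0).
  by have -> : x + h - x = h by ring.
have := @key (x + h) x _ (or_intror erefl); rewrite gerDl => /(_ (ltW h0)).
by rewrite distrC; have -> : (x - (x + h)) ^+ 2 = h ^+ 2 by ring.
Qed.

(** The Gaussian characteristic function solves [A' = - v t A]; multiplying by
    the integrating factor turns an approximate solution on [0, 1] into a
    function of small derivative. *)
Lemma gaussian_ode (A A' : R -> R) (v e : R) : 0 <= v -> 0 <= e ->
  (forall t : R, `|t| < 2 -> is_derive t 1 A (A' t)) ->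
  (forall t : R, 0 <= t <= 1 -> `|A' t + v * t * A t| <= e) ->
  `|A 1 - A 0 * expR (- v / 2)| <= e.
Proof.
move=> v0 e0 dA hA.
pose B (t : R) := expR (v * (t ^+ 2 - 1) / 2) * A t.
have in2 (t : R) : t \in `[(0 : R), 1] -> `|t| < 2.
  by rewrite in_itv/= => /andP[? ?]; rewrite ltr_norml; apply/andP; split; lra.
have dB (t : R) : `|t| < 2 ->
    is_derive t 1 B (expR (v * (t ^+ 2 - 1) / 2) * (A' t + v * t * A t)).
  move=> t2; have dAt := dA t t2.
  have dE : is_derive t 1 (fun t : R => expR (v * (t ^+ 2 - 1) / 2))
     (expR (v * (t ^+ 2 - 1) / 2) * (v * t)).
    have -> : (fun t : R => expR (v * (t ^+ 2 - 1) / 2)) =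
       expR \o (fun t : R => v / 2 *: (t ^+ 2) - v / 2).
      by apply/funext => u /=; congr expR; rewrite /GRing.scale/=; field.
    apply: is_derive_eq; rewrite /GRing.scale/=.
    have -> : v / 2 * t ^+ 2 - v / 2 = v * (t ^+ 2 - 1) / 2 by field.
    by congr (_ * _); field.
  rewrite /B; apply: is_derive_eq; rewrite /GRing.scale/=.
  by ring.
have cB : {within `[(0 : R), 1], continuous B}.
  apply: derivable_within_continuous => t tI.
  by have [] := dB t (in2 t tI).
have [c] := MVT_segment ler01 (fun t tI => dB t (in2 t (subset_itv_oo_cc tI))) cB.
rewrite in_itv/= => /andP[c0 c1].
rewrite subr0 mulr1 /B expr1n subrr mulr0 mul0r expR0 mul1r.
rewrite expr0n/= sub0r mulrN1 [X in _ - X = _]mulrC => ->.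
rewrite normrM (ger0_norm (expR_ge0 _)).
rewrite -[leRHS]mul1r; apply: ler_pM => //; last by apply: hA; rewrite c0.
rewrite -[leRHS]expR0 ler_expR.
have c2 : c ^+ 2 <= 1 by nra.
by rewrite pmulr_lle0// mulr_ge0_le0// subr_le0.
Qed.

End TrigBounds.

(** * Averages over permutations and exchange of two values *)

Section PermAverage.
Context {R : realType} {I : finType}.
Implicit Types (F G : {perm I} -> R).

Definition avg F : R := (\sum_(s : {perm I}) F s) / #|{perm I}|%:R.

Lemma card_perm_gt0 : 0 < #|{perm I}|%:R :> R.
Proof. by rewrite ltr0n; apply/card_gt0P; exists 1%g. Qed.

Lemma avg_cst (a : R) : avg (fun=> a) = a.
Proof.
by rewrite /avg sumr_const -[a *+ _]mulr_natr mulfK// gt_eqF// card_perm_gt0.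
Qed.

Lemma avgD F G : avg (fun s => F s + G s) = avg F + avg G.
Proof. by rewrite /avg big_split/= mulrDl. Qed.

Lemma avgZ (a : R) F : avg (fun s => a * F s) = a * avg F.
Proof. by rewrite /avg -mulr_sumr mulrA. Qed.

Lemma avgB F G : avg (fun s => F s - G s) = avg F - avg G.
Proof. by rewrite /avg big_split/= mulrDl sumrN mulNr. Qed.

Lemma avg_sum (J : Type) (r : seq J) (P : pred J) (F : J -> {perm I} -> R) :
  avg (fun s => \sum_(j <- r | P j) F j s) = \sum_(j <- r | P j) avg (F j).
Proof. by rewrite /avg exchange_big/= mulr_suml. Qed.

Lemma eq_avg F G : (forall s, F s = G s) -> avg F = avg G.
Proof. by move=> FG; rewrite /avg; congr (_ / _); apply: eq_bigr => s _. Qed.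

Lemma ler_avg F G : (forall s, F s <= G s) -> avg F <= avg G.
Proof.
move=> FG; rewrite /avg ler_pM2r ?invr_gt0 ?card_perm_gt0//.
by apply: ler_sum => s _.
Qed.

Lemma ler_norm_avg F : `|avg F| <= avg (fun s => `|F s|).
Proof.
rewrite /avg normrM [X in _ * X]ger0_norm ?invr_ge0 ?(ltW card_perm_gt0)//.
rewrite ler_pM2r ?invr_gt0 ?card_perm_gt0//.
exact: ler_norm_sum.
Qed.

Lemma avg_mull (s0 : {perm I}) F : avg (fun s => F (s0 * s)%g) = avg F.
Proof.
by rewrite /avg; congr (_ / _); rewrite [RHS](reindex_inj (mulgI s0)).
Qed.

Lemma avg_mulr (s0 : {perm I}) F : avg (fun s => F (s * s0)%g) = avg F.
Proof.
by rewrite /avg; congr (_ / _); rewrite [RHS](reindex_inj (mulIg s0)).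
Qed.

Lemma sqr_avg_norm_le F : (avg (fun s => `|F s|)) ^+ 2 <= avg (fun s => F s ^+ 2).
Proof.
set a := avg (fun s => `|F s|).
have : 0 <= avg (fun s => (`|F s| - a) ^+ 2).
  by rewrite -[leLHS](avg_cst 0); apply: ler_avg => s; rewrite sqr_ge0.
rewrite (@eq_avg _ (fun s => F s ^+ 2 + (- 2 * a) * `|F s| + a ^+ 2)); last first.
  by move=> s; rewrite sqrrB real_normK ?num_real//; ring.
by rewrite avgD avgD avgZ avg_cst -/a; nra.
Qed.

Lemma sum_perm (s : {perm I}) (f : I -> R) : \sum_u f (s u) = \sum_u f u.
Proof. by rewrite [RHS](reindex_inj (@perm_inj _ s)). Qed.

(** Hoeffding's combinatorial sum. *)
Definition perm_stat (y : I -> I -> R) (s : {perm I}) : R := \sum_i y i (s i).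

Definition swap_diff (y : I -> I -> R) (s : {perm I}) (i u : I) : R :=
  y i (s u) + y u (s i) - y i (s i) - y u (s u).

Lemma perm_stat_tperm y (s : {perm I}) i u :
  perm_stat y (tperm i u * s)%g = perm_stat y s + swap_diff y s i u.
Proof.
rewrite /perm_stat /swap_diff; have [<-|iu] := eqVneq i u.
  rewrite tperm1 mul1g; ring.
have E (f : I -> R) : \sum_k f k = f i + (f u + \sum_(k | (k != i) && (k != u)) f k).
  by rewrite (bigD1 i)//= (bigD1 (P := fun k => k != i) u) 1?eq_sym.
rewrite !E !permM tpermL tpermR.
under eq_bigr => k /andP[ki ku] do rewrite permM tpermD 1?eq_sym//.
by ring.
Qed.

(** Composing [s] with the transposition of [i] and [u] preserves the uniform law
    on permutations and turns [y i (s i)] into [y i (s u)], whose sum over [u]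
    vanishes: only the increments of [G] remain. *)
Lemma avg_swap (y : I -> I -> R) G : (forall i, \sum_u y i u = 0) ->
  avg (fun s => perm_stat y s * G s) =
  #|I|%:R^-1 * \sum_i \sum_u
    avg (fun s => y i (s u) * (G (tperm i u * s)%g - G s)).
Proof.
move=> y0.
have [I0|I0] := eqVneq #|I| 0%N.
  have no (f : I -> R) : \sum_i f i = 0.
    by rewrite big1// => i _; have := card0_eq I0 i; rewrite inE.
  rewrite no mulr0 -(avg_cst 0); apply: eq_avg => s.
  by rewrite /perm_stat no mul0r.
under eq_avg => s do rewrite /perm_stat mulr_suml.
rewrite avg_sum mulr_sumr; apply: eq_bigr => i _.
have -> : \sum_(u : I) avg (fun s => y i (s u) * (G (tperm i u * s)%g - G s)) =
    \sum_(u : I) avg (fun s => y i (s i) * G s).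
  have -> : \sum_u avg (fun s => y i (s u) * (G (tperm i u * s)%g - G s)) =
      \sum_u avg (fun s => y i (s u) * G (tperm i u * s)%g)
      - \sum_u avg (fun s => y i (s u) * G s).
    rewrite -sumrB; apply: eq_bigr => u _; rewrite -avgB.
    by apply: eq_avg => s; rewrite mulrBr.
  rewrite -[X in _ - X]avg_sum.
  rewrite [X in _ - X](_ : _ = 0) ?subr0; last first.
    rewrite -[RHS](avg_cst 0); apply: eq_avg => s.
    by rewrite -mulr_suml (sum_perm s (y i)) y0 mul0r.
  apply: eq_bigr => u _.
  rewrite -[RHS](avg_mull (tperm i u)); apply: eq_avg => s.
  by rewrite permM tpermL.
by rewrite sumr_const -[X in _ * X]mulr_natl mulKf// pnatr_eq0.
Qed.

Lemma swap_diff_le y b s i u : (forall i u, `|y i u| <= b) ->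
  `|swap_diff y s i u| <= 4 * b.
Proof.
move=> yb; rewrite /swap_diff.
have := yb i (s u); have := yb u (s i); have := yb i (s i); have := yb u (s u).
by rewrite !ler_norml => /andP[? ?] /andP[? ?] /andP[? ?] /andP[? ?];
  apply/andP; split; lra.
Qed.

(** [avg_swap] with [G] the statistic itself, whose increments are bounded by
    [4 * b]: there are [#|I| ^ 2] terms, divided by [#|I|]. *)
Lemma avg_sqr_perm_stat_le y b : (forall i, \sum_u y i u = 0) ->
  (forall i u, `|y i u| <= b) ->
  avg (fun s => perm_stat y s ^+ 2) <= 4 * #|I|%:R * b ^+ 2.
Proof.
move=> y0 yb.
have [I0|I0] := eqVneq #|I| 0%N.
  rewrite I0 mulr0 mul0r -(avg_cst 0); apply: ler_avg => s.
  rewrite /perm_stat big1 ?expr0n// => i _.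
  by have := card0_eq I0 i; rewrite inE.
under eq_avg => s do rewrite expr2.
rewrite avg_swap//.
rewrite -ler_pdivlMl ?invr_gt0 ?ltr0n ?lt0n// invrK.
have -> : #|I|%:R * (4 * #|I|%:R * b ^+ 2) =
    \sum_(i : I) \sum_(u : I) (4 * b ^+ 2).
  by rewrite !sumr_const -mulrnA -[RHS]mulr_natr natrM; ring.
apply: ler_sum => i _; apply: ler_sum => u _.
rewrite -[leRHS]avg_cst; apply: ler_avg => s.
rewrite perm_stat_tperm addrC addKr; apply: le_trans (ler_norm _) _.
rewrite normrM.
have -> : 4 * b ^+ 2 = b * (4 * b) by ring.
by apply: ler_pM => //; exact: swap_diff_le.
Qed.

Lemma avg_norm_perm_stat_le y b : (forall i, \sum_u y i u = 0) ->
  (forall i u, `|y i u| <= b) -> 0 <= b ->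
  avg (fun s => `|perm_stat y s|) <= 2 * Num.sqrt #|I|%:R * b.
Proof.
move=> y0 yb b0.
rewrite -[leRHS]ger0_norm; last by rewrite !mulr_ge0 ?sqrtr_ge0.
apply: le_trans (ler_norm _) _.
rewrite -ler_sqr ?nnegrE// !real_normK ?num_real//.
apply: le_trans (sqr_avg_norm_le _) _.
apply: le_trans (avg_sqr_perm_stat_le y0 yb) _.
by rewrite !exprMn sqr_sqrtr ?ler0n//; nra.
Qed.

End PermAverage.

(** * A central limit theorem for sums over a random permutation *)

Section PermCLT.
Context {R : realType} {I L : finType} (lab : I -> L) (x : L -> I -> R) (b : R).
Hypotheses (x0 : forall l, \sum_j x l j = 0) (xb : forall l j, `|x l j| <= b).
Hypothesis b0 : 0 <= b.

Local Notation N := (#|I|%:R : R).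

Let y i j := x (lab i) j.
Let Y j := \sum_i y i j.

Let y0 i : \sum_j y i j = 0. Proof. exact: x0. Qed.
Let yb i j : `|y i j| <= b. Proof. exact: xb. Qed.

(** The variance of [perm_stat y] is this number times [N / (N - 1)]. *)
Definition perm_var : R :=
  N^-1 * \sum_i \sum_j x (lab i) j ^+ 2 -
  N^-1 ^+ 2 * \sum_j (\sum_i x (lab i) j) ^+ 2.

Let sum_cst (c : R) : \sum_(i : I) c = N * c.
Proof. by rewrite sumr_const mulr_natl. Qed.

Lemma perm_var_ge0 : 0 <= perm_var.
Proof.
rewrite /perm_var; have [I0|I0] := eqVneq #|I| 0%N.
  by rewrite I0 invr0 expr0n/= !mul0r subrr.
have N0 : 0 < N by rewrite ltr0n lt0n.
rewrite exchange_big/= !mulr_sumr -sumrB sumr_ge0// => j _.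
rewrite -(pmulr_lge0 _ N0).
set m := N^-1 * \sum_i y i j.
have -> : (N^-1 * (\sum_i x (lab i) j ^+ 2) -
    N^-1 ^+ 2 * (\sum_i x (lab i) j) ^+ 2) * N = \sum_i (y i j - m) ^+ 2.
  have E i : (y i j - m) ^+ 2 = y i j ^+ 2 - 2 * m * y i j + m ^+ 2 by ring.
  under [RHS]eq_bigr do rewrite E.
  rewrite big_split/= sum_cst sumrB -mulr_sumr /m /y.
  by field; rewrite gt_eqF.
by rewrite sumr_ge0// => i _; rewrite sqr_ge0.
Qed.

Let cross (s : {perm I}) := N^-1 * \sum_i \sum_u y i (s u) * y u (s i).
Let z u j := y u j * Y j - N^-1 * \sum_k y u k * Y k.

(** This quantity estimates the variance when the permutation is given.  The two
    corrections are of smaller order, because [cross] is a sum of boundedly many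
    products of centred statistics and the rows of [z] sum to zero. *)
Let quad_swap (s : {perm I}) : (0 < #|I|)%N ->
  N^-1 * \sum_i \sum_u y i (s u) * swap_diff y s i u =
  perm_var + cross s - N^-1 * perm_stat z s.
Proof.
move=> I0; have N0 : N != 0 by rewrite pnatr_eq0 -lt0n.
have E i u : y i (s u) * swap_diff y s i u =
    y i (s u) ^+ 2 + y i (s u) * y u (s i) - y i (s u) * y i (s i)
    - y i (s u) * y u (s u).
  by rewrite /swap_diff; ring.
under eq_bigr => i _ do under eq_bigr => u _ do rewrite E.
under eq_bigr => i _ do rewrite !sumrB big_split/=.
rewrite !sumrB big_split/=.
rewrite [X in _ + _ - X - _]big1 ?subr0; last first.
  by move=> i _; rewrite -mulr_suml (sum_perm s (y i)) y0 mul0r.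
rewrite [X in _ - X]exchange_big/=.
rewrite (_ : \sum_j \sum_i y i (s j) * y j (s j) =
    \sum_u y u (s u) * Y (s u)); last first.
  by apply: eq_bigr => u _; rewrite -mulr_suml mulrC.
under eq_bigr => i _ do rewrite (sum_perm s (fun u => y i u ^+ 2)).
rewrite mulrBr mulrDr -/(cross s) /perm_stat /z sumrB mulrBr.
rewrite -mulr_sumr [X in _ = _ - (_ - _ * (_ * X))]exchange_big/=.
have -> : \sum_j \sum_i y i j * Y j = \sum_j (\sum_i y i j) ^+ 2.
  by apply: eq_bigr => j _; rewrite -mulr_suml expr2.
rewrite /perm_var -/y opprB.
by rewrite /y; ring.
Qed.

(** Sorting the indices by their labels turns the bilinear form into [#|L| ^ 2]
    products of two centred statistics, which are bounded in mean square. *)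
Let avg_cross : (0 < #|I|)%N ->
  avg (fun s => `|cross s|) <= 4 * #|L|%:R ^+ 2 * b ^+ 2.
Proof.
move=> I0; have N0 : 0 < N by rewrite ltr0n.
pose w l l' (u j : I) : R := (lab u == l')%:R * x l j.
have w0 l l' u : \sum_j w l l' u j = 0 by rewrite -mulr_sumr x0 mulr0.
have wb l l' u j : `|w l l' u j| <= b.
  by rewrite /w; case: eqP => _; rewrite ?mul1r ?mul0r// normr0.
have crossE s : cross s =
    N^-1 * \sum_l \sum_l' perm_stat (w l l') s * perm_stat (w l' l) s.
  rewrite /cross; congr (_ * _).
  have F (f : I -> I -> L -> L -> R) :
      \sum_i \sum_u f i u (lab i) (lab u) =
      \sum_l \sum_l' \sum_i \sum_u (lab i == l)%:R * (lab u == l')%:R * f i u l l'.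
    symmetry.
    under eq_bigr => l _ do rewrite exchange_big/=.
    rewrite exchange_big/=; apply: eq_bigr => i _.
    under eq_bigr => l _ do rewrite exchange_big/=.
    rewrite exchange_big/=; apply: eq_bigr => u _.
    rewrite (bigD1 (lab i))//= [X in _ + X]big1 ?addr0; last first.
      move=> l /negPf; rewrite eq_sym => ->.
      by rewrite big1// => l' _; rewrite !mul0r.
    rewrite (bigD1 (lab u))//= [X in _ + X]big1 ?addr0; last first.
      by move=> l /negPf; rewrite eq_sym => ->; rewrite mulr0 mul0r.
    by rewrite !eqxx !mul1r.
  rewrite (F (fun i u l l' => x l (s u) * x l' (s i))).
  apply: eq_bigr => l _; apply: eq_bigr => l' _.
  rewrite /perm_stat mulrC mulr_suml; apply: eq_bigr => i _.
  rewrite mulr_sumr; apply: eq_bigr => u _.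
  by rewrite /w; ring.
under eq_avg => s do rewrite crossE normrM (gtr0_norm (x := N^-1)) ?invr_gt0//.
rewrite avgZ -ler_pdivlMl ?invr_gt0// invrK.
apply: (@le_trans _ _ (avg (fun s => \sum_l \sum_l'
    (2^-1 * perm_stat (w l l') s ^+ 2 + 2^-1 * perm_stat (w l' l) s ^+ 2)))).
  apply: ler_avg => s; apply: le_trans (ler_norm_sum _ _ _) _.
  apply: ler_sum => l _; apply: le_trans (ler_norm_sum _ _ _) _.
  apply: ler_sum => l' _.
  have := sqr_ge0 (perm_stat (w l l') s - perm_stat (w l' l) s).
  have := sqr_ge0 (perm_stat (w l l') s + perm_stat (w l' l) s).
  by rewrite ler_norml => ? ?; apply/andP; split; nra.
rewrite avg_sum.
have -> : N * (4 * #|L|%:R ^+ 2 * b ^+ 2) =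
    \sum_(l : L) \sum_(l' : L) (4 * N * b ^+ 2).
  by rewrite !sumr_const -mulrnA -[RHS]mulr_natr natrM; ring.
apply: ler_sum => l _; rewrite avg_sum; apply: ler_sum => l' _.
rewrite avgD !avgZ.
have := avg_sqr_perm_stat_le (w0 l l') (wb l l').
have := avg_sqr_perm_stat_le (w0 l' l) (wb l' l).
by lra.
Qed.

Let avg_z : (0 < #|I|)%N ->
  avg (fun s => `|N^-1 * perm_stat z s|) <= 4 * Num.sqrt N * b ^+ 2.
Proof.
move=> I0; have N0 : 0 < N by rewrite ltr0n.
have z0 u : \sum_j z u j = 0.
  by rewrite /z sumrB sum_cst mulVKf ?gt_eqF// subrr.
have Yb j : `|Y j| <= N * b.
  rewrite -sum_cst; apply: le_trans (ler_norm_sum _ _ _) _.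
  by apply: ler_sum => i _.
have yYb u j : `|y u j * Y j| <= N * b ^+ 2.
  by rewrite normrM (_ : N * _ = b * (N * b)) ?ler_pM//; ring.
have zb u j : `|z u j| <= 2 * N * b ^+ 2.
  rewrite /z; apply: le_trans (ler_normB _ _) _.
  have : `|N^-1 * \sum_k y u k * Y k| <= N * b ^+ 2.
    rewrite normrM gtr0_norm ?invr_gt0// -ler_pdivlMl ?invr_gt0// invrK -(sum_cst (N * b ^+ 2)).
    by apply: le_trans (ler_norm_sum _ _ _) _; apply: ler_sum => k _; exact: yYb.
  by have := yYb u j; lra.
under eq_avg => s do rewrite normrM gtr0_norm ?invr_gt0//.
rewrite avgZ -ler_pdivlMl ?invr_gt0// invrK.
have zb0 : 0 <= 2 * N * b ^+ 2 by rewrite !mulr_ge0 ?sqr_ge0// ltW.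
apply: le_trans (avg_norm_perm_stat_le z0 zb zb0) _.
by rewrite le_eqVlt; apply/orP; left; apply/eqP; ring.
Qed.

(** Stein's method for the characteristic function [A t] of the permutation
    statistic: exchanging two values gives [A' t = - v t A t] up to a Taylor
    remainder and the fluctuation of the conditional variance. *)
Lemma perm_clt (a : R) : (0 < #|I|)%N ->
  `|avg (fun s => cos (perm_stat y s + a)) - cos a * expR (- perm_var / 2)|
  <= 16 * N * b ^+ 3 + 4 * #|L|%:R ^+ 2 * b ^+ 2 + 4 * Num.sqrt N * b ^+ 2.
Proof.
move=> I0; have N0 : 0 < N by rewrite ltr0n.
pose W s := perm_stat y s.
pose A (t : R) : R := avg (fun s => cos (t * W s + a)).
pose A' (t : R) : R := avg (fun s => - (W s * sin (t * W s + a))).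
set e := (X in _ <= X).
have e0 : 0 <= e.
  by rewrite !addr_ge0// !mulr_ge0 ?exprn_ge0 ?sqrtr_ge0// ltW.
have dA (t : R) : is_derive t 1 A (A' t).
  rewrite /A /A' /avg.
  have -> : (fun t0 : R => (\sum_s cos (t0 * W s + a)) / #|{perm I}|%:R) =
      (\sum_s (fun t0 : R => cos (t0 * W s + a) / #|{perm I}|%:R)).
    by apply/funext => t0; rewrite fct_sumE mulr_suml.
  rewrite mulr_suml.
  apply: (big_ind2 (fun f df => is_derive t 1 f df)).
  - exact: is_derive_cst.
  - by move=> f df g dg ? ?; exact: is_deriveD.
  move=> s _.
  by apply: is_derive_eq; rewrite /GRing.scale/=; ring.
have := @gaussian_ode R A A' perm_var e perm_var_ge0 e0 (fun t _ => dA t).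
have -> : A 0 = cos a.
  by rewrite /A -[RHS](@avg_cst R I); apply: eq_avg => s; rewrite mul0r add0r.
have -> : A 1 = avg (fun s => cos (W s + a)).
  by apply: eq_avg => s; rewrite mul1r.
apply=> t /andP[t0 t1].
pose S s : R := sin (t * W s + a).
pose C s : R := cos (t * W s + a).
pose rem s i u : R := S (tperm i u * s)%g - S s - t * swap_diff y s i u * C s.
have remb s i u : `|rem s i u| <= 16 * b ^+ 2.
  rewrite /rem /S /W perm_stat_tperm mulrDr.
  rewrite [_ + _ + a]addrAC.
  apply: le_trans (sin_taylor1 _ _) _; rewrite exprMn.
  have := @swap_diff_le R I y b s i u yb; rewrite ler_norml => /andP[? ?].
  have : swap_diff y s i u ^+ 2 <= 16 * b ^+ 2 by nra.
  (* the Taylor remainder is at most [t ^+ 2 * swap_diff ^+ 2] *)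
  have : t ^+ 2 <= 1 by nra.
  have := sqr_ge0 t; have := sqr_ge0 (swap_diff y s i u).
  by nra.
have A'E : A' t = - (N^-1 * \sum_i \sum_u avg (fun s => y i (s u) * rem s i u))
    - t * avg (fun s => C s * (perm_var + cross s - N^-1 * perm_stat z s)).
  have -> : A' t = - avg (fun s => W s * S s).
    by rewrite -mulN1r -avgZ; apply: eq_avg => s; rewrite mulN1r.
  rewrite avg_swap// -opprD; congr (- _).
  have -> : avg (fun s => C s * (perm_var + cross s - N^-1 * perm_stat z s)) =
      \sum_i \sum_u avg (fun s =>
        N^-1 * (C s * (y i (s u) * swap_diff y s i u))).
    under eq_bigr do rewrite -avg_sum.
    rewrite -avg_sum; apply: eq_avg => s; rewrite -quad_swap// mulrCA mulr_sumr.
    rewrite mulr_sumr; apply: eq_bigr => i _.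
    rewrite !mulr_sumr; apply: eq_bigr => u _.
    by ring.
  rewrite !mulr_sumr -big_split/=; apply: eq_bigr => i _.
  rewrite !mulr_sumr -big_split/=; apply: eq_bigr => u _.
  rewrite -!avgZ -avgD; apply: eq_avg => s.
  by rewrite /rem; ring.
have -> : A' t + perm_var * t * A t =
   - (N^-1 * \sum_i \sum_u avg (fun s => y i (s u) * rem s i u))
   - t * avg (fun s => C s * (cross s - N^-1 * perm_stat z s)).
  rewrite A'E.
  have -> : avg (fun s => C s * (perm_var + cross s - N^-1 * perm_stat z s)) =
     perm_var * A t + avg (fun s => C s * (cross s - N^-1 * perm_stat z s)).
    by rewrite /A -avgZ -avgD; apply: eq_avg => s; rewrite /C; ring.
  by ring.
apply: le_trans (ler_normB _ _) _; rewrite /e -addrA; apply: lerD.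
  rewrite normrN normrM gtr0_norm ?invr_gt0// -ler_pdivlMl ?invr_gt0// invrK.
  have -> : N * (16 * N * b ^+ 3) = \sum_(i : I) \sum_(u : I) (16 * b ^+ 3).
    by rewrite !sum_cst; ring.
  apply: le_trans (ler_norm_sum _ _ _) _; apply: ler_sum => i _.
  apply: le_trans (ler_norm_sum _ _ _) _; apply: ler_sum => u _.
  apply: le_trans (ler_norm_avg _) _; rewrite -[leRHS](@avg_cst R I).
  apply: ler_avg => s; rewrite normrM.
  have -> : 16 * b ^+ 3 = b * (16 * b ^+ 2) by ring.
  by apply: ler_pM.
rewrite normrM -[leRHS]mul1r; apply: ler_pM => //; first by rewrite ger0_norm.
apply: le_trans (ler_norm_avg _) _.
apply: (@le_trans _ _ (avg (fun s => `|cross s| + `|N^-1 * perm_stat z s|))).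
  apply: ler_avg => s; rewrite normrM -[leRHS]mul1r.
  by apply: ler_pM => //; [exact: cos_max|exact: ler_normB].
by rewrite avgD lerD// ?avg_cross ?avg_z.
Qed.

End PermCLT.

(** * Trigonometric sums over roots of unity *)

Section TrigSums.
Context {R : realType}.

Lemma sinDpin (x : R) (q : nat) : sin (x + q%:R * pi) = (-1) ^+ q * sin x.
Proof. by rewrite mulr_natl; exact: (alternatingn (@sinDpi R)). Qed.

Lemma sinD2pin (x : R) (q : nat) : sin (x + q%:R * (2 * pi)) = sin x.
Proof.
have -> : q%:R * (2 * pi) = (pi *+ 2) *+ q :> R.
  by rewrite -[RHS]mulr_natr -[pi *+ 2]mulr_natr; ring.
exact: (periodicn (@sinD2pi R)).
Qed.

Lemma sin_frac_pi_neq0 (N k : nat) : (0 < N)%N -> ~~ (N %| k)%N ->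
  sin (pi * k%:R / N%:R) != 0 :> R.
Proof.
move=> N0 Nk; have NR : 0 < N%:R :> R by rewrite ltr0n.
have -> : pi * k%:R / N%:R = pi * (k %% N)%:R / N%:R + (k %/ N)%:R * pi :> R.
  by rewrite {1}(divn_eq k N) natrD natrM; field; rewrite gt_eqF.
rewrite sinDpin mulf_neq0 ?signr_eq0// gt_eqF// sin_gt0_pi//; apply/andP; split.
  by rewrite divr_gt0// mulr_gt0 ?pi_gt0// ltr0n lt0n.
rewrite ltr_pdivrMr// ltr_pM2l ?pi_gt0// ltr_nat; exact: ltn_pmod.
Qed.

(** The sum telescopes after multiplication by [2 * sin h], where [h] is half the
    step of the angles. *)
Lemma sum_cos_roots (N k : nat) (a : R) : (0 < N)%N -> ~~ (N %| k)%N ->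
  \sum_(j < N) cos (k%:R * (2 * pi * j%:R / N%:R) + a) = 0.
Proof.
move=> N0 Nk; have NR : 0 < N%:R :> R by rewrite ltr0n.
set h : R := pi * k%:R / N%:R.
have tele n : (\sum_(j < n) cos (k%:R * (2 * pi * j%:R / N%:R) + a)) * (2 * sin h) =
    sin (2 * h * n%:R - h + a) - sin (- h + a).
  elim: n => [|n IH].
    by rewrite big_ord0 mulr0 sub0r mul0r subrr.
  rewrite big_ord_recr/= mulrDl IH.
  have -> : k%:R * (2 * pi * n%:R / N%:R) + a = 2 * h * n%:R + a.
    by rewrite /h; field; rewrite gt_eqF.
  have -> : 2 * h * n.+1%:R - h + a = (2 * h * n%:R + a) + h.
    by rewrite -natr1; ring.
  have -> : 2 * h * n%:R - h + a = (2 * h * n%:R + a) - h by ring.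
  by rewrite (sinD _ h) (sinD _ (- h)) cosN sinN; ring.
have /eqP := tele N.
have -> : 2 * h * N%:R - h + a = (- h + a) + k%:R * (2 * pi).
  by rewrite /h; field; rewrite gt_eqF.
rewrite sinD2pin subrr mulf_eq0 mulf_eq0 pnatr_eq0/=.
by rewrite (negPf (sin_frac_pi_neq0 N0 Nk)) orbF => /eqP.
Qed.

(** The uniform score of rank [j.+1] is [2 pi j.+1 / N]; the phase [r] selects
    the cosine or the sine of its [k]-th multiple. *)
Definition score_wave (N k : nat) (r : 'I_2) (j : nat) : R :=
  cos (k%:R * (2 * pi * j.+1%:R / N%:R) - r%:R * (pi / 2)).

Lemma score_wave_le1 N k r j : `|score_wave N k r j| <= 1.
Proof. exact: cos_max. Qed.

Lemma sum_score_wave N k r : (0 < N)%N -> ~~ (N %| k)%N ->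
  \sum_(j < N) score_wave N k r j = 0.
Proof.
move=> N0 Nk; have NR : 0 < N%:R :> R by rewrite ltr0n.
rewrite -[RHS](@sum_cos_roots N k (k%:R * (2 * pi / N%:R) - r%:R * (pi / 2)))//.
apply: eq_bigr => j _; rewrite /score_wave -natr1; congr cos.
by field; rewrite gt_eqF.
Qed.

Lemma cos_phase (r r' : 'I_2) : cos ((r%:R - r'%:R) * (pi / 2)) = (r == r')%:R :> R.
Proof.
have two (P : 'I_2 -> Prop) : P ord0 -> P ord_max -> forall i, P i.
  move=> P0 P1 [[|[|//]] lti]; first by rewrite (_ : Ordinal lti = ord0)//; exact: val_inj.
  by rewrite (_ : Ordinal lti = ord_max)//; exact: val_inj.
elim/two: r; elim/two: r' => /=.
- by rewrite subrr mul0r cos0.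
- by rewrite sub0r mulN1r cosN cos_pihalf.
- by rewrite subr0 mul1r cos_pihalf.
- by rewrite subrr mul0r cos0.
Qed.

(** Products of waves are sums of waves of frequencies [k + k'] and [k - k'], and
    of these only the frequency zero survives the summation. *)
Lemma score_wave_orthogonal N k k' r r' : (0 < k)%N -> (0 < k')%N -> (k + k' < N)%N ->
  \sum_(j < N) score_wave N k r j * score_wave N k' r' j =
  N%:R / 2 * (k == k')%:R * (r == r')%:R.
Proof.
wlog lek : k k' r r' / (k' <= k)%N.
  move=> H k0 k0' kN; have [/H|/ltnW lek] := leqP k' k; first exact.
  under eq_bigr do rewrite mulrC.
  by rewrite H// 1?addnC// (eq_sym k) (eq_sym r).
move=> k0 k0' kN.
have N0 : (0 < N)%N by apply: leq_ltn_trans kN.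
have NR : 0 < N%:R :> R by rewrite ltr0n.
pose a m q : R := m%:R * (2 * pi / N%:R) + q * (pi / 2).
have E (j : 'I_N) : score_wave N k r j * score_wave N k' r' j =
   2^-1 * cos ((k + k')%:R * (2 * pi * j%:R / N%:R) + a (k + k')%N (- r%:R - r'%:R)) +
   2^-1 * cos ((k - k')%:R * (2 * pi * j%:R / N%:R) + a (k - k')%N (r'%:R - r%:R)).
  rewrite /score_wave; set A := k%:R * _ - _; set B := k'%:R * _ - _.
  rewrite (_ : _ + a (k + k')%N _ = A + B); last first.
    by rewrite /A /B /a -natr1 natrD; field; rewrite gt_eqF.
  rewrite (_ : _ + a (k - k')%N _ = A - B); last first.
    by rewrite /A /B /a -natr1 natrB//; field; rewrite gt_eqF.
  by rewrite (cosD A B) (cosB A B); field.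
under eq_bigr do rewrite E.
rewrite big_split/= -!mulr_sumr sum_cos_roots//; last first.
  by apply/negP => /dvdn_leq; lia.
rewrite mulr0 add0r.
have [->|kk'] := eqVneq k k'.
  rewrite subnn; under eq_bigr do rewrite mul0r add0r /a mul0r add0r.
  rewrite sumr_const card_ord cos_phase eq_sym -[_ *+ N]mulr_natl mulr1.
  by ring.
rewrite sum_cos_roots ?mulr0 ?mul0r//.
by apply/negP => /dvdn_leq; move/eqP: kk'; lia.
Qed.

Lemma sum_enum_rank (I : finType) (f : nat -> R) :
  \sum_(i : I) f (enum_rank i) = \sum_(j < #|I|) f j.
Proof.
rewrite (reindex (@enum_val I I))/=; last exact/onW_bij/enum_val_bij.
by apply: eq_bigr => j _; rewrite enum_valK.
Qed.

End TrigSums.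

(** * Asymptotic normality of the waves of the ranks *)

(** The limiting variance of the linear combination with coefficients [t] of the
    waves, for relative sample sizes [w]. *)
Definition wave_var (R : realType) (c K : nat) (w : 'I_c -> R)
    (t : 'I_K * 'I_2 * 'I_c -> R) : R :=
  2^-1 * \sum_(q : 'I_K * 'I_2)
    (\sum_l t (q, l) ^+ 2 - (\sum_l Num.sqrt (w l) * t (q, l)) ^+ 2).

Section RankWaves.
Context {R : realType} {c : nat} (n : 'I_c -> nat).
Hypothesis n0 : forall l, (0 < n l)%N.

Notation I := {l : 'I_c & 'I_(n l)}.
Notation N := (total_size n).

Lemma sum_tag (F : 'I_c -> R) : \sum_(i : I) F (tag i) = \sum_l (n l)%:R * F l.
Proof.
rewrite -(sig_big_dep xpredT (fun _ => xpredT) (fun l (_ : 'I_(n l)) => F l))/=.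
by apply: eq_bigr => l _; rewrite sumr_const card_ord mulr_natl.
Qed.

Lemma card_labels : #|{: I}| = N.
Proof. by rewrite card_tagged sumnE big_map big_enum/=; apply: eq_bigr => l _; rewrite card_ord. Qed.

Let sum_rank (f : nat -> R) : \sum_(i : I) f (enum_rank i) = \sum_(j < N) f j.
Proof. by rewrite sum_enum_rank card_labels. Qed.

(** The permutation [s] stands for the ranks: the rank of the observation [i] is
    one more than the position of [s i] in the enumeration of [I]. *)
Definition rank_wave (k : nat) (r : 'I_2) (l : 'I_c) (s : {perm I}) : R :=
  (Num.sqrt (n l)%:R)^-1 *
  \sum_(i < n l) score_wave N k r (enum_rank (s (Tagged (fun l => 'I_(n l)) i))).

Lemma sum_block (l : 'I_c) (F : I -> R) :
  \sum_(i < n l) F (Tagged (fun l => 'I_(n l)) i) = \sum_(i : I) (tag i == l)%:R * F i.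
Proof.
pose G (l' : 'I_c) (i : 'I_(n l')) := (l' == l)%:R * F (Tagged (fun l => 'I_(n l)) i).
have -> : \sum_(i : I) (tag i == l)%:R * F i = \sum_(i : I) G (tag i) (tagged i).
  by apply: eq_bigr => -[l' i] _.
rewrite -(sig_big_dep xpredT (fun _ => xpredT) G)/= (bigD1 l)//=.
rewrite [X in _ + X]big1 ?addr0; last first.
  by move=> l' /negPf ll'; rewrite /G ll' big1// => i _; rewrite mul0r.
by apply: eq_bigr => i _; rewrite /G eqxx mul1r.
Qed.

Lemma rank_waveE k r l s : rank_wave k r l s =
  perm_stat (fun i j => (tag i == l)%:R * ((Num.sqrt (n l)%:R)^-1 *
    score_wave N k r (enum_rank j))) s.
Proof.
rewrite /rank_wave (sum_block l (fun i => score_wave N k r (enum_rank (s i)))) mulr_sumr; apply: eq_bigr => i _.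
by rewrite mulrCA.
Qed.

Let sq0 l : 0 < Num.sqrt (n l)%:R :> R.
Proof. by rewrite sqrtr_gt0 ltr0n. Qed.

Lemma sqr_rank_wave_le k r l s : rank_wave k r l s ^+ 2 <= (n l)%:R.
Proof.
rewrite /rank_wave exprMn exprVn sqr_sqrtr// ler_pdivrMl ?ltr0n// -expr2.
rewrite -[leRHS]ger0_norm ?sqr_ge0// -[leLHS]ger0_norm ?sqr_ge0// !normrX.
rewrite lerXn2r ?nnegrE// (ger0_norm (x := _%:R))//.
rewrite -[X in _ <= X%:R]card_ord -sumr_const.
apply: le_trans (ler_norm_sum _ _ _) _; apply: ler_sum => i _.
exact: score_wave_le1.
Qed.

(** A wave whose frequency is not a multiple of [N] has sum zero, so that
    [avg_sqr_perm_stat_le] applies with entries of size [(n l) ^ (-1/2)]. *)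
Lemma avg_sqr_rank_wave_le k r l : ~~ (N %| k)%N ->
  avg (fun s => rank_wave k r l s ^+ 2) <= 4 * N%:R / (n l)%:R.
Proof.
move=> Nk.
have N0 : (0 < N)%N by apply: leq_trans (n0 l) _; rewrite /total_size (bigD1 l)//= leq_addr.
under eq_avg => s do rewrite rank_waveE.
have -> : 4 * N%:R / (n l)%:R = 4 * N%:R * (Num.sqrt (n l)%:R)^-1 ^+ 2 :> R.
  by rewrite exprVn sqr_sqrtr.
rewrite -[X in _ * X%:R * _]card_labels; apply: avg_sqr_perm_stat_le => i.
  by rewrite -!mulr_sumr (sum_rank (score_wave N k r)) sum_score_wave// !mulr0.
move=> j; rewrite normrM normrM (gtr0_norm (x := _^-1)) ?invr_gt0//.
rewrite -[leRHS]mul1r; apply: ler_pM => //.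
  by case: eqP; rewrite ?normr1// normr0.
by rewrite ler_piMr ?score_wave_le1// invr_ge0 ltW.
Qed.

Section Combination.
Variables (K : nat) (t : 'I_K * 'I_2 * 'I_c -> R).
Hypothesis KN : (2 * K < N)%N.

Notation Q := ('I_K * 'I_2)%type.
Let wave (q : Q) (j : I) : R := score_wave N q.1.+1 q.2 (enum_rank j).
Let x l j : R := \sum_(q : Q) t (q, l) / Num.sqrt (n l)%:R * wave q j.

Let N0 : (0 < N)%N. Proof. exact: leq_ltn_trans KN. Qed.

Let NkN (k : 'I_K) : ~~ (N %| k.+1)%N.
Proof. by apply/negP => /dvdn_leq; have := ltn_ord k; lia. Qed.

Lemma sum_rank_waveE s :
  \sum_(d : 'I_K * 'I_2 * 'I_c) t d * rank_wave d.1.1.+1 d.1.2 d.2 s =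
  perm_stat (fun i j => x (tag i) j) s.
Proof.
transitivity (\sum_(d : Q * 'I_c) t (d.1, d.2) * rank_wave d.1.1.+1 d.1.2 d.2 s).
  by apply: eq_bigr => -[]//.
rewrite -(pair_bigA _ (fun q l => t (q, l) * rank_wave q.1.+1 q.2 l s))/=.
rewrite /perm_stat /x [RHS]exchange_big/=; apply: eq_bigr => q _.
rewrite (_ : \sum_(i : I) _ = \sum_(i : I) \sum_l (tag i == l)%:R *
  (t (q, l) / Num.sqrt (n l)%:R * wave q (s i))); last first.
  apply: eq_bigr => i _; rewrite (bigD1 (tag i))//= eqxx mul1r big1 ?addr0//.
  by move=> l; rewrite eq_sym => /negPf ->; rewrite mul0r.
rewrite exchange_big/=; apply: eq_bigr => l _.
rewrite rank_waveE mulr_sumr; apply: eq_bigr => i _.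
by rewrite /wave; ring.
Qed.

Let x_sum0 l : \sum_j x l j = 0.
Proof.
rewrite exchange_big/= big1// => q _.
by rewrite -mulr_sumr (sum_rank (score_wave N q.1.+1 q.2)) sum_score_wave// mulr0.
Qed.

Let parseval (a : Q -> R) :
  \sum_j (\sum_q a q * wave q j) ^+ 2 = N%:R / 2 * \sum_q a q ^+ 2.
Proof.
under eq_bigr => j _ do rewrite expr2 mulr_suml.
rewrite exchange_big/= mulr_sumr; apply: eq_bigr => q _.
under eq_bigr => j _ do rewrite mulr_sumr.
rewrite exchange_big/= (bigD1 q)//= [X in _ + X]big1 ?addr0.
  rewrite (_ : \sum_j _ = a q ^+ 2 * \sum_j wave q j * wave q j); last first.
    by rewrite mulr_sumr; apply: eq_bigr => j _; ring.
  rewrite (sum_rank (fun j => score_wave N q.1.+1 q.2 j * score_wave N q.1.+1 q.2 j)).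
  rewrite score_wave_orthogonal//; last by apply: leq_ltn_trans KN; have := ltn_ord q.1; lia.
  by rewrite !eqxx/= !mulr1 mulrC.
move=> q' qq'.
rewrite (_ : \sum_j _ = a q * a q' * \sum_j wave q j * wave q' j); last first.
  by rewrite mulr_sumr; apply: eq_bigr => j _; ring.
rewrite (sum_rank (fun j => score_wave N q.1.+1 q.2 j * score_wave N q'.1.+1 q'.2 j)).
rewrite score_wave_orthogonal//; last first.
  by apply: leq_ltn_trans KN; have := ltn_ord q.1; have := ltn_ord q'.1; lia.
case: q q' qq' => [k r] [k' r'] /=; rewrite -pair_eqE /pair_eq/= eqSS.
rewrite (eq_sym k') (eq_sym r') -val_eqE/=.
by case: (_ == _ :> nat); case: (r == r') => //= _; rewrite ?(mulr0, mul0r).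
Qed.

(** By orthogonality the frequencies and the phases contribute separately; within
    one of them, the first term of [perm_var] is the sum over the samples and the
    second one the square of the pooled sum. *)
Lemma perm_var_rank_wave : perm_var (@tag _ (fun l => 'I_(n l))) x =
  wave_var (fun l => (n l)%:R / N%:R) t.
Proof.
rewrite /wave_var.
have NR : N%:R != 0 :> R by rewrite pnatr_eq0 -lt0n.
rewrite /perm_var card_labels (sum_tag (fun l => \sum_j x l j ^+ 2)).
have E (j : I) : \sum_(i : I) x (tag i) j = \sum_q (\sum_l Num.sqrt (n l)%:R * t (q, l)) * wave q j.
  transitivity (\sum_l (n l)%:R * x l j); first exact: (sum_tag (fun l => x l j)).
  rewrite /x.
  under eq_bigr => l _ do rewrite mulr_sumr.
  rewrite exchange_big/=; apply: eq_bigr => q _.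
  rewrite mulr_suml; apply: eq_bigr => l _.
  rewrite -{1}[(n l)%:R]sqr_sqrtr//.
  by field; rewrite gt_eqF.
under [X in _ - _ * X]eq_bigr => j _ do rewrite E.
rewrite parseval.
under eq_bigr => l _ do rewrite parseval.
rewrite sumrB mulrBr; congr (_ - _).
  rewrite exchange_big/= !mulr_sumr; apply: eq_bigr => l _.
  under eq_bigr => q _ do rewrite exprMn exprVn sqr_sqrtr//.
  rewrite -mulr_suml; field.
  by rewrite NR pnatr_eq0 -lt0n n0.
rewrite !mulr_sumr; apply: eq_bigr => q _.
rewrite (_ : \sum_l Num.sqrt ((n l)%:R / N%:R) * t (q, l) =
  (\sum_l Num.sqrt (n l)%:R * t (q, l)) / Num.sqrt N%:R); last first.
  rewrite mulr_suml; apply: eq_bigr => l _.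
  by rewrite sqrtrM// sqrtrV//; ring.
rewrite [in RHS]exprMn [in RHS]exprVn sqr_sqrtr//.
by field.
Qed.

(** With [N <= B * n l] the summands of the statistic are of order [N^(-1/2)]. *)
Lemma rank_wave_clt (a B : R) : 0 < B -> (forall l, N%:R <= B * (n l)%:R) ->
  `|avg (fun s => cos (\sum_(d : 'I_K * 'I_2 * 'I_c)
                     t d * rank_wave d.1.1.+1 d.1.2 d.2 s + a))
    - cos a * expR (- wave_var (fun l => (n l)%:R / N%:R) t / 2)|
  <= (Num.sqrt N%:R)^-1 *
     (16 * (\sum_d `|t d| * Num.sqrt B) ^+ 3 +
      (4 * c%:R ^+ 2 + 4) * (\sum_d `|t d| * Num.sqrt B) ^+ 2).
Proof.
move=> B0 NB; have NR : 1 <= N%:R :> R by rewrite (ler_nat _ 1).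
have SN1 : 1 <= Num.sqrt N%:R :> R by rewrite -[leLHS]sqrtr1 ler_sqrt.
set S := \sum_d `|t d| * Num.sqrt B.
have S0 : 0 <= S by rewrite sumr_ge0// => d _; exact: mulr_ge0.
have xb l j : `|x l j| <= S / Num.sqrt N%:R.
  apply: le_trans (ler_norm_sum _ _ _) _.
  apply: (@le_trans _ _ (\sum_q `|t (q, l)| * (Num.sqrt B / Num.sqrt N%:R))).
    apply: ler_sum => q _; rewrite !normrM -mulrA ler_wpM2l//.
    rewrite -[leRHS]mulr1; apply: ler_pM => //; last exact: score_wave_le1.
    rewrite ger0_norm ?invr_ge0// ler_pdivlMr ?(lt_le_trans _ SN1)//.
    rewrite ler_pdivrMl// -sqrtrM// ler_sqrt 1?mulrC//.
    by rewrite mulr_ge0// ltW.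
  rewrite /S mulr_suml.
  rewrite [leRHS](_ : _ = \sum_(d : Q * 'I_c)
      `|t (d.1, d.2)| * (Num.sqrt B / Num.sqrt N%:R)); last first.
    by apply: eq_bigr => -[q l'] _; rewrite mulrA.
  rewrite -(pair_bigA _ (fun q l => `|t (q, l)| * (Num.sqrt B / Num.sqrt N%:R)))/=.
  apply: ler_sum => q _; rewrite (bigD1 l)//= lerDl; apply: sumr_ge0 => l' _.
  by rewrite mulr_ge0// divr_ge0.
have b0 : 0 <= S / Num.sqrt N%:R by rewrite divr_ge0.
rewrite -perm_var_rank_wave; under eq_avg => s do rewrite sum_rank_waveE.
have I0 : (0 < #|{: I}|)%N by rewrite card_labels.
apply: le_trans (perm_clt (@tag _ (fun l => 'I_(n l))) x_sum0 xb b0 a I0) _.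
rewrite card_ord card_labels; set w := Num.sqrt N%:R in SN1 *.
have w0 : 0 < w by rewrite (lt_le_trans _ SN1).
have -> : N%:R = w ^+ 2 :> R by rewrite sqr_sqrtr.
have -> : 16 * w ^+ 2 * (S / w) ^+ 3 + 4 * c%:R ^+ 2 * (S / w) ^+ 2 + 4 * w * (S / w) ^+ 2 =
  w^-1 * (16 * S ^+ 3 + (4 * c%:R ^+ 2 / w + 4) * S ^+ 2) by field; rewrite gt_eqF.
rewrite ler_pM2l ?invr_gt0// lerD2l ler_wpM2r ?sqr_ge0// lerD2r.
rewrite ler_pdivrMr// ler_peMr// mulr_ge0// ?sqr_ge0//.
Qed.

End Combination.
End RankWaves.

(** * Approximation by trigonometric polynomials *)

Section SinInverse.
Context {R : realType}.

Lemma cos1_le (x : R) : -1 <= x <= 1 -> cos 1 <= cos x.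
Proof.
move=> /andP[x1 x2]; rewrite -(cos_norm x).
have x1' : `|x| <= 1 by rewrite ler_norml x1.
have pi1 : 1 <= pi :> R by have := @pi_ge2 R; lra.
have I y : 0 <= y <= 1 -> y \in `[(0 : R), pi].
  by move=> /andP[y0 y1]; rewrite in_itv/= y0 (le_trans y1).
have [->//|x1ne] := eqVneq `|x| 1.
rewrite ltW// ltr_cos ?I ?normr_ge0 ?x1' ?ler01 ?lexx//.
by rewrite lt_neqAle x1ne.
Qed.

Lemma sin_expand (x y : R) : -1 <= x <= 1 -> -1 <= y <= 1 ->
  cos 1 * `|x - y| <= `|sin x - sin y|.
Proof.
wlog lexy : x y / y <= x.
  move=> H x1 y1; have [/H|/ltW/H] := leP y x; first exact.
  by rewrite distrC (distrC (sin x)); exact.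
move=> /andP[x1 x2] /andP[y1 y2].
have [c] := MVT_segment lexy (fun z _ => is_derive_sin z)
  (continuous_subspaceT (@continuous_sin R)).
rewrite in_itv/= => /andP[yc cx] ->; rewrite normrM ler_wpM2r//.
apply: le_trans (ler_norm _); apply: cos1_le.
by rewrite (le_trans y1) ?(le_trans cx).
Qed.

Lemma clamp_le (s x v : R) : 0 <= s -> `|x| <= s ->
  `|x - Num.max (- s) (Num.min s v)| <= `|x - v|.
Proof.
move=> s0; rewrite ler_norml => /andP[x1 x2].
have [sv|vs] := leP s v; have [h|h] := leP (- s) _;
  rewrite ler_norml; apply/andP; split;
  have := ler_norm (x - v); have := ler_norm (v - x); rewrite (distrC v);
  lra.
Qed.

(** A Lipschitz left inverse of the sine on [-1, 1], defined on the whole line. *)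
Lemma sin_left_inverse (v : R) : exists2 y : R, -1 <= y <= 1 &
  forall x, -1 <= x <= 1 -> cos 1 * `|x - y| <= `|sin x - v|.
Proof.
have pi1 : 1 <= pi / 2 :> R by exact: pihalf_ge1.
have s0 : 0 <= sin (1 : R) by rewrite ltW// sin2_gt0// ltr01 ltr1n.
have half (y : R) : -1 <= y <= 1 -> y \in `[(- (pi / 2)), pi / 2].
  by move=> /andP[y1 y2]; rewrite in_itv/=; apply/andP; split; lra.
have sin_le (y z : R) : y \in `[(- (pi / 2)), pi / 2] ->
  z \in `[(- (pi / 2)), pi / 2] -> (sin y <= sin z) = (y <= z).
  by move=> yI zI; rewrite !leNgt ltr_sin.
have h1 : (1 : R) \in `[(- (pi / 2)), pi / 2] by apply: half; rewrite lexx andbT; lra.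
have hN1 : (-1 : R) \in `[(- (pi / 2)), pi / 2] by apply: half; rewrite lexx/=; lra.
pose w := Num.max (- sin 1) (Num.min (sin 1) v).
have [w1 w2] : - sin 1 <= w /\ w <= sin 1.
  split; first by rewrite /w le_max lexx.
  by rewrite /w ge_max ge_min lexx/= andbT; lra.
have s1 := @sin_le1 R 1.
have wI : w \in `[(-1), 1] by rewrite in_itv/=; apply/andP; split; lra.
have aI : asin w \in `[(- (pi / 2)), pi / 2].
  by rewrite in_itv/= asin_geNpi2 ?asin_lepi2//; move: wI; rewrite in_itv.
have yI : -1 <= asin w <= 1.
  by apply/andP; split; rewrite -sin_le// asinK// sinN.
exists (asin w) => // x xI; apply: le_trans (sin_expand xI yI) _.
rewrite asinK//; apply: clamp_le => //.
move: xI => /andP[x1 x2]; have xI := half x; rewrite x1 x2 in xI.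
by rewrite ler_norml -sinN !sin_le ?x1 ?x2//; apply: xI.
Qed.

End SinInverse.

Section TrigPoly.
Context {R : realType} {D : finType}.
Implicit Types (f g : (D -> R) -> R) (x : D -> R).

(** Real trigonometric polynomials in several variables, with arbitrary real
    frequencies. *)
Inductive trig_poly : ((D -> R) -> R) -> Prop :=
| trig_cos t a : trig_poly (fun x => cos (\sum_d t d * x d + a))
| trig_lin u v f g : trig_poly f -> trig_poly g ->
    trig_poly (fun x => u * f x + v * g x).

Lemma trig_cst (a : R) : trig_poly (fun=> a).
Proof.
rewrite (_ : (fun=> a) = fun x => a * cos (\sum_(d : D) 0 * x d + 0)
    + 0 * cos (\sum_(d : D) 0 * x d + 0)).
  by apply: (trig_lin a 0); exact: (@trig_cos (fun=> 0)).
by apply/funext => x; rewrite big1 ?addr0 ?cos0 ?mul0r ?mulr1 ?addr0// => d _; rewrite mul0r.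
Qed.

Lemma trigD f g : trig_poly f -> trig_poly g -> trig_poly (fun x => f x + g x).
Proof.
move=> tf tg; rewrite (_ : (fun x => f x + g x) = fun x => 1 * f x + 1 * g x).
  exact: trig_lin.
by apply/funext => x; rewrite !mul1r.
Qed.

Lemma trigM f g : trig_poly f -> trig_poly g -> trig_poly (fun x => f x * g x).
Proof.
move=> tf tg; elim: tf => [t a|u v f1 f2 _ t1 _ t2]; last first.
  rewrite (_ : (fun x => _) = fun x => u * (f1 x * g x) + v * (f2 x * g x)).
    exact: trig_lin.
  by apply/funext => x; ring.
elim: tg => [t' a'|u v g1 g2 _ t1 _ t2]; last first.
  rewrite (_ : (fun x => _) = fun x =>
     u * (cos (\sum_d t d * x d + a) * g1 x) + v * (cos (\sum_d t d * x d + a) * g2 x)).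
    exact: trig_lin.
  by apply/funext => x; ring.
rewrite (_ : (fun x => _) = fun x =>
  2^-1 * cos (\sum_d (t d + t' d) * x d + (a + a')) +
  2^-1 * cos (\sum_d (t d - t' d) * x d + (a - a'))).
  by apply: trig_lin; [exact: (@trig_cos (fun d => t d + t' d))
    |exact: (@trig_cos (fun d => t d - t' d))].
apply/funext => x; set A := \sum_d t d * x d + a; set B := \sum_d t' d * x d + a'.
have -> : \sum_d (t d + t' d) * x d + (a + a') = A + B.
  by rewrite /A /B addrACA -big_split/=; congr (_ + _); apply: eq_bigr => d _; ring.
have -> : \sum_d (t d - t' d) * x d + (a - a') = A - B.
  rewrite /A /B opprD addrACA -sumrB; congr (_ + _).
  by apply: eq_bigr => d _; ring.
by rewrite (cosD A B) (cosB A B); field.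
Qed.

End TrigPoly.

Section Walk.
Context {R : realType} {D : finType}.
Implicit Types (p : D -> R) (h : (D -> nat) -> R) (k : D -> nat).

Definition incr_at (d : D) k : D -> nat := fun e => (k e + (e == d))%N.

(** The mean of [h] at the end point of a walk on [D -> nat] started at [k] that
    increments, for each [d] of the list in turn, the coordinate [d] with
    probability [p d].  Visiting every coordinate [n] times gives the Bernstein
    operator in several variables, in a form suited to induction. *)
Fixpoint walk (s : seq D) p h k : R :=
  if s is d :: s' then p d * walk s' p h (incr_at d k) + (1 - p d) * walk s' p h k
  else h k.

Lemma walk_cst s p (a : R) k : walk s p (fun=> a) k = a.
Proof. by elim: s k => [|d s IH] k //=; rewrite !IH; ring. Qed.

Lemma walk_lin s p (a b : R) h h' k :
  walk s p (fun k => a * h k + b * h' k) k = a * walk s p h k + b * walk s p h' k.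
Proof. by elim: s k => [|d s IH] k //=; rewrite !IH; ring. Qed.

Lemma walk_sum s p (F : D -> (D -> nat) -> R) k :
  walk s p (fun k => \sum_e F e k) k = \sum_e walk s p (F e) k.
Proof.
elim: s k => [|d s IH] k //=.
by rewrite !IH !mulr_sumr -big_split.
Qed.

Lemma walk_le s p h h' k : (forall d, 0 <= p d <= 1) -> (forall k, h k <= h' k) ->
  walk s p h k <= walk s p h' k.
Proof.
move=> p01 hh'; elim: s k => [|d s IH] k //=.
have /andP[p0 p1] := p01 d.
by rewrite lerD// ler_wpM2l// subr_ge0.
Qed.

(** The second moment of a binomial variable about an arbitrary centre [a]; each
    visit to [e] contributes one Bernoulli variance. *)
Lemma walk_sqr s p e (a : R) k :
  walk s p (fun k => ((k e)%:R - a) ^+ 2) k =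
  ((k e)%:R + (count_mem e s)%:R * p e - a) ^+ 2
  + (count_mem e s)%:R * (p e * (1 - p e)).
Proof.
elim: s k => [|d s IH] k /=; first by rewrite !mul0r !addr0.
rewrite !IH /incr_at (eq_sym e); have [->|de] := eqVneq d e; rewrite !natrD /=.
  by ring.
by ring.
Qed.

Lemma trig_walk s (p : (D -> R) -> D -> R) h k :
  (forall d, trig_poly (fun x => p x d)) -> trig_poly (fun x => walk s (p x) h k).
Proof.
move=> tp; elim: s k => [|d s IH] k /=; first exact: trig_cst.
apply: trigD; apply: trigM => //.
rewrite (_ : (fun x => _) = fun x => 1 * 1 + (-1) * p x d).
  by apply: (trig_lin 1 (-1)) => //; exact: trig_cst.
by apply/funext => x; ring.
Qed.

Lemma exists_uniform_seq n : exists s : seq D, forall e, count_mem e s = n.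
Proof.
exists (flatten (nseq n (enum D))) => e; elim: n => //= n IH.
by rewrite count_cat IH (count_uniq_mem _ (enum_uniq D)) mem_enum add1n.
Qed.

End Walk.

Section Approximation.
Context {R : realType} {D : finType} (g : (D -> R) -> R) (B : R).
Hypothesis gB : forall x, `|g x| <= B.
Hypothesis glip : forall M : R, 0 < M -> exists2 L : R, 0 <= L &
  forall x y : D -> R, (forall d, `|x d| <= M) -> (forall d, `|y d| <= M) ->
  `|g x - g y| <= L * \sum_d `|x d - y d|.

(** Bernstein approximation in the variables [sin (x d / M)].  The approximating
    function is bounded by [B] on the whole space, so that outside a large cube
    the error is absorbed by the quadratic term. *)
Lemma trig_poly_approx (e : R) : 0 < e ->
  exists2 p, trig_poly p & forall x, `|g x - p x| <= e * (1 + \sum_d x d ^+ 2).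
Proof.
move=> e0.
have B0 : 0 <= B by apply: le_trans (gB (fun=> 0)).
(* outside the cube of half-width [M] the trivial bound [2 * B] suffices *)
pose M : R := 2 * B / e + 1.
have M0 : 0 < M by rewrite ltr_wpDl// divr_ge0 ?mulr_ge0// ltW.
have MB : 2 * B <= e * M ^+ 2.
  have : 2 * B <= e * M.
    have -> : e * M = 2 * B + e by rewrite /M; field; rewrite gt_eqF.
    by rewrite lerDl ltW.
  have : e * M <= e * M ^+ 2.
    by rewrite (ler_wpM2l (ltW e0))// expr2 (ler_peMl (ltW M0))// lerDr divr_ge0 ?mulr_ge0 ?(ltW e0).
  by lra.
have [L L0 Lip] := glip M0.
have [iv ivI ivL] : exists2 iv : R -> R, forall v, -1 <= iv v <= 1 &
    forall v x, -1 <= x <= 1 -> cos 1 * `|x - iv v| <= `|sin x - v|.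
  have /choice[iv H] : forall v : R, exists y : R, -1 <= y <= 1 /\
      forall x, -1 <= x <= 1 -> cos 1 * `|x - y| <= `|sin x - v|.
    by move=> v; have [y ? ?] := sin_left_inverse v; exists y.
  by exists iv => v; have [] := H v.
have c1 : 0 < cos (1 : R) by exact: cos1_gt0.
(* [C] is the Lipschitz constant of the passage from the empirical frequencies
   [k d / n] to the nodes; [n] is such that the mean deviation of a frequency is at
   most [2 * eta] *)
pose C : R := 2 * M / cos 1.
have C0 : 0 <= C by rewrite divr_ge0 ?mulr_ge0// ltW.
pose A : R := L * C * #|D|%:R.
have A0 : 0 <= A by rewrite /A mulr_ge0// mulr_ge0.
pose eta : R := e / (2 * (A + 1)).
have A1 : 0 < A + 1 by lra.
have eta0 : 0 < eta by rewrite divr_gt0// mulr_gt0.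
have etaA : A * (2 * eta) <= e.
  have -> : 2 * eta = e / (A + 1) by rewrite /eta; field; rewrite gt_eqF.
  by rewrite mulrA ler_pdivrMr// mulrC (ler_wpM2l (ltW e0))// lerDl.
pose n := (Num.bound (eta ^- 2)).+1.
have n0 : 0 < n%:R :> R by rewrite ltr0n.
have nE : n%:R^-1 <= eta ^+ 2 :> R.
  rewrite -[leRHS]invrK lef_pV2 ?posrE ?invr_gt0 ?exprn_gt0// /n -natr1.
  apply: (@le_trans _ _ (Num.bound (eta ^- 2))%:R); last by rewrite lerDl.
  by apply/ltW/archi_boundP; rewrite invr_ge0 exprn_ge0// ltW.
pose p (x : D -> R) (d : D) : R := (1 + sin (x d / M)) / 2.
have p01 x d : 0 <= p x d <= 1.
  have := sin_le1 (x d / M); have := sin_geN1 (x d / M).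
  by rewrite /p => ? ?; apply/andP; split; lra.
pose node (k : D -> nat) (d : D) : R := M * iv (2 * (k d)%:R / n%:R - 1).
have nodeM k d : `|node k d| <= M.
  rewrite /node normrM gtr0_norm// (ler_piMr (ltW M0))// ler_norml.
  exact: ivI.
have [s sn] := @exists_uniform_seq D n.
pose q x := walk s (p x) (fun k => g (node k)) (fun=> 0%N).
exists q.
  apply: trig_walk => d.
  rewrite (_ : (fun x => _) = fun x =>
    2^-1 * 1 + 2^-1 * cos (\sum_e' (e' == d)%:R / M * x e' + (- (pi / 2)))).
    by apply: trig_lin; [exact: trig_cst|exact: (@trig_cos _ _ (fun e' => (e' == d)%:R / M))].
  apply/funext => x; rewrite (bigD1 d)//= eqxx big1 ?addr0; last first.
    by move=> e' /negPf ->; rewrite mul0r mul0r.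
  rewrite cosBpihalf /p (_ : true%:R / M * x d = x d / M); first by field.
  by rewrite mulrAC mul1r.
move=> x.
have -> : g x - q x = walk s (p x) (fun k => g x - g (node k)) (fun=> 0%N).
  rewrite (_ : (fun k => g x - g (node k)) = fun k => g x * 1 + (-1) * g (node k)).
    by rewrite walk_lin walk_cst /q; ring.
  by apply/funext => k; ring.
have norm_walk (h h' : (D -> nat) -> R) : (forall k, `|h k| <= h' k) ->
    `|walk s (p x) h (fun=> 0%N)| <= walk s (p x) h' (fun=> 0%N).
  move=> hh'; rewrite ler_norml; apply/andP; split; last first.
    by apply: walk_le => // k; apply: le_trans (ler_norm _) _.
  rewrite -[leLHS]mul1r mulrN -mulNr.
  rewrite -[leLHS]addr0 -(mul0r (walk s (p x) h' (fun=> 0%N))) -walk_lin.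
  apply: walk_le => // k; rewrite mul0r addr0 mulN1r lerNl.
  by apply: le_trans (hh' k); rewrite -normrN ler_norm.
have [xM|] := pselect (forall d, `|x d| <= M); last first.
  move=> /existsNP[d /negP]; rewrite -ltNge => xdM.
  apply: le_trans (norm_walk _ (fun=> 2 * B) _) _.
    move=> k; apply: le_trans (ler_normB _ _) _.
    by have := gB x; have := gB (node k); lra.
  rewrite walk_cst; apply: le_trans MB _; rewrite (ler_wpM2l (ltW e0))//.
  apply: (@le_trans _ _ (x d ^+ 2)).
    by rewrite -[leRHS]real_normK ?num_real// lerXn2r ?nnegrE// ltW.
  rewrite (bigD1 d)//= addrCA lerDl addr_ge0// sumr_ge0// => d' _.
  exact: sqr_ge0.
apply: le_trans (norm_walk _ (fun k => \sum_d (L * C * eta * 1 +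
    (L * C / eta / n%:R ^+ 2) * ((k d)%:R - n%:R * p x d) ^+ 2)) _) _.
  move=> k; apply: le_trans (Lip _ _ xM (nodeM k)) _.
  rewrite mulr_sumr; apply: ler_sum => d _.
  set u := (k d)%:R - n%:R * p x d.
  have h1 : `|x d - node k d| <= C * `|u / n%:R|.
    have -> : x d - node k d = M * (x d / M - iv (2 * (k d)%:R / n%:R - 1)).
      by rewrite /node; field; rewrite gt_eqF.
    rewrite normrM gtr0_norm//.
    have -> : C * `|u / n%:R| = M * ((2 * `|u / n%:R|) / cos 1).
      by rewrite /C; field; rewrite gt_eqF.
    rewrite (ler_wpM2l (ltW M0))// ler_pdivlMr// mulrC.
    have /ivL : -1 <= x d / M <= 1.
      by rewrite -ler_norml normrM normfV (gtr0_norm M0) ler_pdivrMr// mul1r.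
    move=> /(_ (2 * (k d)%:R / n%:R - 1)) h; apply: le_trans h _.
    rewrite -[X in _ <= _ * X]normrN -[2 in leRHS]gtr0_norm// -normrM.
    rewrite le_eqVlt; apply/orP; left; apply/eqP; congr (`|_|).
    by rewrite /u /p; field; rewrite gt_eqF.
  (* arithmetic-geometric mean inequality: the first moment is replaced by the
     second, which [walk_sqr] computes *)
  have h2 : `|u / n%:R| <= eta + (u / n%:R) ^+ 2 / eta.
    rewrite -(ler_pM2l eta0) mulrDr [eta * (_ / eta)]mulrC divfK ?gt_eqF//.
    rewrite -[(u / n%:R) ^+ 2]real_normK ?num_real//.
    by have := sqr_ge0 (`|u / n%:R| - eta); have := normr_ge0 (u / n%:R); nra.
  apply: (@le_trans _ _ (L * (C * (eta + (u / n%:R) ^+ 2 / eta)))).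
    by rewrite ler_wpM2l// (le_trans h1)// ler_wpM2l.
  rewrite le_eqVlt; apply/orP; left; apply/eqP.
  by field; rewrite !gt_eqF.
rewrite walk_sum.
apply: (@le_trans _ _ (\sum_(d : D) (L * C * (2 * eta)))); last first.
  have -> : \sum_(d : D) (L * C * (2 * eta)) = A * (2 * eta).
    by rewrite sumr_const /A -[LHS]mulr_natr; ring.
  apply: le_trans etaA _.
  by rewrite (ler_peMr (ltW e0))// lerDl sumr_ge0// => d _; rewrite sqr_ge0.
apply: ler_sum => d _; rewrite walk_lin walk_cst walk_sqr sn mulr1 add0r subrr.
rewrite expr0n/= add0r.
have -> : L * C / eta / n%:R ^+ 2 * (n%:R * (p x d * (1 - p x d))) =
    (L * C) * (n%:R^-1 / eta * (p x d * (1 - p x d))).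
  by field; rewrite !gt_eqF.
rewrite -mulrDr (ler_wpM2l (mulr_ge0 L0 C0))//.
have h1 : n%:R^-1 / eta <= eta by rewrite ler_pdivrMr// -expr2.
have h2 : p x d * (1 - p x d) <= 1 by have /andP[? ?] := p01 x d; nra.
have h3 : 0 <= p x d * (1 - p x d) by have /andP[? ?] := p01 x d; nra.
have h4 : 0 <= n%:R^-1 / eta by rewrite divr_ge0 ?invr_ge0// ltW.
have : n%:R^-1 / eta * (p x d * (1 - p x d)) <= eta * 1 by apply: ler_pM.
by lra.
Qed.

End Approximation.

(** * The characteristic function of the normal law *)

Section NormalIntegrals.
Context {R : realType} (sigma : R).
Hypothesis sigma0 : sigma != 0.

Local Notation mu := (@lebesgue_measure R).
Local Notation pdf := (normal_pdf 0 sigma).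

Lemma ge0_integral_normal_prob (f : R -> \bar R) :
  measurable_fun [set: R] f -> (forall x, (0 <= f x)%E) ->
  (\int[normal_prob 0 sigma]_x f x = \int[mu]_x (f x * (pdf x)%:E))%E.
Proof.
move=> mf f0; have dom := normal_prob_dominates 0 sigma.
rewrite -(Radon_Nikodym_SigmaFinite.change_of_variables dom f0 measurableT mf).
have mpdf : measurable_fun [set: R] (EFin \o pdf).
  by apply/measurable_EFinP; exact: measurable_normal_pdf.
apply: ae_eq_integral => //.
- apply: emeasurable_funM => //; apply: (measurable_int mu).
  exact: Radon_Nikodym_SigmaFinite.f_integrable.
- exact: emeasurable_funM.
apply: ae_eqe_mul2l; apply: integral_ae_eq => //.
- exact: Radon_Nikodym_SigmaFinite.f_integrable.
- by move=> E _ mE; rewrite -Radon_Nikodym_SigmaFinite.f_integral.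
Qed.

Let s2 : 0 < sigma ^+ 2. Proof. by rewrite exprn_even_gt0. Qed.

Let tau : R := Num.sqrt 2 * sigma.

Let tau0 : tau != 0.
Proof. by rewrite mulf_neq0// gt_eqF// sqrtr_gt0. Qed.

Let domc : R := normal_peak sigma * (4 * sigma ^+ 2) / normal_peak tau.

Let domc0 : 0 <= domc.
Proof.
have s4 : 0 <= 4 * sigma ^+ 2 by rewrite mulr_ge0// (ltW s2).
by rewrite /domc; apply: divr_ge0 (normal_peak_ge0 _); exact: mulr_ge0 (normal_peak_ge0 _) s4.
Qed.

(* [u <= expR u] at [u = x ^+ 2 / (4 * sigma ^+ 2)] *)
Let sqr_pdf_le x : x ^+ 2 * pdf x <= domc * normal_pdf 0 tau x.
Proof.
rewrite !normal_pdfE// /domc.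
have -> : normal_peak sigma * (4 * sigma ^+ 2) / normal_peak tau *
   (normal_peak tau * normal_fun 0 tau x) =
   normal_peak sigma * (4 * sigma ^+ 2 * normal_fun 0 tau x).
  by field; rewrite gt_eqF// normal_peak_gt0.
rewrite mulrCA ler_wpM2l ?normal_peak_ge0// /normal_fun subr0.
set u := x ^+ 2 / (4 * sigma ^+ 2).
have -> : - x ^+ 2 / (sigma ^+ 2 *+ 2) = - u - u.
  by rewrite /u; field; rewrite sigma0.
have -> : - x ^+ 2 / (tau ^+ 2 *+ 2) = - u.
  by rewrite /u /tau exprMn sqr_sqrtr//; field; rewrite sigma0.
have -> : x ^+ 2 = 4 * sigma ^+ 2 * u by rewrite /u; field; rewrite sigma0.
have s4 : 0 <= 4 * sigma ^+ 2 by rewrite mulr_ge0// (ltW s2).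
rewrite -[leLHS]mulrA (ler_wpM2l s4)//.
rewrite expRD mulrA ler_piMl ?expR_ge0// expRN ler_pdivrMr ?expR_gt0// mul1r.
by have := expR_ge1Dx u; lra.
Qed.

Lemma integrable_normal_sqr : mu.-integrable [set: R] (fun x => (x ^+ 2 * pdf x)%:E).
Proof.
apply: (@le_integrable _ _ _ mu _ measurableT _ (fun x => (domc * normal_pdf 0 tau x)%:E)).
- by apply/measurable_EFinP/measurable_funM; [exact: measurable_funX|exact: measurable_normal_pdf].
- move=> x _; rewrite !abse_EFin lee_fin !ger0_norm ?sqr_pdf_le//.
  + exact: mulr_ge0 domc0 (normal_pdf_ge0 _ _ _).
  + exact: mulr_ge0 (sqr_ge0 _) (normal_pdf_ge0 _ _ _).
- exact: (integrableZl measurableT domc (integrable_normal_pdf 0 tau)).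
Qed.

Lemma integrable_normal_dom :
  mu.-integrable [set: R] (fun x => ((1 + x ^+ 2) * pdf x)%:E).
Proof.
rewrite (_ : (fun x => _) = (fun x => (pdf x)%:E + (x ^+ 2 * pdf x)%:E)%E).
  exact: (integrableD measurableT (integrable_normal_pdf 0 sigma) integrable_normal_sqr).
by apply/funext => x; rewrite mulrDl mul1r EFinD.
Qed.

Lemma integrable_normal_le (f : R -> R) (C : R) : measurable_fun [set: R] f ->
  (forall x, `|f x| <= C * (1 + x ^+ 2)) ->
  mu.-integrable [set: R] (fun x => (f x * pdf x)%:E).
Proof.
move=> mf fC.
apply: (@le_integrable _ _ _ mu _ measurableT _ (fun x => (C * ((1 + x ^+ 2) * pdf x))%:E)).
- by apply/measurable_EFinP/measurable_funM => //; exact: measurable_normal_pdf.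
- move=> x _; rewrite !abse_EFin lee_fin normrM (ger0_norm (normal_pdf_ge0 _ _ _)).
  rewrite mulrA; apply: le_trans (ler_norm _).
  by rewrite ler_wpM2r ?normal_pdf_ge0.
- exact: (integrableZl measurableT C integrable_normal_dom).
Qed.

Lemma is_derive_normal_pdf (x : R) : is_derive x 1 pdf (- x / sigma ^+ 2 * pdf x).
Proof.
have E : pdf = (fun y => normal_peak sigma * expR (- (2 * sigma ^+ 2)^-1 * y ^+ 2)).
  apply/funext => y; rewrite normal_pdfE// /normal_fun subr0; congr (_ * expR _).
  by field; rewrite sigma0.
rewrite E; apply: is_derive_eq; rewrite /GRing.scale/=.
by field; rewrite sigma0.
Qed.

Let norm_le_1Dsqr (x : R) : `|x| <= 1 + x ^+ 2.
Proof.
rewrite -real_normK ?num_real//.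
by have := sqr_ge0 (`|x| - 1); have := normr_ge0 x; nra.
Qed.

Let norm_sin_le (x y : R) : `|- x * sin y| <= 1 + x ^+ 2.
Proof.
apply: le_trans (norm_le_1Dsqr x).
by rewrite normrM normrN ler_piMr// sin_max.
Qed.

Let trig_le (t x : R) (a : R) : `|t * cos (t * x + a) - x / sigma ^+ 2 * sin (t * x + a)|
  <= (`|t| + sigma ^- 2) * (1 + x ^+ 2).
Proof.
apply: le_trans (ler_normB _ _) _; rewrite mulrDl; apply: lerD.
  rewrite normrM; apply: ler_pM => //; apply: le_trans (cos_max _) _.
  by rewrite lerDl sqr_ge0.
have i0 : 0 <= sigma ^- 2 by rewrite invr_ge0 ltW.
apply: (@le_trans _ _ (`|x| * sigma ^- 2)).
  by rewrite !normrM (ger0_norm i0) ler_piMr ?sin_max// mulr_ge0.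
by rewrite mulrC (ler_wpM2l i0)// norm_le_1Dsqr.
Qed.

Let mtrig (t a : R) : measurable_fun [set: R]
  (fun x => t * cos (t * x + a) - x / sigma ^+ 2 * sin (t * x + a)).
Proof.
apply: continuous_measurable_fun => x.
apply: (@differentiable_continuous _ R R).
by apply/derivable1_diffP; apply: ex_derive.
Qed.

(** Integration by parts: the integrand is the derivative of
    [x |-> sin (t * x + a) * pdf x], which vanishes at infinity. *)
Lemma normal_stein (t a : R) :
  \int[mu]_x ((t * cos (t * x + a) - x / sigma ^+ 2 * sin (t * x + a)) * pdf x) = 0.
Proof.
set h := fun x => _.
have ih : mu.-integrable [set: R] (EFin \o h).
  by apply: integrable_normal_le (trig_le t ^~ a); exact: mtrig.
pose F x := sin (t * x + a) * pdf x.
have dF (x : R) : is_derive x 1 F (h x).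
  have := is_derive_normal_pdf x => ?.
  rewrite /F; apply: is_derive_eq; rewrite /GRing.scale/= /h.
  by ring.
have cF : continuous F.
  by move=> x; apply/differentiable_continuous/derivable1_diffP; case: (dF x).
have ch : continuous h.
  move=> x; apply: (@differentiable_continuous _ R R).
  have := is_derive_normal_pdf x => ?.
  by apply/derivable1_diffP; apply: ex_derive.
have FTC n : (\int[mu]_(x in `[(- n.+1%:R)%R, n.+1%:R%R]) (h x)%:E =
    (F n.+1%:R - F (- n.+1%:R))%:E)%E.
  rewrite EFinB; apply: continuous_FTC2.
  - by apply: (@lt_trans _ _ 0); rewrite ?oppr_lt0 ltr0n.
  - exact: continuous_subspaceT.
  - split.
    + by move=> x xI; case: (dF x).
    + exact/cvg_at_right_filter/cF.
    + exact/cvg_at_left_filter/cF.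
  - by move=> x _; rewrite derive1E; apply: derive_val.
pose h_ (n : nat) : R -> \bar R := (EFin \o h) \_ `[(- n.+1%:R)%R, n.+1%:R%R].
have [_ _] : [/\ mu.-integrable [set: R] (EFin \o h),
  (fun n => \int[mu]_x `|h_ n x - (h x)%:E|)%E @ \oo --> 0%E &
  (fun n => \int[mu]_x (h_ n x))%E @ \oo --> (\int[mu]_x (h x)%:E)%E].
  apply: (@dominated_convergence _ _ _ mu _ measurableT h_ (EFin \o h) (fun x => `|(h x)%:E|%E)).
  - move=> n; apply/(measurable_restrict _ _ _)=> //.
    by apply: measurable_funTS; exact: (measurable_int mu).
  - exact: (measurable_int mu).
  - apply: aeW => x _; apply: cvg_near_cst.
    exists (Num.bound `|x|) => // n /= hn; rewrite /h_ patchE mem_set//=.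
    rewrite in_itv/= -ler_norml; apply: ltW; apply: lt_le_trans (archi_boundP _) _ => //.
    by rewrite ler_nat ltnW.
  - exact: integrable_abse.
  - apply: aeW => x n _; rewrite /h_ patchE; case: ifP => //= _.
    by rewrite normr0 lee_fin.
have -> : (fun n => \int[mu]_x (h_ n x))%E = (fun n => (F n.+1%:R - F (- n.+1%:R))%:E).
  by apply/funext => n; rewrite -FTC [RHS]integral_mkcond.
have F0 : (fun n => (F n.+1%:R - F (- n.+1%:R))%:E) @ \oo --> 0%E.
  pose M : R := domc * normal_peak tau.
  have pdfM x : x ^+ 2 * pdf x <= M.
    by apply: le_trans (sqr_pdf_le _) _; rewrite ler_wpM2l// normal_pdf_ub.
  have FM n : `|F n.+1%:R - F (- n.+1%:R)| <= (2 * M) * n.+1%:R^-1.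
    have one x : n.+1%:R ^+ 2 = x ^+ 2 -> `|F x| <= M * n.+1%:R^-1.
      move=> xE; rewrite normrM (ger0_norm (normal_pdf_ge0 _ _ _)).
      apply: le_trans (_ : pdf x <= _).
        by rewrite ler_piMl ?normal_pdf_ge0// sin_max.
      rewrite ler_pdivlMr ?ltr0n//; apply: le_trans (pdfM x).
      rewrite mulrC ler_wpM2r ?normal_pdf_ge0// -xE expr2 ler_peMl//.
      by rewrite (ler_nat _ 1).
    apply: le_trans (ler_normB _ _) _.
    have -> : 2 * M * n.+1%:R^-1 = M * n.+1%:R^-1 + M * n.+1%:R^-1 by ring.
    by apply: lerD; apply: one; rewrite ?sqrrN.
  apply: cvg_EFin; first exact: nearW.
  apply: norm_cvg0.
  apply: (@squeeze_cvgr _ _ _ _ (fun=> 0) (fun n => (2 * M) * n.+1%:R^-1)).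
  - by apply: nearW => n; rewrite normr_ge0 FM.
  - exact: cvg_cst.
  - rewrite -[X in _ --> X](mulr0 (2 * M)); apply: cvgMr.
    exact: cvg_harmonic.
move=> /(cvg_unique _ F0) E.
by rewrite /Rintegral -E.
Qed.

(** Differentiation under the integral sign and [normal_stein] give the equation
    [A' t = - sigma ^+ 2 * t * A t]. *)
Lemma integral_cos_normal (a : R) :
  \int[mu]_x (cos (x + a) * pdf x) = cos a * expR (- sigma ^+ 2 / 2).
Proof.
pose f (t x : R) : R := cos (t * x + a) * pdf x.
pose A (t : R) : R := \int[mu]_x (f t x).
pose A' (t : R) : R := \int[mu]_x (- x * sin (t * x + a) * pdf x).
have mcos t : measurable_fun [set: R] (fun x => cos (t * x + a)).
  apply: continuous_measurable_fun => x.
  apply: (@differentiable_continuous _ R R).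
  by apply/derivable1_diffP; apply: ex_derive.
have icos t : mu.-integrable [set: R] (EFin \o f t).
  apply: (@integrable_normal_le _ 1) => // x.
  by rewrite mul1r (le_trans (cos_max _))// lerDl sqr_ge0.
have df (t x : R) : is_derive t 1 (f ^~ x) (- x * sin (t * x + a) * pdf x).
  by rewrite /f; apply: is_derive_eq; rewrite /GRing.scale/=; ring.
have dA (t : R) : is_derive t 1 A (A' t).
  have tI : [set` `](t - 1), (t + 1)[] t by rewrite /= in_itv/=; apply/andP; split; lra.
  have G0 x : 0 <= (1 + x ^+ 2) * pdf x.
    by rewrite mulr_ge0 ?normal_pdf_ge0// addr_ge0 ?sqr_ge0.
  have dd (t' x : R) : partial1of2 f t' x = - x * sin (t' * x + a) * pdf x.
    by rewrite partial1of2E; have := df t' x => ?; rewrite derive_val.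
  have GB (s x : R) : [set` `](t - 1), (t + 1)[] s -> setT x ->
      `|partial1of2 f s x| <= (1 + x ^+ 2) * pdf x.
    move=> _ _; rewrite dd normrM (ger0_norm (normal_pdf_ge0 _ _ _)).
    by rewrite ler_wpM2r ?normal_pdf_ge0.
  have derf (s x : R) : [set` `](t - 1), (t + 1)[] s -> setT x -> derivable (f ^~ x) s 1.
    by move=> _ _; case: (df s x).
  have := @derivable_under_integral R _ _ mu f setT measurableT t _ _ tI
    (fun s _ => icos s) derf _ G0 integrable_normal_dom GB.
  move=> dA; apply: DeriveDef => //.
  rewrite -derive1E (@differentiation_under_integral R _ _ mu f setT measurableT t _ _ tI
    (fun s _ => icos s) derf _ G0 integrable_normal_dom GB).
  by apply: eq_Rintegral => x _; rewrite -dd.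
have A'E (t : R) : A' t + sigma ^+ 2 * t * A t = 0.
  have := normal_stein t a => E.
  rewrite /A' /A -RintegralZl// -RintegralD//.
  - rewrite -[RHS](mulr0 (sigma ^+ 2)) -[in RHS]E -RintegralZl//.
      by apply: eq_Rintegral => x _; rewrite /f; field; rewrite sigma0.
    by apply: integrable_normal_le (trig_le t ^~ a); exact: mtrig.
  - apply: (@integrable_normal_le _ 1).
      apply: continuous_measurable_fun => x.
      apply: (@differentiable_continuous _ R R).
      by apply/derivable1_diffP; apply: ex_derive.
    by move=> x; rewrite mul1r.
  - rewrite (_ : EFin \o _ = (fun x => (sigma ^+ 2 * t)%:E * (EFin \o f t) x)%E).
      exact: integrableZl.
    by apply/funext => x; rewrite /= EFinM.
have := @gaussian_ode R A A' (sigma ^+ 2) 0 (ltW s2) (lexx _) (fun t _ => dA t).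
have -> : A 0 = cos a.
  rewrite /A /f; under eq_Rintegral do rewrite mul0r add0r.
  rewrite RintegralZl//; last exact: integrable_normal_pdf.
  by rewrite /Rintegral integral_normal_pdf mulr1.
have -> : A 1 = \int[mu]_x (cos (x + a) * pdf x).
  by apply: eq_Rintegral => x _; rewrite /f mul1r.
move=> H; apply/eqP; rewrite -subr_eq0 -normr_le0; apply: H => t _.
by rewrite A'E normr0.
Qed.

End NormalIntegrals.

(** * Expectations of bounded and of normal variables *)

Section BoundedIntegrals.
Context d (T : measurableType d) {R : realType} (P : probability T R).
Implicit Types (f g : T -> R).

Lemma integrable_bounded f (C : R) : measurable_fun setT f ->
  (forall x, `|f x| <= C) -> P.-integrable setT (EFin \o f).
Proof.
move=> mf fC; apply: measurable_bounded_integrable => //.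
  exact: le_lt_trans (probability_le1 P measurableT) (ltry _).
by exists C; split; [rewrite num_real|move=> M CM x _; exact: le_trans (fC x) (ltW CM)].
Qed.

Lemma Rintegral_prob_cst (C : R) : \int[P]_(_ in setT) C = C.
Proof.
rewrite Rintegral_cst// [X in fine X](_ : _ = 1%E) ?mulr1//.
exact: probability_setT.
Qed.

Lemma Rintegral_lin f g (u v : R) : P.-integrable setT (EFin \o f) ->
  P.-integrable setT (EFin \o g) ->
  \int[P]_x (u * f x + v * g x) = u * \int[P]_x f x + v * \int[P]_x g x.
Proof.
move=> fi gi; rewrite RintegralD ?RintegralZl//.
- exact: (integrableZl measurableT u fi).
- exact: (integrableZl measurableT v gi).
Qed.

Lemma integrable_lin f g (u v : R) : P.-integrable setT (EFin \o f) ->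
  P.-integrable setT (EFin \o g) ->
  P.-integrable setT (EFin \o (fun x => u * f x + v * g x)).
Proof.
move=> fi gi.
exact: (integrableD measurableT (integrableZl measurableT u fi) (integrableZl measurableT v gi)).
Qed.

Lemma Rintegral_dist_le f g h : P.-integrable setT (EFin \o f) ->
  P.-integrable setT (EFin \o g) -> P.-integrable setT (EFin \o h) ->
  (forall x, `|f x - g x| <= h x) ->
  `|\int[P]_x f x - \int[P]_x g x| <= \int[P]_x h x.
Proof.
move=> fi gi hi fgh; rewrite -RintegralB//.
have fgi : P.-integrable setT (EFin \o (f \- g)) by exact: (integrableB measurableT fi gi).
apply: le_trans (le_normr_Rintegral measurableT fgi) _.
apply: le_Rintegral => //.
  exact: (integrable_abse fgi).
by move=> x _; exact: fgh.
Qed.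

Lemma Rintegral_fsum (J : Type) (s : seq J) (F : J -> T -> R) :
  (forall j, P.-integrable setT (EFin \o F j)) ->
  P.-integrable setT (EFin \o (fun x => \sum_(j <- s) F j x)) /\
  \int[P]_x (\sum_(j <- s) F j x) = \sum_(j <- s) \int[P]_x F j x.
Proof.
move=> Fi; elim: s => [|j s [IHi IHE]].
  split; last by under eq_Rintegral do rewrite big_nil; rewrite big_nil Rintegral_prob_cst.
  rewrite (_ : _ \o _ = EFin \o (fun=> 0)); last by apply/funext => x /=; rewrite big_nil.
  by apply: (@integrable_bounded _ 0) => // x; rewrite normr0.
rewrite (_ : (fun x => \sum_(i <- j :: s) F i x) =
  (fun x => 1 * F j x + 1 * \sum_(i <- s) F i x)); last first.
  by apply/funext => x; rewrite big_cons !mul1r.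
by split; [exact: integrable_lin|rewrite Rintegral_lin// big_cons IHE !mul1r].
Qed.

End BoundedIntegrals.

Section LawIntegrals.
Context d d' (T : measurableType d) (E : measurableType d') {R : realType}.
Context (P : probability T R) (X : T -> E) (Q : probability E R).
Hypothesis XQ : has_law P X Q.

Lemma ge0_integral_law (f : E -> \bar R) : measurable_fun setT f ->
  (forall x, (0 <= f x)%E) -> (\int[P]_w f (X w) = \int[Q]_x f x)%E.
Proof.
move=> mf f0; have [mX law] := XQ.
rewrite -(ge0_integral_pushforward mX P measurableT mf) => [|y _ //].
by apply: eq_measure_integral => A mA _; exact: law.
Qed.

End LawIntegrals.

Section NormalVariable.
Context d (T : measurableType d) {R : realType} (P : probability T R).

(** The second moment of the centred normal law of variance [v], left as an
    integral: it enters the proof as a finite constant. *)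
Definition normal_sqr (v : R) : R :=
  if v == 0 then 0
  else \int[@lebesgue_measure R]_x (x ^+ 2 * normal_pdf 0 (Num.sqrt v) x).

Context (X : T -> measurableTypeR R) (v : R).
Hypothesis v0 : 0 <= v.
Hypothesis XN : has_law P X (normal_law 0 v).

Let mX : measurable_fun setT X. Proof. by case: XN. Qed.

Let sv0 : v != 0 -> Num.sqrt v != 0.
Proof. by move=> vn0; rewrite gt_eqF// sqrtr_gt0 lt_neqAle eq_sym vn0. Qed.

Let ge0_integral_X (f : R -> R) : measurable_fun setT f -> (forall x, 0 <= f x) ->
  (\int[P]_w (f (X w))%:E = if v == 0%R then (f 0%R)%:E else
     \int[@lebesgue_measure R]_x (f x * normal_pdf 0%R (Num.sqrt v) x)%:E)%E.
Proof.
move=> mf f0; move: XN; rewrite /normal_law.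
have mf' : measurable_fun setT (EFin \o f) by exact/measurable_EFinP.
have f0' x : (0 <= (EFin \o f) x)%E by rewrite lee_fin.
case: ifPn => [_|vn0] law.
  pose D : probability (measurableTypeR R) R := dirac (0 : measurableTypeR R).
  have -> := ge0_integral_law (Q := D) law mf' f0'.
  by rewrite integral_dirac// diracT mul1e.
pose G : probability (measurableTypeR R) R := normal_prob 0 (Num.sqrt v).
have -> := ge0_integral_law (Q := G) law mf' f0'.
rewrite (ge0_integral_normal_prob (Num.sqrt v) mf' f0').
by apply: eq_integral.
Qed.

(** The change of variables is for nonnegative integrands, hence is applied to
    [1 + cos]. *)
Lemma Rintegral_cos_normal (a : R) :
  \int[P]_w cos (X w + a) = cos a * expR (- v / 2).
Proof.
have mc : measurable_fun setT (fun x : R => cos (x + a)).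
  apply: continuous_measurable_fun => x.
  apply: (@differentiable_continuous _ R R).
  by apply/derivable1_diffP; apply: ex_derive.
have ic : P.-integrable setT (EFin \o (fun w => cos (X w + a))).
  apply: (@integrable_bounded _ _ _ _ _ 1) => [|w]; last exact: cos_max.
  exact: (measurableT_comp mc mX).
have i1 : P.-integrable setT (EFin \o (fun=> 1 : R)).
  by apply: (@integrable_bounded _ _ _ _ _ 1) => // w; rewrite normr1.
have mf : measurable_fun setT (fun x : R => 1 + cos (x + a)).
  exact: measurable_funD.
have f0 x : 0 <= 1 + cos (x + a) by have := cos_geN1 (x + a); lra.
have E : \int[P]_w (1 + cos (X w + a)) = 1 + cos a * expR (- v / 2).
  rewrite {1}/Rintegral (ge0_integral_X mf f0); case: ifPn => [/eqP ->|vn0].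
    by rewrite add0r oppr0 mul0r expR0 mulr1.
  rewrite (_ : fine _ = \int[@lebesgue_measure R]_x
     (normal_pdf 0 (Num.sqrt v) x + cos (x + a) * normal_pdf 0 (Num.sqrt v) x)); last first.
    by congr fine; apply: eq_integral => x _; rewrite mulrDl mul1r.
  rewrite RintegralD//.
  - rewrite integral_cos_normal ?sv0// sqr_sqrtr//.
    by rewrite /Rintegral integral_normal_pdf.
  - exact: integrable_normal_pdf.
  - apply: (@integrable_normal_le _ _ (sv0 vn0) _ 1) => // x.
    by rewrite mul1r (le_trans (cos_max _))// lerDl sqr_ge0.
have := @Rintegral_lin _ _ _ P _ _ 1 1 i1 ic.
rewrite Rintegral_prob_cst.
under eq_Rintegral do rewrite !mul1r.
by rewrite E; lra.
Qed.

Lemma integrable_normal_variable_sqr :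
  P.-integrable setT (EFin \o (fun w => X w ^+ 2 : R)) /\
  \int[P]_w (X w ^+ 2 : R) = normal_sqr v.
Proof.
have mf : measurable_fun setT (fun x : R => x ^+ 2) by exact: measurable_funX.
have f0 (x : R) : 0 <= x ^+ 2 by exact: sqr_ge0.
have E := ge0_integral_X mf f0.
split; last first.
  by rewrite /Rintegral E /normal_sqr; case: ifP => // _; rewrite expr0n.
apply/integrableP; split.
  exact/measurable_EFinP/(measurableT_comp mf mX).
under eq_integral do rewrite /= ger0_norm ?sqr_ge0//.
rewrite E; case: ifPn => [_|vn0]; first exact: ltry.
have /integrableP[_] := integrable_normal_sqr (sv0 vn0).
apply: le_lt_trans; rewrite le_eqVlt; apply/orP; left; apply/eqP.
apply: eq_integral => x _ /=; congr EFin; rewrite ger0_norm//.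
exact: (mulr_ge0 (sqr_ge0 _) (normal_pdf_ge0 _ _ _)).
Qed.

End NormalVariable.

(** * Expectations of products of independent variables *)

Section Independence.
Context d d' (T : measurableType d) (E : measurableType d') {R : realType}.
Context (P : probability T R) {I : choiceType} (X : I -> T -> E).
Hypothesis mX : forall i, measurable_fun setT (X i).
Hypothesis indep : mutually_independent P X.

Definition bounded1 (f : E -> R) := measurable_fun setT f /\ forall x, `|f x| <= 1.

Let prod_le1 (s : seq I) (f : I -> E -> R) (w : T) : (forall i, bounded1 (f i)) ->
  `|\prod_(i <- s) f i (X i w)| <= 1.
Proof.
move=> f1; elim: s => [|i s IH]; first by rewrite big_nil normr1.
by rewrite big_cons normrM mulr_ile1//; have [_] := f1 i.
Qed.

Let mprod (s : seq I) (f : I -> E -> R) : (forall i, bounded1 (f i)) ->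
  measurable_fun setT (fun w => \prod_(i <- s) f i (X i w)).
Proof.
move=> f1; elim: s => [|i s IH].
  by under eq_fun do rewrite big_nil; exact: measurable_cst.
under eq_fun do rewrite big_cons.
by apply: measurable_funM => //; apply: measurableT_comp (mX i); have [] := f1 i.
Qed.

Let upd (i : I) (g : E -> R) (f : I -> E -> R) : I -> E -> R :=
  fun j => if j == i then g else f j.

Let upd_eq i g f : upd i g f i = g.
Proof. by rewrite /upd eqxx. Qed.

Let prod_upd i g f (s : seq I) (w : T) : i \notin s ->
  \prod_(j <- s) upd i g f j (X j w) = \prod_(j <- s) f j (X j w).
Proof.
move=> si; apply: eq_big_seq => j js; rewrite /upd.
by case: eqP => // ji; move: si; rewrite -ji js.
Qed.

Let upd1 i g f : bounded1 g -> (forall j, bounded1 (f j)) ->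
  forall j, bounded1 (upd i g f j).
Proof. by move=> g1 f1 j; rewrite /upd; case: ifP. Qed.

Let indic1 (A : set E) : measurable A -> bounded1 (\1_A : E -> R).
Proof.
move=> mA; split; first exact: measurable_indic.
by move=> x; rewrite indicE; case: (_ \in _); rewrite ?normr1// normr0.
Qed.

Let indep_indic (s : seq I) (A : I -> set E) : uniq s ->
  (forall i, measurable (A i)) ->
  \int[P]_w (\prod_(i <- s) \1_(A i) (X i w)) =
  \prod_(i <- s) \int[P]_w (\1_(A i) (X i w) : R).
Proof.
move=> us mA; pose J : {fset I} := [fset i in s]%fset.
have perm : perm_eq J s.
  by apply: uniq_perm => //; move=> i; rewrite /J inE.
have mXA i : measurable (X i @^-1` A i) by rewrite -[_ @^-1` _]setTI; exact: mX.
have int1 i : \int[P]_w (\1_(A i) (X i w) : R) = fine (P (X i @^-1` A i)).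
  rewrite /Rintegral; congr fine.
  transitivity (\int[P]_w (\1_(X i @^-1` A i) w)%:E)%E.
    by apply: eq_integral => w _; rewrite !indicE.
  by rewrite integral_indic// setIT.
have -> : \int[P]_w (\prod_(i <- s) \1_(A i) (X i w)) =
    fine (P (\bigcap_(i in [set` J]) (X i @^-1` A i))).
  rewrite /Rintegral; congr fine.
  transitivity (\int[P]_w (\1_(\bigcap_(i in [set` J]) (X i @^-1` A i)) w)%:E)%E.
    apply: eq_integral => w _; congr EFin; rewrite indicE.
    have [wJ|wJ] := boolP (w \in _).
      rewrite big_seq big1// => i is_; rewrite indicE mem_set//.
      by move: wJ; rewrite inE => /(_ i); apply; rewrite /= inE.
    have [i is_ wi] : exists2 i, i \in s & ~ A i (X i w).
      apply: contrapT => H; move/negP: wJ; apply; rewrite inE => i /=.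
      rewrite inE => is_; apply: contrapT => wi; apply: H; by exists i.
    apply/eqP; rewrite prodf_seq_eq0; apply/hasP; exists i => //=.
    by rewrite indicE memNset.
  rewrite integral_indic// ?setIT//.
  by apply: fin_bigcap_measurable => // ; exact: finite_fset.
rewrite (indep J mA) (perm_big _ perm)/=.
under [RHS]eq_bigr do rewrite int1.
elim: s {us J perm} => [|i s IH]; first by rewrite !big_nil.
by rewrite !big_cons fineM ?IH// ?prode_fin_num// => *; exact: fin_num_measure.
Qed.

(* Rounding down to a multiple of [1 / m] *)
Let level (m : nat) (f : E -> R) (j : nat) : set E :=
  f @^-1` `[j%:R / m%:R - 1, j.+1%:R / m%:R - 1[.
Let step (m : nat) (f : E -> R) (x : E) : R :=
  \sum_(j < (2 * m).+1) (j%:R / m%:R - 1) * \1_(level m f j) x.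

Let step_approx m f x : (0 < m)%N -> bounded1 f -> `|f x - step m f x| <= m%:R^-1.
Proof.
move=> m0 [_ f1]; have mR : 0 < m%:R :> R by rewrite ltr0n.
have /andP[fx1 fx2] : -1 <= f x <= 1 by rewrite -ler_norml.
have y0 : 0 <= (f x + 1) * m%:R by rewrite mulr_ge0//; lra.
pose k := Num.truncn ((f x + 1) * m%:R).
have kE j : (x \in level m f j) = (j == k).
  rewrite eq_sym truncn_eq//; apply/idP/idP.
    rewrite inE /level/= in_itv/= lerBlDr ltrBrDr ler_pdivrMr// ltr_pdivlMr//.
  by rewrite inE /level/= in_itv/= lerBlDr ltrBrDr ler_pdivrMr// ltr_pdivlMr.
have kk : (k < (2 * m).+1)%N.
  rewrite ltnS -(ler_nat R); apply: le_trans (_ : (f x + 1) * m%:R <= _).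
    by rewrite truncn_le.
  by rewrite natrM ler_wpM2r//; lra.
have -> : step m f x = k%:R / m%:R - 1.
  rewrite /step (bigD1 (Ordinal kk))//= big1 ?addr0.
    by rewrite indicE kE eqxx mulr1.
  move=> j /negPf jk; rewrite indicE kE.
  by move: jk; rewrite -val_eqE/= => ->; rewrite mulr0.
have /andP[k1 k2] := truncn_itv y0; rewrite -/k in k1 k2.
have -> : f x - (k%:R / m%:R - 1) = ((f x + 1) * m%:R - k%:R) / m%:R.
  by field; rewrite gt_eqF.
rewrite normrM (gtr0_norm (x := m%:R^-1)) ?invr_gt0// ler_piMl ?invr_ge0//.
by rewrite ger0_norm ?subr_ge0//; move: k2; rewrite -natr1; lra.
Qed.

Let mlevel m f j : bounded1 f -> measurable (level m f j).
Proof.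
by move=> [mf _]; rewrite /level -[_ @^-1` _]setTI; apply: mf => //; exact: measurable_itv.
Qed.

Let bounded1_integrable (f : I -> E -> R) (s : seq I) : (forall i, bounded1 (f i)) ->
  P.-integrable setT (EFin \o (fun w => \prod_(i <- s) f i (X i w))).
Proof.
move=> f1; apply: (@integrable_bounded _ _ _ _ _ 1); first exact: mprod.
by move=> w; exact: prod_le1.
Qed.

(* [g] may be passed from indicators to bounded functions by uniform
   approximation with step functions *)
Let prod_step (i : I) (g : E -> R) (f : I -> E -> R) (s : seq I) (c : R) :
  bounded1 g -> (forall j, bounded1 (f j)) -> i \notin s -> `|c| <= 1 ->
  (forall A, measurable A ->
     \int[P]_w (\1_A (X i w) * \prod_(j <- s) f j (X j w)) =
     (\int[P]_w (\1_A (X i w) : R)) * c) ->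
  \int[P]_w (g (X i w) * \prod_(j <- s) f j (X j w)) =
  (\int[P]_w (g (X i w) : R)) * c.
Proof.
move=> g1 f1 si c1 H.
pose G w := \prod_(j <- s) f j (X j w).
have G1 w : `|G w| <= 1 by exact: prod_le1.
have mG : measurable_fun setT G by exact: mprod.
have ig h (hb : bounded1 h) : P.-integrable setT (EFin \o (fun w => h (X i w))).
  apply: (@integrable_bounded _ _ _ _ _ 1); last by move=> w; have [_] := hb.
  by apply: measurableT_comp (mX i); have [] := hb.
have igG h (hb : bounded1 h) : P.-integrable setT (EFin \o (fun w => h (X i w) * G w)).
  apply: (@integrable_bounded _ _ _ _ _ 1).
    by apply: measurable_funM => //; apply: measurableT_comp (mX i); have [] := hb.
  by move=> w; rewrite normrM mulr_ile1//; have [_] := hb.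
have key m : (0 < m)%N ->
    `|\int[P]_w (g (X i w) * G w) - (\int[P]_w (g (X i w) : R)) * c| <= 2 * m%:R^-1.
  move=> m0.
  have lev j : bounded1 (\1_(level m g j) : E -> R) by apply/indic1/mlevel.
  have [iS ES] := Rintegral_fsum (index_enum 'I_(2 * m).+1)
    (fun j => integrableZl measurableT (j%:R / m%:R - 1) (ig _ (lev j))).
  have [iSG ESG] := Rintegral_fsum (index_enum 'I_(2 * m).+1)
    (fun j => integrableZl measurableT (j%:R / m%:R - 1) (igG _ (lev j))).
  have icst : P.-integrable setT (EFin \o (fun=> m%:R^-1 : R)).
    by apply: (@integrable_bounded _ _ _ _ _ `|m%:R^-1|).
  have d1 : `|\int[P]_w (g (X i w) * G w) -
      \int[P]_w (\sum_(j < (2 * m).+1) (j%:R / m%:R - 1) * (\1_(level m g j) (X i w) * G w))|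
      <= m%:R^-1.
    rewrite -[leRHS](Rintegral_prob_cst P); apply: Rintegral_dist_le => //; first exact: igG.
    move=> w; have -> : \sum_(j < (2 * m).+1) (j%:R / m%:R - 1) * (\1_(level m g j) (X i w) * G w)
        = step m g (X i w) * G w.
      by rewrite /step mulr_suml; apply: eq_bigr => j _; rewrite mulrA.
    by rewrite -mulrBl normrM -[leRHS]mulr1 ler_pM// step_approx.
  have d2 : `|\int[P]_w (g (X i w) : R) -
      \int[P]_w (\sum_(j < (2 * m).+1) (j%:R / m%:R - 1) * \1_(level m g j) (X i w))|
      <= m%:R^-1.
    rewrite -[leRHS](Rintegral_prob_cst P); apply: Rintegral_dist_le => //; first exact: ig.
    by move=> w; exact: step_approx.
  set a := \int[P]_w (g (X i w) * G w); set b := \int[P]_w (g (X i w) : R).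
  set a' := (X in `|_ - X| <= _) in d1; set b' := (X in `|_ - X| <= _) in d2.
  have ab : a' = b' * c.
    rewrite /a' /b' ESG ES mulr_suml; apply: eq_bigr => j _.
    rewrite !RintegralZl//; [|exact: ig|exact: igG].
    by rewrite H ?mulrA//; exact: mlevel.
  have -> : a - b * c = (a - a') - (b - b') * c by rewrite ab; ring.
  apply: le_trans (ler_normB _ _) _; rewrite normrM mulr2n mulrDl mul1r lerD//.
  by rewrite -[leRHS]mulr1 ler_pM.
apply/eqP; rewrite -subr_eq0 -normr_le0; apply/ler_addgt0Pr => e e0; rewrite add0r.
pose m := (Num.bound (2 / e)).+1.
apply: le_trans (key m _) _ => //.
rewrite ler_pdivrMr ?ltr0n// mulrC -ler_pdivrMr//.
apply: le_trans (ltW (archi_boundP _)) _; first by rewrite divr_ge0// ltW.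
by rewrite ler_nat leqnSn.
Qed.

(** Independence is the product rule for indicators.  The factors are replaced one
    at a time by bounded functions; [s1] lists the factors already replaced. *)
Lemma Rintegral_prod_indep (s : seq I) (f : I -> E -> R) : uniq s ->
  (forall i, bounded1 (f i)) ->
  \int[P]_w (\prod_(i <- s) f i (X i w)) = \prod_(i <- s) \int[P]_w (f i (X i w) : R).
Proof.
move=> us f1.
suff H (s1 s2 : seq I) (h : I -> E -> R) : uniq (s1 ++ s2) -> (forall i, bounded1 (h i)) ->
    (forall i, i \notin s1 -> exists2 A, measurable A & h i = \1_A) ->
    \int[P]_w (\prod_(i <- s1 ++ s2) h i (X i w)) =
    \prod_(i <- s1 ++ s2) \int[P]_w (h i (X i w) : R).
  pose h i := if i \in s then f i else \1_set0.
  have hb i : bounded1 (h i) by rewrite /h; case: ifP => // _; exact: indic1.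
  have := H s [::] h; rewrite cats0 => /(_ us hb) E'.
  rewrite (_ : \prod_(i <- s) \int[P]_w f i (X i w) =
      \prod_(i <- s) \int[P]_w h i (X i w)); last first.
    by apply: eq_big_seq => i is_; rewrite /h is_.
  rewrite -E'; last by move=> i /negPf is_; exists set0 => //; rewrite /h is_.
  by apply: eq_Rintegral => w _; apply: eq_big_seq => i is_; rewrite /h is_.
elim: s1 s2 h => [|i s1 IH] s2 h us' hb hA.
  have /choice[A hA'] : forall i, exists A, measurable A /\ h i = \1_A.
    by move=> i; have [A ? ?] := hA i erefl; exists A.
  have := indep_indic (A := A) us' (fun i => (hA' i).1).
  rewrite /= (_ : (fun w => _) = (fun w => \prod_(i <- s2) h i (X i w))); last first.
    by apply/funext => w; apply: eq_bigr => i _; rewrite (hA' i).2.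
  by move=> ->; apply: eq_bigr => i _; rewrite (hA' i).2.
move: us'; rewrite cat_cons cons_uniq => /andP[is_ us'].
under eq_Rintegral do rewrite big_cons.
rewrite big_cons; apply: prod_step => //.
  elim: (s1 ++ s2) => [|j u IHu]; first by rewrite big_nil normr1.
  rewrite big_cons normrM mulr_ile1//.
  have ih : P.-integrable setT (EFin \o (fun w => h j (X j w))).
    apply: (@integrable_bounded _ _ _ _ _ 1); last by move=> w; have [_] := hb j.
    by apply: measurableT_comp (mX j); have [] := hb j.
  apply: le_trans (le_normr_Rintegral measurableT ih) _.
  rewrite -[leRHS](Rintegral_prob_cst P); apply: le_Rintegral => //.
  - exact: (integrable_abse ih).
  - by apply: (@integrable_bounded _ _ _ _ _ 1) => // w; rewrite normr1.
  - by move=> w _; have [_] := hb j.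
move=> A mA.
have := IH (i :: s2) (upd i (\1_A : E -> R) h).
have si : i \notin s1 /\ i \notin s2 by move: is_; rewrite mem_cat negb_or => /andP[].
have pe : perm_eq (s1 ++ i :: s2) (i :: (s1 ++ s2)).
  by rewrite perm_catC cat_cons perm_cons perm_catC.
rewrite (perm_uniq pe) cons_uniq is_ us' => /(_ isT).
move=> /(_ (upd1 _ (indic1 mA) hb)).
have hA' : forall j, j \notin s1 -> exists2 A0 : set E, measurable A0 & upd i (\1_A : E -> R) h j = \1_A0.
  move=> j js; rewrite /upd; case: eqP => [_|/eqP ji]; first by exists A.
  by apply: hA; rewrite in_cons negb_or ji.
move=> /(_ hA').
rewrite (perm_big _ pe)/= big_cons upd_eq.
rewrite (_ : (fun w => \prod_(i0 <- s1 ++ i :: s2) upd i (\1_A : E -> R) h i0 (X i0 w)) =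
    (fun w => \1_A (X i w) * \prod_(j <- s1 ++ s2) h j (X j w))); last first.
  apply/funext => w; rewrite (perm_big _ pe)/= big_cons upd_eq; congr (_ * _).
  exact: prod_upd.
move=> ->; congr (_ * _); apply: eq_big_seq => j js; rewrite /upd.
by case: eqP => // ji; move: is_; rewrite -ji js.
Qed.

(** If the characteristic function of each independent summand is real, then the
    characteristic functions multiply.  The induction carries along a product of
    cosines and sines of the summands already split off by the addition formula. *)
Lemma Rintegral_cos_sum_indep (s : seq I) (y : I -> E -> R) (v : I -> R) (a : R) :
  uniq s -> (forall i, measurable_fun setT (y i)) ->
  (forall i b, i \in s -> \int[P]_w cos (y i (X i w) + b) = cos b * v i) ->
  \int[P]_w cos (\sum_(i <- s) y i (X i w) + a) = cos a * \prod_(i <- s) v i.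
Proof.
move=> us my yv.
have cosb b i : bounded1 (fun x => cos (y i x + b)).
  split; last by move=> x; exact: cos_max.
  apply: (@measurableT_comp _ _ _ _ _ _ (@cos R)).
    by apply: continuous_measurable_fun; exact: continuous_cos.
  exact: measurable_funD.
suff H (s1 s2 : seq I) (f : I -> E -> R) b : uniq (s1 ++ s2) -> {subset s2 <= s} ->
    (forall i, bounded1 (f i)) ->
    \int[P]_w (\prod_(i <- s1) f i (X i w) * cos (\sum_(i <- s2) y i (X i w) + b)) =
    \prod_(i <- s1) (\int[P]_w f i (X i w)) * (cos b * \prod_(i <- s2) v i).
  have := H [::] s (fun=> \1_set0) a us (fun _ => id) (fun=> indic1 measurable0).
  rewrite big_nil mul1r => <-; apply: eq_Rintegral => w _.
  by rewrite big_nil mul1r.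
elim: s2 s1 f b => [|i s2 IH] s1 f b.
  rewrite cats0 => us1 _ f1; rewrite -(Rintegral_prod_indep us1 f1) big_nil mulr1.
  under eq_Rintegral do rewrite big_nil add0r.
  by rewrite RintegralZr//; exact: bounded1_integrable.
have pe : perm_eq (s1 ++ i :: s2) (i :: (s1 ++ s2)).
  by rewrite perm_catC cat_cons perm_cons perm_catC.
rewrite (perm_uniq pe) cons_uniq => /andP[is12 us12] sub f1.
have is1 : i \notin s1 by move: is12; rewrite mem_cat negb_or => /andP[].
have us1 : uniq ((i :: s1) ++ s2) by rewrite cat_cons cons_uniq is12.
have sub2 : {subset s2 <= s} by move=> j js; apply: sub; rewrite in_cons js orbT.
pose g e i := fun x => cos (y i x + e).
have key e b' : \int[P]_w (\prod_(j <- i :: s1) upd i (g e i) f j (X j w) *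
      cos (\sum_(j <- s2) y j (X j w) + b')) =
    cos e * v i * \prod_(j <- s1) (\int[P]_w f j (X j w)) * (cos b' * \prod_(j <- s2) v j).
  rewrite (IH _ _ _ us1 sub2 (upd1 _ (cosb e i) f1)); congr (_ * _).
  rewrite big_cons upd_eq yv ?in_cons ?sub ?mem_head//; congr (_ * _).
  apply: eq_big_seq => j js; rewrite /upd; case: eqP => // ji.
  by move: is1; rewrite -ji js.
have E1 w : \prod_(j <- s1) f j (X j w) * cos (\sum_(j <- i :: s2) y j (X j w) + b) =
   1 * (\prod_(j <- i :: s1) upd i (g 0 i) f j (X j w) * cos (\sum_(j <- s2) y j (X j w) + b))
   + 1 * (\prod_(j <- i :: s1) upd i (g (pi / 2) i) f j (X j w) *
          cos (\sum_(j <- s2) y j (X j w) + (b - pi / 2))).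
  rewrite !big_cons !upd_eq (prod_upd _ _ _ is1) (prod_upd _ _ _ is1).
  rewrite /g addr0 [_ + (b - _)]addrA cosDpihalf cosBpihalf -[_ + _ + b]addrA cosD.
  by ring.
have ii e b' : P.-integrable setT (EFin \o (fun w =>
    \prod_(j <- i :: s1) upd i (g e i) f j (X j w) * cos (\sum_(j <- s2) y j (X j w) + b'))).
  apply: (@integrable_bounded _ _ _ _ _ 1); last first.
    move=> w; rewrite normrM mulr_ile1 ?cos_max//; apply: prod_le1.
    exact: upd1 _ (cosb e i) f1.
  apply: measurable_funM; first exact/mprod/(upd1 _ (cosb e i) f1).
  apply: (@measurableT_comp _ _ _ _ _ _ (@cos R)).
    by apply: continuous_measurable_fun; exact: continuous_cos.
  apply: measurable_funD => //; apply: measurable_sum => j.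
  exact: measurableT_comp (my j) (mX j).
under eq_Rintegral do rewrite E1.
rewrite Rintegral_lin// !key cos_pihalf cos0 big_cons.
by ring.
Qed.

End Independence.

(** * The joint characteristic function of the limit variables *)

Section LimitVariables.
Context {R : realType} {c : nat} (p : 'I_c -> R).
Hypothesis p0 : forall l, 0 < p l.
Hypothesis p1 : \sum_l p l = 1.

Lemma limit_cov_form (a : 'rV[R]_c) :
  (a *m limit_cov p *m a^T) ord0 ord0 =
  \sum_l a ord0 l ^+ 2 / p l - (\sum_l a ord0 l) ^+ 2.
Proof.
rewrite /limit_cov mulmxBr mulmxBl [LHS]mxE [X in _ + X]mxE; congr (_ - _).
  rewrite mxE; apply: eq_bigr => l _; rewrite mul_mx_diag !mxE.
  by rewrite mulrAC -expr2.
rewrite mulmxA -mulmxA -trmx_mul mxE big_ord1 [X in _ * X]mxE -expr2.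
by rewrite mxE; congr (_ ^+ 2); apply: eq_bigr => l _; rewrite !mxE mulr1.
Qed.

(** Cauchy-Schwarz inequality: the vector of the [Num.sqrt (p l)] has norm one. *)
Lemma limit_form_ge0 (t : 'I_c -> R) :
  0 <= \sum_l t l ^+ 2 - (\sum_l Num.sqrt (p l) * t l) ^+ 2.
Proof.
set m := \sum_l Num.sqrt (p l) * t l.
have -> : \sum_l t l ^+ 2 - m ^+ 2 = \sum_l (t l - m * Num.sqrt (p l)) ^+ 2.
  have E l : (t l - m * Num.sqrt (p l)) ^+ 2 =
      t l ^+ 2 - 2 * m * (Num.sqrt (p l) * t l) + m ^+ 2 * p l.
    by rewrite -{3}[p l]sqr_sqrtr ?(ltW (p0 l))//; ring.
  under [RHS]eq_bigr do rewrite E.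
  by rewrite big_split/= sumrB -!mulr_sumr p1 -/m; ring.
by apply: sumr_ge0 => l _; exact: sqr_ge0.
Qed.

Context d (T : measurableType d) (P : probability T R).
Context (Z : nat -> 'I_2 -> T -> c.-tuple (measurableTypeR R)).
Hypothesis hZmeas : forall k r, (1 <= k)%N -> measurable_fun [set: T] (Z k r).
Hypothesis hZ : forall k r, (1 <= k)%N -> is_mvnormal P (Z k r) 0 (limit_cov p).
Hypothesis hZindep : mutually_independent P (fun s : nat * 'I_2 => Z s.1.+1 s.2).

(** The limit of [rank_wave k r l]; the factor is such that the squares,
    weighted by the coefficients, are the terms of the limiting series. *)
Definition limit_var (w : T) (k : nat) (r : 'I_2) (l : 'I_c) : R :=
  Num.sqrt (p l / 2) * tnth (Z k r w) l.

Lemma law_combination k r (t : 'I_c -> R) : (1 <= k)%N ->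
  has_law P (fun w => \sum_l t l * limit_var w k r l : measurableTypeR R)
    (normal_law 0 (2^-1 * (\sum_l t l ^+ 2 - (\sum_l Num.sqrt (p l) * t l) ^+ 2))).
Proof.
move=> k1; pose a := \row_l (t l * Num.sqrt (p l / 2)).
have := hZ r k1 a; rewrite trmx0 mulmx0 mxE limit_cov_form.
have h (u : R) : Num.sqrt (u / 2) = Num.sqrt u / Num.sqrt 2.
  by rewrite mulrC sqrtrM ?invr_ge0// sqrtrV// mulrC.
rewrite (_ : (fun w => _) = (fun w => \sum_l t l * limit_var w k r l)); last first.
  apply/funext => w; apply: eq_bigr => l _; rewrite /limit_var mxE; ring.
congr has_law; congr normal_law.
rewrite mulrBr; congr (_ - _).
  rewrite mulr_sumr; apply: eq_bigr => l _; rewrite mxE exprMn sqr_sqrtr.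
    by field; rewrite gt_eqF.
  by rewrite divr_ge0// ltW.
have -> : 2^-1 = (Num.sqrt 2)^-1 ^+ 2 :> R by rewrite exprVn sqr_sqrtr.
rewrite -exprMn mulr_sumr; congr (_ ^+ 2); apply: eq_bigr => l _.
by rewrite mxE h; ring.
Qed.

(** The vectors [Z k r] are independent, so that the variances of the combinations
    for the different pairs [(k, r)] add up to [wave_var]. *)
Lemma Rintegral_cos_limit_var (K : nat) (t : 'I_K * 'I_2 * 'I_c -> R) (a : R) :
  \int[P]_w cos (\sum_d t d * limit_var w d.1.1.+1 d.1.2 d.2 + a) =
  cos a * expR (- wave_var p t / 2).
Proof.
pose t' (i : nat * 'I_2) (l : 'I_c) : R :=
  if insub i.1 is Some k then t (k, i.2, l) else 0.
have t'E (q : 'I_K * 'I_2) l : t' (q.1 : nat, q.2) l = t (q, l).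
  by rewrite /t'/= valK; case: q.
pose s := [seq (q.1 : nat, q.2) | q : 'I_K * 'I_2].
have us : uniq s.
  rewrite map_inj_uniq ?enum_uniq// => -[k r] [k' r'] /= [/ord_inj -> ->] //.
pose y (i : nat * 'I_2) (z : c.-tuple (measurableTypeR R)) : R :=
  \sum_l t' i l * (Num.sqrt (p l / 2) * tnth z l).
pose V (i : nat * 'I_2) : R :=
  2^-1 * (\sum_l t' i l ^+ 2 - (\sum_l Num.sqrt (p l) * t' i l) ^+ 2).
have my i : measurable_fun setT (y i).
  apply: measurable_sum => l; apply: measurable_funM => //; apply: measurable_funM => //.
  exact: measurable_tnth.
have V0 i : 0 <= V i by rewrite mulr_ge0// limit_form_ge0.
have yV i b : i \in s ->
    \int[P]_w cos (y i (Z i.1.+1 i.2 w) + b) = cos b * expR (- V i / 2).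
  move=> _; have L := law_combination (k := i.1.+1) i.2 (t' i) isT.
  by have := Rintegral_cos_normal (V0 i) L b.
have mZ (i : nat * 'I_2) : measurable_fun setT (Z i.1.+1 i.2) by exact: hZmeas.
have := Rintegral_cos_sum_indep mZ hZindep a us my yV.
rewrite (_ : (fun w => _) =
    (fun w => cos (\sum_d t d * limit_var w d.1.1.+1 d.1.2 d.2 + a))); last first.
  apply/funext => w; congr (cos (_ + _)).
  rewrite big_map big_enum/=.
  transitivity (\sum_(d : ('I_K * 'I_2) * 'I_c) t (d.1, d.2) * limit_var w d.1.1.+1 d.1.2 d.2).
    rewrite -(pair_bigA _ (fun q l => t (q, l) * limit_var w q.1.+1 q.2 l))/=.
    by apply: eq_bigr => q _; apply: eq_bigr => l _; rewrite t'E.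
  by apply: eq_bigr => -[].
move=> ->; congr (_ * _).
rewrite big_map big_enum/= -expR_sum; congr expR.
rewrite -mulr_suml sumrN /wave_var mulr_sumr; congr (- _ / _).
apply: eq_bigr => q _; rewrite /V; congr (_ * (_ - _ ^+ 2)).
  by apply: eq_bigr => l _; rewrite t'E.
by apply: eq_bigr => l _; rewrite t'E.
Qed.

Let tnth_law k r l : (1 <= k)%N ->
  has_law P (fun w => tnth (Z k r w) l : measurableTypeR R) (normal_law 0 ((p l)^-1 - 1)).
Proof.
move=> k1; have := hZ r k1 (delta_mx ord0 l).
rewrite trmx0 mulmx0 mxE limit_cov_form.
have D l' : (delta_mx ord0 l : 'rV[R]_c) ord0 l' = (l' == l)%:R by rewrite mxE eqxx.
have S (F : 'I_c -> R) : \sum_l' (l' == l)%:R * F l' = F l.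
  rewrite (bigD1 l)//= eqxx mul1r big1 ?addr0// => l' /negPf ->.
  by rewrite mul0r.
rewrite (_ : (fun w => _) = (fun w => tnth (Z k r w) l)); last first.
  by apply/funext => w; under eq_bigr do rewrite D; exact: (S (tnth (Z k r w))).
congr has_law; congr normal_law; congr (_ - _).
  transitivity (\sum_l' (l' == l)%:R * ((l' == l)%:R / p l')); last by rewrite S eqxx mul1r.
  by apply: eq_bigr => l' _; rewrite D expr2 mulrA.
transitivity ((\sum_l' (l' == l)%:R * (1 : R)) ^+ 2); last by rewrite S expr1n.
by congr (_ ^+ 2); apply: eq_bigr => l' _; rewrite D mulr1.
Qed.

Lemma integrable_sqr_tnth k r l : (1 <= k)%N ->
  P.-integrable setT (EFin \o (fun w => (tnth (Z k r w) l : R) ^+ 2)) /\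
  \int[P]_w ((tnth (Z k r w) l : R) ^+ 2) = normal_sqr ((p l)^-1 - 1).
Proof.
move=> k1; apply: (integrable_normal_variable_sqr _ (tnth_law r l k1)).
rewrite subr_ge0 invf_ge1// -p1 (bigD1 l)//= lerDl sumr_ge0// => l' _.
exact: ltW.
Qed.

Lemma measurable_tnth_Z k r l : (1 <= k)%N ->
  measurable_fun setT (fun w => tnth (Z k r w) l : R).
Proof. by move=> k1; have [] := tnth_law r l k1. Qed.

End LimitVariables.

(** * Ranks of independent observations with a common law *)

Section RankPermutation.
Context {R : realType} {I : finType}.

Definition rank_of (x : I -> R) (i : I) : nat := (\sum_(j : I) (x j <= x i)%R)%N.

Lemma rank_of_perm (x : I -> R) (s : {perm I}) i :
  rank_of (fun i => x (s i)) i = rank_of x (s i).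
Proof. by rewrite /rank_of [RHS](reindex_inj (@perm_inj _ s)). Qed.

Lemma rank_of_le (x : I -> R) i : (rank_of x i <= #|I|)%N.
Proof.
rewrite /rank_of -sum1_card; apply: leq_sum => j _.
by case: (_ <= _).
Qed.

Lemma rank_of_gt0 (x : I -> R) i : (0 < rank_of x i)%N.
Proof. by rewrite /rank_of (bigD1 i)//= lexx. Qed.

Lemma rank_of_inj (x : I -> R) : injective x -> injective (rank_of x).
Proof.
have lt (i j : I) : x i < x j -> (rank_of x i < rank_of x j)%N.
  move=> xij; rewrite /rank_of (bigD1 j)//= [X in (_ < X)%N](bigD1 j)//=.
  rewrite lexx leNgt xij/= add0n add1n ltnS; apply: leq_sum => k _.
  by case: (leP (x k) (x i)) => // /le_trans/(_ (ltW xij)) ->.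
move=> xinj i j rij; apply: xinj; apply/eqP/negPn/negP => xij.
case: (ltgtP (x i) (x j)) xij => // /lt; by rewrite rij ltnn.
Qed.

(** Without ties the ranks are distinct numbers between 1 and [#|I|], hence take
    each of these values once. *)
Lemma rank_of_enum_rank (x : I -> R) : injective x ->
  exists s : {perm I}, forall i, rank_of x i = (enum_rank (s i)).+1.
Proof.
move=> xinj.
have lt i : ((rank_of x i).-1 < #|I|)%N.
  by rewrite prednK ?rank_of_gt0// rank_of_le.
pose f i := enum_val (Ordinal (lt i)).
have finj : injective f.
  move=> i j /enum_val_inj /(congr1 val)/= ij; apply: (rank_of_inj xinj).
  by rewrite -(prednK (rank_of_gt0 x i)) ij prednK// rank_of_gt0.
exists (perm finj) => i.
by rewrite permE enum_valK/= prednK// rank_of_gt0.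
Qed.

End RankPermutation.

Local Notation image_measure :=
  measure_function_pushforward__canonical__measure_function_Measure.

Section Exchangeable.
Context d (T : measurableType d) {R : realType} (P : probability T R) {I : finType}.
Context (Q : probability (measurableTypeR R) R) (Th : I -> T -> measurableTypeR R).
Hypothesis law : forall i, has_law P (Th i) Q.
Hypothesis indep : mutually_independent P Th.
Hypothesis atomless : forall x : R, Q [set x] = 0%E.

Let mTh i : measurable_fun setT (Th i). Proof. by have [] := law i. Qed.

Let V := I -> measurableTypeR R.
Let rectangles : set (set V) :=
  [set B | exists2 A : I -> set (measurableTypeR R),
    (forall i, measurable (A i)) & B = [set x | forall i, A i (x i)]].
(** The families of angles with the product sigma-algebra. *)
Let W := g_sigma_algebraType rectangles.

Let rectanglesI : setI_closed rectangles.
Proof.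
move=> _ _ [A mA ->] [B mB ->]; exists (fun i => A i `&` B i).
  by move=> i; exact: measurableI.
by apply/seteqP; split => [x [xA xB] i|x xAB]; [split|split => i; have [] := xAB i].
Qed.

Let pre (s : {perm I}) (w : T) : W := fun i => Th (s i) w.

Let pre_rect s (A : I -> set (measurableTypeR R)) :
  pre s @^-1` [set x | forall i, A i (x i)] =
  \bigcap_(j in [set` [fset j | j in I]%fset]) (Th j @^-1` A ((s^-1)%g j)).
Proof.
apply/seteqP; split => [w wA j _|w wA i] /=.
  by have := wA ((s^-1)%g j); rewrite /pre permKV.
by have := wA (s i); rewrite /= permK; apply; rewrite /= !inE.
Qed.

Let mTA (A : I -> set (measurableTypeR R)) i j : (forall i, measurable (A i)) ->
  measurable (Th i @^-1` A j).
Proof. by move=> mA; rewrite -[_ @^-1` _]setTI; exact: mTh. Qed.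

Let mpre s : measurable_fun setT (pre s).
Proof.
apply: (@measurability _ _ T (g_sigma_algebraType rectangles) setT (pre s) rectangles) => //.
move=> _ [_ [A mA ->] <-]; rewrite setTI pre_rect.
apply: fin_bigcap_measurable; first exact: finite_fset.
by move=> j _; exact: (mTA (A := fun i => A ((s^-1)%g i))).
Qed.

Let P_rect s (A : I -> set (measurableTypeR R)) : (forall i, measurable (A i)) ->
  P (pre s @^-1` [set x | forall i, A i (x i)]) = (\prod_(i : I) Q (A i))%E.
Proof.
move=> mA; rewrite pre_rect (indep _ (A := fun j => A ((s^-1)%g j)))//.
transitivity (\prod_(j : I) Q (A ((s^-1)%g j)))%E.
  have perm : perm_eq [fset j | j in I]%fset (index_enum I).
    apply: uniq_perm; rewrite ?index_enum_uniq//.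
    by move=> j; rewrite mem_index_enum !inE.
  rewrite (perm_big _ perm)/=; apply: eq_bigr => j _.
  by have [_] := law j; apply.
by rewrite [RHS](reindex_inj (@perm_inj _ (s^-1)%g)).
Qed.

(** A law on families is determined by the measures of rectangles, and these are
    products that do not depend on the order of the factors. *)
Lemma exchangeable s (B : set W) : measurable B ->
  P (pre s @^-1` B) = P (pre 1%g @^-1` B).
Proof.
move=> mB.
pose m s' := image_measure P (mpre s').
pose m1 := m s; pose m2 := m 1%g.
have rT : rectangles setT.
  by exists (fun=> setT) => //; apply/seteqP; split.
have cover : \bigcup_(k : nat) (setT : set W) = setT.
  by apply/seteqP; split=> // x _; exists 0%N.
have m12 A : rectangles A -> m1 A = m2 A.
  move=> [A' mA' ->].
  exact: etrans (P_rect s mA') (esym (P_rect 1%g mA')).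
have fin (k : nat) : (m1 setT < +oo)%E.
  by apply: le_lt_trans (probability_le1 P _) (ltry _); rewrite preimage_setT.
exact: (@measure_unique _ R (g_sigma_algebraType rectangles) rectangles (fun=> setT)
  erefl rectanglesI (fun=> rT) cover m1 m2 m12 fin B mB).
Qed.

Let mcoord i : measurable_fun setT (fun x : W => x i : measurableTypeR R).
Proof.
move=> _ A mA; rewrite setTI; apply: sub_sigma_algebra.
exists (fun j => if j == i then A else setT); first by move=> j; case: ifP.
apply/seteqP; split => [x xA j|x /(_ i)]; last by rewrite eqxx.
by case: eqP => // ->.
Qed.

Let mrank (r : {ffun I -> 'I_#|I|.+1}) :
  measurable [set x : W | forall i, rank_of x i = r i].
Proof.
rewrite (_ : [set x : W | _] = \bigcap_(i in [set` [fset j | j in I]%fset])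
    [set x : W | rank_of x i = r i]); last first.
  apply/seteqP; split=> [w h i _|w h i]; first exact: h.
  by apply: h; rewrite /= !inE.
apply: fin_bigcap_measurable => [|i _]; first exact: finite_fset.
have mle (j : I) : measurable_fun setT (fun x : W => ((x j <= x i)%R : nat)%:R : R).
  apply: (measurableT_comp (f := fun b : bool => (b : nat)%:R : R)) => //.
  by apply: measurable_fun_ler; exact: mcoord.
have mr : measurable_fun setT (fun x : W => (rank_of x i)%:R : R).
  rewrite [X in measurable_fun _ X](_ : _ = fun x : W => \sum_(j : I) ((x j <= x i)%R : nat)%:R).
    exact: measurable_sum.
  by apply/funext => x; rewrite /rank_of natr_sum.
rewrite (_ : [set x : W | _] = (fun x : W => (rank_of x i)%:R : R) @^-1` [set (r i)%:R]).
  by rewrite -[_ @^-1` _]setTI; apply: mr.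
by apply/seteqP; split=> w /= => [-> //|/eqP]; rewrite eqr_nat => /eqP.
Qed.

(** The joint law of two observations is the product measure, and the sections of
    the diagonal are points, which are null sets. *)
Let no_ties i j : i != j -> {ae P, forall w, Th i w <> Th j w}.
Proof.
move=> ij.
pose Y w := (Th i w, Th j w).
have mY : measurable_fun setT Y by exact: measurable_fun_pair.
pose m := image_measure P mY.
have mE A B : measurable A -> measurable B -> m (A `*` B) = (Q A * Q B)%E.
  move=> mA mB.
  pose C k := if k == i then A else if k == j then B else setT.
  have mC k : measurable (C k) by rewrite /C; case: ifP => // _; case: ifP.
  have -> : m (A `*` B) = P (pre 1%g @^-1` [set x | forall i, C i (x i)]).
    congr (P _); apply/seteqP; split=> [w [/= wA wB] k|w /= wC].
      rewrite /C /pre perm1; case: eqP => [->//|_]; by case: eqP => // ->.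
    split; first by have := wC i; rewrite /pre perm1 /C eqxx.
    by have := wC j; rewrite /pre perm1 /C eqxx eq_sym (negPf ij).
  rewrite P_rect// (bigD1 i)//= (bigD1 j) 1?eq_sym//= big1 ?mule1.
    by rewrite /C !eqxx eq_sym (negPf ij).
  by move=> k /andP[ki kj]; rewrite /C (negPf ki) (negPf kj) probability_setT.
pose D : set (measurableTypeR R * measurableTypeR R) := [set x | x.1 = x.2].
have mD : measurable D.
  rewrite (_ : D = [set: measurableTypeR R * measurableTypeR R] `&`
     (fun x => x.1 == x.2 :> R) @^-1` [set true]).
    by apply: measurable_fun_eqr => //.
  by rewrite setTI; apply/seteqP; split=> x /= /eqP.
exists (Y @^-1` D); split.
- by rewrite -[_ @^-1` _]setTI; exact: (mY).
- have := product_measure_unique mE mD; rewrite /product_measure1 => E.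
  transitivity (m D) => //; rewrite -E.
  rewrite integral0_eq// => x _ /=.
  rewrite (_ : xsection D x = [set x])//; apply/seteqP; split => y; rewrite xsectionP /D/=.
    by move=> ->.
  by move=> ->.
- by move=> w /= /contrapT.
Qed.

(** By exchangeability the expectation does not change when the observations are
    relabelled, hence equals its mean over all relabellings.  For one sample
    without ties, whose ranks are a permutation, the relabelled ranks run through
    all permutations. *)
Lemma Rintegral_rank (F : (I -> nat) -> R) :
  measurable_fun setT (fun w => F (rank_of (fun i => Th i w))) /\
  \int[P]_w F (rank_of (fun i => Th i w)) =
  avg (fun s : {perm I} => F (fun i => (enum_rank (s i)).+1)).
Proof.
pose G (s : {perm I}) w := F (rank_of (pre s w)).
pose E (r : {ffun I -> 'I_#|I|.+1}) : set W := [set x : W | forall i, rank_of x i = r i].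
have GE s w : G s w = \sum_(r : {ffun I -> 'I_#|I|.+1}) F (fun i => r i) * \1_(pre s @^-1` E r) w.
  pose r0 : {ffun I -> 'I_#|I|.+1} :=
    [ffun i => Ordinal (rank_of_le (pre s w) i : (_ < #|I|.+1)%N)].
  have r0E : rank_of (pre s w) = (fun i => r0 i) by apply/funext => i; rewrite ffunE.
  rewrite (bigD1 r0)//= indicE mem_set ?mulr1; last first.
    by rewrite /E/= => i; rewrite ffunE.
  rewrite big1 ?addr0; first by rewrite /G r0E.
  move=> r /eqP rr0; rewrite indicE memNset ?mulr0// /E/= => h; apply: rr0.
  by apply/ffunP => i; apply/val_inj; rewrite /= -h ffunE.
have mE s r : measurable (pre s @^-1` E r).
  by rewrite -[_ @^-1` _]setTI; apply: mpre => //; exact: mrank.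
have i1 s r : P.-integrable setT (EFin \o (\1_(pre s @^-1` E r) : T -> R)).
  apply: (@integrable_bounded _ _ _ _ _ 1); first exact: measurable_indic.
  by move=> w; rewrite indicE; case: (_ \in _); rewrite ?normr1// normr0.
have iGE s := Rintegral_fsum (index_enum {ffun I -> 'I_#|I|.+1})
  (fun r => integrableZl measurableT (F (fun i => r i)) (i1 s r)).
have iG s : P.-integrable setT (EFin \o G s).
  by rewrite (_ : G s = fun w => \sum_(r : {ffun I -> 'I_#|I|.+1}) F (fun i => r i) * \1_(pre s @^-1` E r) w);
    [have [] := iGE s|apply/funext].
have Gs s : \int[P]_w G s w = \int[P]_w G 1%g w.
  under eq_Rintegral do rewrite GE.
  under [RHS]eq_Rintegral do rewrite GE.
  rewrite (iGE s).2 (iGE 1%g).2; apply: eq_bigr => r _.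
  rewrite !RintegralZl//; congr (_ * _).
  rewrite /Rintegral !integral_indic// !setIT; congr fine; apply: exchangeable; exact: mrank.
have G1 w : G 1%g w = F (rank_of (fun i => Th i w)).
  by congr (F (rank_of _)); apply/funext => i; rewrite /pre perm1.
rewrite (_ : (fun w => F (rank_of (fun i => Th i w))) = G 1%g); last first.
  by apply/funext => w; rewrite G1.
split; first by have /measurable_int/measurable_EFinP := iG 1%g.
set c := avg _.
have -> : \int[P]_w G 1%g w = \int[P]_w (avg (fun s => G s w)).
  transitivity (avg (fun s : {perm I} => \int[P]_w G s w)).
    by under eq_avg => s do rewrite Gs; rewrite avg_cst.
  rewrite /avg RintegralZr//; last exact: (Rintegral_fsum _ iG).1.
  by rewrite (Rintegral_fsum _ iG).2.
rewrite -[RHS](Rintegral_prob_cst P c) /Rintegral; congr fine.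
apply: ae_eq_integral => //.
- apply/measurable_EFinP; rewrite /avg; apply: measurable_funM => //.
  by have /measurable_int/measurable_EFinP := (Rintegral_fsum (index_enum {perm I}) iG).1.
have ties : {ae P, forall w, forall i j, i != j -> Th i w <> Th j w}.
  apply: filter_forall => i; apply: filter_forall => j.
  have [ij|ij] := eqVneq i j; first by apply: nearW => w.
  by have := no_ties ij; apply: filterS => w h _.
apply: filterS ties => w inj _; congr EFin.
have xinj : injective (fun i => Th i w).
  by move=> i j ijE; apply/eqP/negPn/negP => /inj.
have [t tE] := rank_of_enum_rank xinj.
rewrite /c -[RHS](avg_mulr t).
apply: eq_avg => s; rewrite /G; congr F; apply/funext => i.
by rewrite permM -tE; exact: (rank_of_perm (fun i => Th i w)).
Qed.

End Exchangeable.

(** * Measurability of limits and of Lipschitz functions *)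

Lemma cvg_fsum (R : realType) (J : Type) (s : seq J) (u : J -> nat -> R) (l : J -> R) :
  (forall j, u j n @[n --> \oo] --> l j) ->
  \sum_(j <- s) u j n @[n --> \oo] --> \sum_(j <- s) l j.
Proof.
move=> ul; elim: s => [|j s IH].
  by rewrite big_nil; under eq_fun do rewrite big_nil; exact: cvg_cst.
by rewrite big_cons; under eq_fun do rewrite big_cons; exact: cvgD.
Qed.

Section Measurability.
Context d (T : measurableType d) {R : realType}.

Lemma measurable_cvgn_set (u : nat -> T -> R) :
  (forall n, measurable_fun setT (u n)) -> measurable [set w | cvgn (u ^~ w)].
Proof.
move=> mu.
have -> : [set w | cvgn (u ^~ w)] =
  \bigcap_(j : nat) \bigcup_(n : nat) \bigcap_(k : nat)
    [set w | `|u (n + k)%N w - u n w| <= j.+1%:R^-1].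
  apply/seteqP; split => w /=.
    move=> cu j _; have /cvgrPdist_le/(_ (2^-1 * j.+1%:R^-1)) := cu.
    rewrite mulr_gt0// => /(_ isT)[n _ h]; exists n => // k _ /=.
    have h1 := h (n + k)%N (leq_addr _ _); have h2 := h n (leqnn _).
    set l := lim _ in h1 h2.
    have -> : u (n + k)%N w - u n w = (l - u n w) - (l - u (n + k)%N w) by ring.
    apply: le_trans (ler_normB _ _) _; apply: le_trans (lerD h2 h1) _.
    by rewrite -mulrDl (_ : 2^-1 + 2^-1 = 1) ?mul1r//; field.
  move=> h; apply/cauchy_cvgP/cauchy_exP => e e0.
  pose j := Num.bound e^-1; have [n _ hn] := h j I.
  exists (u n w); exists n => // k /= nk.
  rewrite /ball/= distrC -(subnKC nk); apply: le_lt_trans (hn (k - n)%N I) _.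
  rewrite invf_plt ?posrE//; apply: lt_trans (archi_boundP _) _; first by rewrite invr_ge0 ltW.
  by rewrite ltr_nat.
apply: bigcapT_measurable => j; apply: bigcupT_measurable => n.
apply: bigcapT_measurable => k.
rewrite -[X in measurable X]setTI; apply: measurable_fun_le => //.
by apply: measurableT_comp => //; exact: measurable_funB.
Qed.

(** On divergent sequences the limit operator returns a fixed value, and the set of
    convergence is measurable. *)
Lemma measurable_limn (u : nat -> T -> R) :
  (forall n, measurable_fun setT (u n)) ->
  measurable_fun setT (fun w => limn (u ^~ w)).
Proof.
move=> mu; set C := [set w | cvgn (u ^~ w)].
have mC : measurable C by exact: measurable_cvgn_set.
pose v n w := \1_C w * u n w.
have mv n : measurable_fun setT (v n) by exact: measurable_funM.
have mlim : measurable_fun setT (fun w => \1_C w * limn (u ^~ w)).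
  apply: (@measurable_fun_cvg _ _ _ _ v) => // w _; rewrite /v indicE.
  have [/set_mem wC|_] := boolP (w \in C).
    by under eq_fun do rewrite mul1r; rewrite mul1r.
  by under eq_fun do rewrite mul0r; rewrite mul0r; exact: cvg_cst.
rewrite (_ : (fun w => _) =
  (fun w => \1_C w * limn (u ^~ w) + \1_(~` C) w * (point : R))).
  apply: measurable_funD => //; apply: measurable_funM => //.
  exact/measurable_indic/measurableC.
apply/funext => w; rewrite !indicE in_setC.
have [wC|wC] := boolP (w \in C); first by rewrite mul1r mul0r addr0.
rewrite mul0r mul1r add0r; apply: dvgP => cu; move/negP: wC; apply.
by rewrite inE.
Qed.

Lemma row_norm_le c (u : 'I_c -> R) : `|\row_l u l| <= \sum_l `|u l|.
Proof.
have [->|/mx_norm_neq0[[i l]]] := eqVneq `|\row_l u l| 0.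
  by rewrite sumr_ge0.
move=> /= E; rewrite [leLHS]E mxE (bigD1 l)//= lerDl sumr_ge0//.
Qed.

(** Rounding the coordinates to multiples of [1 / n.+1] reduces the claim to
    functions of countably many values. *)
Lemma measurable_lipschitz_row c (m : 'rV[R]_c -> R) (L : R) (h : 'I_c -> T -> R) :
  (forall x y, `|m x - m y| <= L * `|x - y|) ->
  (forall l, measurable_fun setT (h l)) ->
  measurable_fun setT (fun w => m (\row_l h l w)).
Proof.
move=> mL mh.
have L0 : 0 <= L \/ forall x y : 'rV[R]_c, m x = m y.
  have [L0|L0] := leP 0 L; [by left|right => x y].
  apply/eqP; rewrite -subr_eq0 -normr_le0; apply: le_trans (mL x y) _.
  by rewrite mulr_le0_ge0// ltW.
case: L0 => [L0|mc]; last first.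
  rewrite (_ : (fun w => _) = fun=> m 0); first exact: measurable_cst.
  by apply/funext => w.
pose z n w : {ffun 'I_c -> int} := [ffun l => Num.floor (h l w * n.+1%:R)].
pose G n (k : {ffun 'I_c -> int}) := m (\row_l ((k l)%:~R / n.+1%:R)).
have mz n k : measurable [set w | z n w = k].
  rewrite (_ : [set w | _] = \bigcap_(l in [set` [fset l | l in 'I_c]%fset])
     (h l @^-1` `[(k l)%:~R / n.+1%:R, (k l + 1)%:~R / n.+1%:R[)).
    apply: fin_bigcap_measurable => [|l _]; first exact: finite_fset.
    by rewrite -[_ @^-1` _]setTI; apply: mh.
  have flE l w : (Num.floor (h l w * n.+1%:R) == k l) =
      (h l w \in `[(k l)%:~R / n.+1%:R, (k l + 1)%:~R / n.+1%:R[).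
    by rewrite in_itv/= ler_pdivrMr// ltr_pdivlMr// floor_eq.
  apply/seteqP; split => [w zw l _|w hw].
    by rewrite /= -flE -zw ffunE.
  apply/ffunP => l; rewrite ffunE; apply/eqP; rewrite flE.
  by apply: (hw l); rewrite /= !inE.
have mG n : measurable_fun setT (fun w => G n (z n w)).
  move=> _ A mA; rewrite setTI.
  rewrite (_ : _ @^-1` A = \bigcup_k ([set w | z n w = k] `&` [set w | A (G n k)])).
    apply: countable_bigcupT_measurable; first exact: countableP.
    move=> k; have [Ak|Ak] := pselect (A (G n k)).
      by rewrite (_ : [set w | A _] = setT) ?setIT//; apply/seteqP; split.
    by rewrite (_ : [set w | A _] = set0) ?setI0//; apply/seteqP; split.
  apply/seteqP; split => [w Aw|w [k _ [/= <-]]//].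
  by exists (z n w).
apply: (@measurable_fun_cvg _ _ _ _ (fun n w => G n (z n w))) => // w _.
have E n : `|m (\row_l h l w) - G n (z n w)| <= (L * c%:R) * n.+1%:R^-1.
  apply: le_trans (mL _ _) _; rewrite -mulrA ler_wpM2l//.
  have -> : \row_l h l w - \row_l ((z n w l)%:~R / n.+1%:R) =
     \row_l (h l w - (z n w l)%:~R / n.+1%:R) by apply/rowP => l; rewrite !mxE.
  apply: le_trans (row_norm_le _) _.
  rewrite -[X in X%:R * _]card_ord mulr_natl -sumr_const; apply: ler_sum => l _.
  rewrite ffunE; set u := h l w * n.+1%:R.
  have -> : h l w = u / n.+1%:R by rewrite /u mulfK.
  rewrite -mulrBl normrM [X in _ * X]gtr0_norm ?invr_gt0// ler_piMl//.
  have := floor_le_tmp u; have := floorD1_gt u; rewrite intrD => h1 h2.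
  by rewrite ger0_norm ?subr_ge0//; lra.
apply/cvgrPdist_le => e e0.
have : (L * c%:R) * n.+1%:R^-1 @[n --> \oo] --> (L * c%:R) * 0.
  by apply: cvgMr; exact: cvg_harmonic.
rewrite mulr0 => /cvgr_le h0.
near=> n; apply: le_trans (E n) _; near: n; exact: h0.
Unshelve. all: by end_near. Qed.

End Measurability.

(** * Bounded Lipschitz test functions *)

Section Portmanteau.
Context {R : realType}.

(** The largest [n]-Lipschitz minorant of [f], an infimal convolution. *)
Definition lipschitz_minorant (f : R -> R) (n : nat) (x : R) : R :=
  inf [set f y + n%:R * `|x - y| | y in setT].

Context (f : R -> R) (B : R).
Hypothesis fB : forall x, `|f x| <= B.

Local Notation fn := (lipschitz_minorant f).

Let lb n x : lbound [set f y + n%:R * `|x - y| | y in setT] (- B).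
Proof.
move=> _ [y _ <-]; rewrite -[leLHS]addr0 lerD// ?mulr_ge0//.
by have := fB y; rewrite ler_norml => /andP[].
Qed.

Let hasinf n x : has_inf [set f y + n%:R * `|x - y| | y in setT].
Proof. by split; [exists (f x + n%:R * `|x - x|); exists x|exists (- B); exact: lb]. Qed.

Lemma lipschitz_minorant_le n x : fn n x <= f x.
Proof.
have : fn n x <= f x + n%:R * `|x - x|.
  by apply: ge_inf; [exists (- B); exact: lb|exists x].
by rewrite subrr normr0 mulr0 addr0.
Qed.

Lemma lipschitz_minorant_bound n x : `|fn n x| <= B.
Proof.
rewrite ler_norml; apply/andP; split.
  by apply: lb_le_inf; [exact: (hasinf n x).1|exact: lb].
apply: le_trans (lipschitz_minorant_le n x) _.
by apply: le_trans (fB x); exact: ler_norm.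
Qed.

Lemma lipschitz_minorant_lip n x y : `|fn n x - fn n y| <= n%:R * `|x - y|.
Proof.
have h u v : fn n u <= fn n v + n%:R * `|u - v|.
  rewrite -lerBlDr; apply: lb_le_inf; first exact: (hasinf n v).1.
  move=> _ [z _ <-]; rewrite lerBlDr.
  apply: (@le_trans _ _ (f z + n%:R * `|u - z|)).
    by apply: ge_inf; [exists (- B); exact: lb|exists z].
  rewrite -addrA lerD2l -mulrDr ler_wpM2l// [leRHS]addrC.
  exact: ler_distD.
have := h x y; have := h y x; rewrite (distrC y).
by rewrite ler_norml => ? ?; apply/andP; split; lra.
Qed.

Lemma cvg_lipschitz_minorant x : {for x, continuous f} ->
  fn n x @[n --> \oo] --> f x.
Proof.
move=> cf; apply/cvgrPdist_le => e e0.
move/cvgrPdist_le: cf => /(_ e e0)[r /= r0 fr].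
have B0 : 0 <= B by apply: le_trans (fB x).
near=> n.
have nr : 2 * B <= n%:R * r.
  rewrite -ler_pdivrMr//; apply: ltW; apply: lt_le_trans (archi_boundP _) _.
    by rewrite divr_ge0 ?mulr_ge0// ltW.
  by rewrite ler_nat; near: n; exact: nbhs_infty_ge.
rewrite ger0_norm ?subr_ge0 ?lipschitz_minorant_le// lerBlDr -lerBlDl.
apply: lb_le_inf; first exact: (hasinf n x).1.
move=> _ [y _ <-]; have [yr|yr] := ltP `|x - y| r.
  have := fr y yr; have : 0 <= n%:R * `|x - y| by rewrite mulr_ge0.
  by rewrite ler_norml => ? /andP[? ?]; lra.
have : n%:R * r <= n%:R * `|x - y| by rewrite ler_wpM2l.
have := fB x; have := fB y; rewrite !ler_norml => /andP[? ?] /andP[? ?].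
by lra.
Unshelve. all: by end_near. Qed.

End Portmanteau.

Lemma lipschitz_continuous (R : realType) (f : R -> R) (L : R) :
  (forall x y, `|f x - f y| <= L * `|x - y|) -> continuous f.
Proof.
move=> fL x; apply/cvgrPdist_lt => e e0.
have L1 : 0 < `|L| + 1 by rewrite ltr_wpDl.
exists (e / (`|L| + 1)); first by rewrite /= divr_gt0.
move=> y /= xy; apply: le_lt_trans (fL _ _) _.
apply: le_lt_trans (_ : L * `|x - y| <= (`|L| + 1) * `|x - y|) _.
  by rewrite ler_wpM2r// (le_trans (ler_norm _))// lerDl.
by rewrite mulrC -ltr_pdivlMr.
Qed.

Section PortmanteauLimit.
Context {R : realType} (d : nat -> measure_display) (T : forall n, measurableType (d n)).
Context (P : forall n, probability (T n) R) (X : forall n, T n -> R).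
Context d' (T' : measurableType d') (P' : probability T' R) (Y : T' -> R).
Arguments X : clear implicits.
Hypothesis mX : forall n, measurable_fun setT (X n).
Hypothesis mY : measurable_fun setT Y.

(** The Lipschitz minorants of a bounded continuous function converge to it, which
    gives a lower bound for the limit inferior; applied to [- f] it gives the upper
    bound. *)
Lemma portmanteau :
  (forall (f : R -> R) (B L : R), (forall x, `|f x| <= B) ->
     (forall x y, `|f x - f y| <= L * `|x - y|) ->
     \int[P n]_w f (X n w) @[n --> \oo] --> \int[P']_w f (Y w)) ->
  forall (f : R -> R) (B : R), continuous f -> (forall x, `|f x| <= B) ->
     \int[P n]_w f (X n w) @[n --> \oo] --> \int[P']_w f (Y w).
Proof.
move=> H.
have int dd (S : measurableType dd) (PS : probability S R) (W : S -> R) (f : R -> R) (B : R) :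
    measurable_fun setT W -> continuous f -> (forall x, `|f x| <= B) ->
    PS.-integrable setT (EFin \o (fun w => f (W w))).
  move=> mW cf fB; apply: (@integrable_bounded _ _ _ _ _ B) => //.
  by apply: (measurableT_comp _ mW); exact: continuous_measurable_fun.
have half (f : R -> R) (B e : R) : continuous f -> (forall x, `|f x| <= B) -> 0 < e ->
    \forall n \near \oo, \int[P']_w f (Y w) - e <= \int[P n]_w f (X n w).
  move=> cf fB e0.
  pose fk k := lipschitz_minorant f k.
  have fkB k x : `|fk k x| <= B by exact: lipschitz_minorant_bound.
  have fkL k x y : `|fk k x - fk k y| <= k%:R * `|x - y| by exact: lipschitz_minorant_lip fB _ _ _.
  have fkc k : continuous (fk k) by exact: lipschitz_continuous (fkL k).
  have ifY := int _ _ P' _ _ _ mY cf fB.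
  have ifk k := int _ _ P' _ _ _ mY (fkc k) (fkB k).
  have cvgk : \int[P']_w fk k (Y w) @[k --> \oo] --> \int[P']_w f (Y w).
    have [_ _] : [/\ P'.-integrable setT (EFin \o (fun w => f (Y w))),
      (fun k => \int[P']_w `|(fk k (Y w))%:E - (f (Y w))%:E|)%E @ \oo --> 0%E &
      (fun k => \int[P']_w (fk k (Y w))%:E)%E @ \oo --> (\int[P']_w (f (Y w))%:E)%E].
      apply: (@dominated_convergence _ _ _ P' _ measurableT
         (fun k w => (fk k (Y w))%:E) (fun w => (f (Y w))%:E) (fun=> B%:E)).
      - by move=> k; exact: (measurable_int _ (ifk k)).
      - exact: (measurable_int _ ifY).
      - apply: aeW => w _; apply: cvg_EFin; first exact: nearW.
        by apply: (cvg_lipschitz_minorant fB); exact: cf.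
      - by apply: (@integrable_bounded _ _ _ P' (fun=> B) `|B|).
      - by apply: aeW => w k _; rewrite lee_fin.
    by rewrite -[X in _ --> X](fineK (integrable_fin_num measurableT ifY)) => /fine_cvg.
  have : \forall k \near \oo, \int[P']_w f (Y w) - e / 2 <= \int[P']_w fk k (Y w).
    by apply: (cvgr_ge _ cvgk); rewrite ltrBlDr ltrDl divr_gt0.
  move=> [k _ /(_ k (leqnn _)) hk].
  have := H (fk k) B k%:R (fkB k) (fkL k).
  move=> /cvgr_ge/(_ (\int[P']_w fk k (Y w) - e / 2)).
  rewrite ltrBlDr ltrDl divr_gt0// => /(_ isT).
  apply: filterS => n hn.
  have : \int[P n]_w fk k (X n w) <= \int[P n]_w f (X n w).
    apply: le_Rintegral => //; [exact: int (fkc k) (fkB k)|exact: int cf fB|].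
    by move=> w _; exact: (lipschitz_minorant_le fB).
  by lra.
move=> f B cf fB; apply/cvgrPdist_le => e e0.
have Nf : continuous (fun x => - f x) by move=> x; apply: (@continuousN _ R^o); exact: cf.
have NfB x : `|- f x| <= B by rewrite normrN.
have N dd (S : measurableType dd) (PS : probability S R) (W : S -> R) :
    measurable_fun setT W -> \int[PS]_w (- f (W w)) = - \int[PS]_w f (W w).
  move=> mW; rewrite -mulN1r -RintegralZl//; last exact: int mW cf fB.
  by apply: eq_Rintegral => w _; rewrite mulN1r.
near=> n; rewrite ler_norml; apply/andP; split.
  have : \int[P']_w (- f (Y w)) - e <= \int[P n]_w (- f (X n w)).
    by near: n; exact: (half _ _ _ Nf NfB e0).
  by rewrite !N//; lra.
have : \int[P']_w f (Y w) - e <= \int[P n]_w f (X n w).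
  by near: n; exact: (half _ _ _ cf fB e0).
by lra.
Unshelve. all: by end_near. Qed.

End PortmanteauLimit.

(** * Convergence at finitely many frequencies *)

Section ContinuityTheorem.
Context {R : realType} {D : finType}.
Context (I : nat -> finType) (W : forall n, D -> {perm I n} -> R).
Arguments W : clear implicits.
Context d (T : measurableType d) (P : probability T R) (X : T -> D -> R).
Hypothesis mX : forall e, measurable_fun setT (fun w => X w e).
Hypothesis iX : forall e, P.-integrable setT (EFin \o (fun w => X w e ^+ 2)).
Context (C : R).
Hypothesis WC : \forall n \near \oo, \sum_e avg (fun s => W n e s ^+ 2) <= C.
Hypothesis char : forall (t : D -> R) (a : R),
  avg (fun s => cos (\sum_e t e * W n e s + a)) @[n --> \oo] -->
  \int[P]_w cos (\sum_e t e * X w e + a).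

Let trig_bounded (f : (D -> R) -> R) : trig_poly f -> exists B, forall x, `|f x| <= B.
Proof.
elim=> [t a|u v g h _ [B gB] _ [B' hB]]; first by exists 1 => x; exact: cos_max.
exists (`|u| * B + `|v| * B') => x; apply: le_trans (ler_normD _ _) _.
by rewrite !normrM lerD// ler_wpM2l.
Qed.

Let trig_measurable (f : (D -> R) -> R) : trig_poly f ->
  measurable_fun setT (fun w => f (X w)).
Proof.
elim=> [t a|u v g h _ mg _ mh]; last first.
  by apply: measurable_funD; apply: measurable_funM.
apply: (@measurableT_comp _ _ _ _ _ _ (@cos R)).
  by apply: continuous_measurable_fun; exact: continuous_cos.
apply: measurable_funD => //; apply: measurable_sum => e.
exact: measurable_funM.
Qed.

Let trig_integrable (f : (D -> R) -> R) : trig_poly f ->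
  P.-integrable setT (EFin \o (fun w => f (X w))).
Proof.
move=> tf; have [B fB] := trig_bounded tf.
by apply: (@integrable_bounded _ _ _ _ _ B) => //; exact: trig_measurable.
Qed.

Let trig_cvg (f : (D -> R) -> R) : trig_poly f ->
  avg (fun s => f (fun e => W n e s)) @[n --> \oo] --> \int[P]_w f (X w).
Proof.
elim=> [t a|u v g h tg cg th ch]; first exact: char.
rewrite Rintegral_lin; [|exact: trig_integrable|exact: trig_integrable].
under eq_fun do rewrite avgD !avgZ.
by apply: cvgD; apply: cvgMr.
Qed.

Context (g : (D -> R) -> R) (B : R).
Hypothesis gB : forall x, `|g x| <= B.
Hypothesis mg : measurable_fun setT (fun w => g (X w)).
Hypothesis glip : forall M : R, 0 < M -> exists2 L : R, 0 <= L &
  forall x y : D -> R, (forall e, `|x e| <= M) -> (forall e, `|y e| <= M) ->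
  `|g x - g y| <= L * \sum_e `|x e - y e|.

(** Convergence of characteristic functions with bounded second moments gives
    convergence of means: a trigonometric polynomial approximates [g] up to a
    small multiple of [1 + \sum_e x e ^+ 2]. *)
Lemma cvg_mean :
  avg (fun s => g (fun e => W n e s)) @[n --> \oo] --> \int[P]_w g (X w).
Proof.
have ig : P.-integrable setT (EFin \o (fun w => g (X w))).
  exact: (@integrable_bounded _ _ _ _ _ B).
have [iS SE] := Rintegral_fsum (index_enum D) iX.
have i1 : P.-integrable setT (EFin \o (fun=> 1 : R)).
  by apply: (@integrable_bounded _ _ _ _ _ 1) => // w; rewrite normr1.
set S := \sum_(e : D) \int[P]_x (X x e ^+ 2) in SE.
have S0 : 0 <= S by rewrite -SE; apply: Rintegral_ge0 => w _; apply: sumr_ge0 => e _; exact: sqr_ge0.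
apply/cvgrPdist_le => eps eps0.
pose den := (1 + S) + (1 + `|C|) + 1.
have den0 : 0 < den by rewrite /den; have := normr_ge0 C; lra.
pose e := eps / den.
have e0 : 0 < e by rewrite divr_gt0.
have [q tq gq] := trig_poly_approx gB glip e0.
have dX : `|\int[P]_w g (X w) - \int[P]_w q (X w)| <= e * (1 + S).
  have idom : P.-integrable setT (EFin \o (fun w => e * 1 + e * \sum_e X w e ^+ 2)).
    exact: integrable_lin.
  have -> : e * (1 + S) = \int[P]_w (e * 1 + e * \sum_e X w e ^+ 2).
    by rewrite Rintegral_lin// Rintegral_prob_cst SE mulrDr.
  apply: Rintegral_dist_le => //; first exact: trig_integrable.
  by move=> w; rewrite -mulrDr.
near=> n.
have dW : `|avg (fun s => g (fun e => W n e s)) - avg (fun s => q (fun e => W n e s))| <=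
    e * (1 + `|C|).
  rewrite -avgB; apply: le_trans (ler_norm_avg _) _.
  apply: (@le_trans _ _ (avg (fun s => e * 1 + e * \sum_e W n e s ^+ 2))).
    by apply: ler_avg => s; rewrite -mulrDr.
  rewrite avgD !avgZ avg_cst avg_sum -mulrDr (ler_wpM2l (ltW e0))// lerD2l.
  apply: le_trans (ler_norm C); near: n; exact: WC.
have dq : `|\int[P]_w q (X w) - avg (fun s => q (fun e => W n e s))| <= e.
  by near: n; have /cvgrPdist_le := trig_cvg tq; apply.
set a := \int[P]_w g (X w) in dX *; set b := \int[P]_w q (X w) in dX dq *.
set a' := avg _ in dW *; set b' := avg _ in dW dq.
have -> : a - a' = (a - b) + (b - b') - (a' - b') by ring.
apply: le_trans (ler_normB _ _) _.
apply: le_trans (lerD (ler_normD _ _) (lexx _)) _.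
apply: le_trans (lerD (lerD dX dq) dW) _.
have -> : eps = e * den by rewrite /e divfK ?gt_eqF.
by rewrite /den; lra.
Unshelve. all: by end_near. Qed.

End ContinuityTheorem.

Section FixedLevel.
Context {R : realType} {c : nat} (p : 'I_c -> R).
Hypothesis p0 : forall l, 0 < p l.
Hypothesis p1 : \sum_l p l = 1.
Context d (T : measurableType d) (P : probability T R).
Context (Z : nat -> 'I_2 -> T -> c.-tuple (measurableTypeR R)).
Hypothesis hZmeas : forall k r, (1 <= k)%N -> measurable_fun [set: T] (Z k r).
Hypothesis hZ : forall k r, (1 <= k)%N -> is_mvnormal P (Z k r) 0 (limit_cov p).
Hypothesis hZindep : mutually_independent P (fun s : nat * 'I_2 => Z s.1.+1 s.2).
Context (n : nat -> 'I_c -> nat).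
Hypothesis n0 : forall nu l, (0 < n nu l)%N.
Hypothesis hN : (fun nu => total_size (n nu)) @ \oo --> \oo.
Hypothesis hnp : forall l,
  (n nu l)%:R / (total_size (n nu))%:R @[nu --> \oo] --> p l.

Local Notation N nu := (total_size (n nu)).

Lemma near_total_size_gt (K : nat) : \forall nu \near \oo, (K < N nu)%N.
Proof. by move: hN => /(_ [set k | (K < k)%N]); apply; exists K.+1. Qed.

Lemma near_ratio_le : exists2 B : R, 0 < B &
  \forall nu \near \oo, forall l, (N nu)%:R <= B * (n nu l)%:R.
Proof.
exists (\sum_l 2 / p l + 1).
  by rewrite ltr_wpDl// sumr_ge0// => l _; rewrite divr_ge0// ltW.
apply: filter_forall => l.
have pl : p l / 2 < p l by have := p0 l; lra.
apply: (filterS2 _ _ (near_total_size_gt 0) (cvgr_ge _ (@hnp l) _ pl)) => nu N0; rewrite ler_pdivlMr ?ltr0n// => h.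
have h2 : (N nu)%:R <= 2 / p l * (n nu l)%:R.
  by rewrite mulrAC ler_pdivlMr//; have := p0 l; lra.
apply: le_trans h2 _; rewrite ler_wpM2r//.
rewrite (bigD1 l)//= -addrA lerDl addr_ge0// sumr_ge0// => l' _.
by rewrite divr_ge0// ltW.
Qed.

Lemma cvg_inv_sqrt_total : (Num.sqrt (N nu)%:R)^-1 @[nu --> \oo] --> (0 : R).
Proof.
apply/cvgrPdist_le => e e0.
apply: filterS (near_total_size_gt (Num.bound (e ^- 2))) => nu hK.
have N0 : 0 < (N nu)%:R :> R by rewrite ltr0n; exact: leq_ltn_trans hK.
rewrite sub0r normrN ger0_norm ?invr_ge0// invf_ple ?posrE ?sqrtr_gt0//.
rewrite -[e^-1]ger0_norm ?invr_ge0 ?(ltW e0)// -sqrtr_sqr ler_sqrt ?(ltW N0)// exprVn.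
apply: ltW; apply: lt_trans (archi_boundP _) _; first by rewrite invr_ge0 exprn_ge0// ltW.
by rewrite ltr_nat.
Qed.

Lemma cvg_wave_var K (t : 'I_K * 'I_2 * 'I_c -> R) :
  wave_var (fun l => (n nu l)%:R / (N nu)%:R) t @[nu --> \oo] --> wave_var p t.
Proof.
rewrite /wave_var; apply: cvgMr; apply: cvg_fsum => q.
apply: cvgB; first exact: cvg_cst.
have h : \sum_l Num.sqrt ((n nu l)%:R / (N nu)%:R) * t (q, l) @[nu --> \oo] -->
    \sum_l Num.sqrt (p l) * t (q, l).
  apply: cvg_fsum => l; apply: cvgMl.
  exact: (cvg_comp _ _ (@hnp l) (@sqrt_continuous R (p l))).
rewrite expr2; under eq_fun do rewrite expr2.
exact: cvgM.
Qed.

Lemma cvg_char_rank_wave K (t : 'I_K * 'I_2 * 'I_c -> R) (a : R) :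
  avg (fun s => cos (\sum_e t e * rank_wave (n := n nu) e.1.1.+1 e.1.2 e.2 s + a))
    @[nu --> \oo] -->
  \int[P]_w cos (\sum_e t e * limit_var p Z w e.1.1.+1 e.1.2 e.2 + a).
Proof.
rewrite (Rintegral_cos_limit_var p0 p1 hZmeas hZ hZindep).
have [B B0 nB] := near_ratio_le.
pose S : R := \sum_e `|t e| * Num.sqrt B.
pose C : R := 16 * S ^+ 3 + (4 * c%:R ^+ 2 + 4) * S ^+ 2.
pose lim nu : R := cos a * expR (- wave_var (fun l => (n nu l)%:R / (N nu)%:R) t / 2).
have c1 : lim nu @[nu --> \oo] --> cos a * expR (- wave_var p t / 2).
  have c0 : - wave_var (fun l => (n nu l)%:R / (N nu)%:R) t / 2 @[nu --> \oo] -->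
      - wave_var p t / 2.
    by apply: cvgMl; apply: cvgN; exact: cvg_wave_var.
  by apply: cvgMr; exact: (cvg_comp _ _ c0 (@continuous_expR R _)).
have c2 : (Num.sqrt (N nu)%:R)^-1 * C @[nu --> \oo] --> (0 : R).
  by rewrite -(mul0r C); apply: cvgMl; exact: cvg_inv_sqrt_total.
set u := (fun nu => avg _).
have -> : u = (fun nu => (u nu - lim nu) + lim nu).
  by apply/funext => nu; rewrite subrK.
rewrite -[X in _ --> X]add0r; apply: cvgD c1.
apply: norm_cvg0; apply: (@squeeze_cvgr _ _ _ _ (fun=> 0)); [|exact: cvg_cst|exact: c2].
near=> nu; rewrite normr_ge0/=.
apply: rank_wave_clt => //.
- by near: nu; exact: near_total_size_gt.
- by near: nu.
Unshelve. all: by end_near. Qed.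

Context (b : nat -> R) (F : 'rV[R]_c -> R) (B L : R).
Hypothesis FB : forall x, `|F x| <= B.
Hypothesis L0 : 0 <= L.
Hypothesis FL : forall x y, `|F x - F y| <= L * `|x - y|.

Lemma lipschitz_row_le (u v : 'I_c -> R) :
  `|F (\row_l u l) - F (\row_l v l)| <= L * \sum_l `|u l - v l|.
Proof.
apply: le_trans (FL _ _) _; rewrite ler_wpM2l//.
rewrite (_ : _ - _ = \row_l (u l - v l)); last by apply/rowP => l; rewrite !mxE.
exact: row_norm_le.
Qed.

Lemma measurable_limit_var k r l : (1 <= k)%N ->
  measurable_fun setT (fun w => limit_var p Z w k r l).
Proof.
move=> k1; apply: measurable_funM => //.
exact: (measurable_tnth_Z hZ).
Qed.

(** The squares of the waves are not bounded, but they are Lipschitz functions on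
    every cube, which is all that [cvg_mean] asks for. *)
Lemma cvg_truncated K :
  avg (fun s => F (\row_l \sum_(k < K) b k.+1 *
    \sum_(r < 2) rank_wave (n := n nu) k.+1 r l s ^+ 2)) @[nu --> \oo] -->
  \int[P]_w F (\row_l \sum_(k < K) b k.+1 *
    \sum_(r < 2) limit_var p Z w k.+1 r l ^+ 2).
Proof.
pose D := ('I_K * 'I_2 * 'I_c)%type.
pose g (x : D -> R) : R := F (\row_l \sum_(k < K) b k.+1 * \sum_(r < 2) x (k, r, l) ^+ 2).
pose W nu (e : D) s : R := rank_wave (n := n nu) e.1.1.+1 e.1.2 e.2 s.
pose X w (e : D) : R := limit_var p Z w e.1.1.+1 e.1.2 e.2.
have [A A0 nA] := near_ratio_le.
apply: (@cvg_mean R D _ W _ T P X _ _ (\sum_(e : D) (4 * A)) _ _ g B) => //.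
- by move=> e; exact: measurable_limit_var.
- move=> e; have [iZ _] := integrable_sqr_tnth p0 p1 hZ e.1.2 e.2 (ltn0Sn e.1.1).
  rewrite (_ : _ \o _ = (fun w => (p e.2 / 2)%:E *
      (EFin \o (fun w => (tnth (Z e.1.1.+1 e.1.2 w) e.2 : R) ^+ 2)%R) w)%E).
    exact: integrableZl.
  apply/funext => w; rewrite /= -EFinM /X /limit_var exprMn sqr_sqrtr//.
  by rewrite divr_ge0// ltW.
- near=> nu; apply: ler_sum => e _.
  have KN : (K < N nu)%N by near: nu; exact: near_total_size_gt.
  have nAnu : forall l, (N nu)%:R <= A * (n nu l)%:R by near: nu.
  have NK : ~~ (N nu %| e.1.1.+1)%N.
    by apply/negP => /dvdn_leq; have := ltn_ord e.1.1; lia.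
  apply: le_trans (avg_sqr_rank_wave_le (@n0 nu) e.1.2 e.2 NK) _.
  by rewrite ler_pdivrMr ?ltr0n// -mulrA ler_wpM2l.
- by move=> t a; exact: cvg_char_rank_wave.
- by move=> x; exact: FB.
- apply: (measurable_lipschitz_row (h := fun l w => \sum_(k < K) b k.+1 *
    \sum_(r < 2) X w (k, r, l) ^+ 2) FL) => l; apply: measurable_sum => k.
  apply: measurable_funM => //; apply: measurable_sum => r; apply: measurable_funX.
  exact: measurable_limit_var.
move=> M M0; pose beta : R := \sum_(k < K) `|b k.+1|.
have beta0 : 0 <= beta by rewrite sumr_ge0.
exists (L * (beta * (2 * M))); first by rewrite mulr_ge0// mulr_ge0// mulr_ge0// ltW.
move=> x y xM yM; apply: le_trans (lipschitz_row_le _ _) _.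
rewrite -mulrA ler_wpM2l//.
have E : \sum_(e : D) `|x e - y e| =
    \sum_l \sum_(k < K) \sum_(r < 2) `|x (k, r, l) - y (k, r, l)|.
  transitivity (\sum_(e : ('I_K * 'I_2) * 'I_c) `|x (e.1, e.2) - y (e.1, e.2)|).
    by apply: eq_bigr => -[].
  rewrite -(pair_bigA _ (fun q l => `|x (q, l) - y (q, l)|))/= exchange_big/=.
  apply: eq_bigr => l _; rewrite [RHS]pair_bigA/=.
  by apply: eq_bigr => -[].
rewrite E mulr_sumr; apply: ler_sum => l _.
rewrite -sumrB mulr_sumr; apply: le_trans (ler_norm_sum _ _ _) _.
apply: ler_sum => k _; rewrite -mulrBr -sumrB normrM -mulrA.
apply: ler_pM => //.
  by rewrite /beta (bigD1 k)//= lerDl sumr_ge0.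
rewrite mulr_sumr; apply: le_trans (ler_norm_sum _ _ _) _.
apply: ler_sum => r _; rewrite subr_sqr mulrC normrM ler_wpM2r//.
apply: le_trans (ler_normD _ _) _.
by have := xM (k, r, l); have := yM (k, r, l); lra.
Unshelve. all: by end_near. Qed.

End FixedLevel.

(** * Tails of the coefficients *)

Section MultiplesTail.
Context {R : realType}.

Lemma sum_multiples (F : nat -> R) (N J : nat) : (0 < N)%N ->
  \sum_(0 <= k < J * N | (N %| k.+1)%N) F k.+1 = \sum_(0 <= j < J) F (j.+1 * N)%N.
Proof.
case: N => // N _; elim: J => [|J IH]; first by rewrite mul0n !big_geq.
rewrite big_nat_recr//= -IH (big_cat_nat (n := (J * N.+1)%N))//=; last by rewrite leq_mul.
congr (_ + _); rewrite mulSn addnC.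
rewrite addnS big_mkcond/= big_nat_recr ?leq_addr//= -addnS -mulSnr dvdn_mull//.
rewrite big_nat_cond big1 ?add0r// => k; rewrite andbT => /andP[k1 k2].
case: ifP => // /dvdnP[q qE]; exfalso.
have h1 : (J * N.+1 < q * N.+1)%N by rewrite -qE.
have h2 : (q * N.+1 < J.+1 * N.+1)%N by rewrite -qE mulSn addnC addnS ltnS.
by move: h1 h2; rewrite !ltn_mul2r/= => h1 h2; lia.
Qed.

Lemma powR_antitone (x y s : R) : 0 <= s -> 0 < x -> x <= y -> y `^ (- s) <= x `^ (- s).
Proof.
move=> s0 x0 xy; have y0 := lt_le_trans x0 xy.
by rewrite !powRN lef_pV2 ?posrE ?powR_gt0// ge0_ler_powR ?nnegrE// ltW.
Qed.

(** Cauchy condensation: the terms between two powers of [2] are bounded by a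
    geometric term. *)
Lemma pseries_le (delta : R) (J : nat) : 0 < delta ->
  \sum_(0 <= j < J) j.+1%:R `^ (- (1 + delta)) <= (1 - 2 `^ (- delta))^-1 :> R.
Proof.
move=> d0; set s := 1 + delta; set q := 2 `^ (- delta).
have s0 : 0 <= s by rewrite /s addr_ge0// ltW.
have q0 : 0 < q by exact: powR_gt0.
have q1 : q < 1.
  rewrite /q powRN invf_lt1 ?powR_gt0//.
  have : 1 `^ delta < 2 `^ delta :> R by apply: gt0_ltr_powR; rewrite ?nnegrE ?ltr1n.
  by rewrite powR1.
have dy i : \sum_(1 <= m < 2 ^ i) m%:R `^ (- s) <= \sum_(0 <= h < i) q ^+ h.
  elim: i => [|i IH]; first by rewrite expn0 !big_geq.
  rewrite big_nat_recr//= (big_cat_nat (n := (2 ^ i)%N)) ?expn_gt0 ?leq_exp2l//=.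
  apply: lerD => //.
  have p0 : 0 < (2 ^ i)%:R :> R by rewrite ltr0n expn_gt0.
  apply: (@le_trans _ _ (\sum_(2 ^ i <= m < 2 ^ i.+1) (2 ^ i)%:R `^ (- s))).
    rewrite big_nat_cond [leRHS]big_nat_cond; apply: ler_sum => m /andP[/andP[m1 _] _].
    by apply: powR_antitone => //; rewrite ler_nat.
  rewrite sumr_const_nat expnS mul2n -addnn addnK -[leLHS]mulr_natl /s opprD.
  rewrite powRD ?(gt_eqF p0) ?implybT// powR_inv1 ?ler0n// mulrA divff ?gt_eqF// mul1r.
  by rewrite natrX -powR_mulrn// -powRrM mulrC powRrM powR_mulrn.
have JE : (J.+1 <= 2 ^ J)%N by exact: ltn_expl.
have -> : \sum_(0 <= j < J) j.+1%:R `^ (- s) = \sum_(1 <= m < J.+1) m%:R `^ (- s) :> R.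
  by rewrite big_add1.
apply: (@le_trans _ _ (\sum_(1 <= m < 2 ^ J) m%:R `^ (- s))).
  rewrite [leRHS](big_cat_nat (n := J.+1))//= lerDl.
  by apply: sumr_ge0 => m _; exact: powR_ge0.
apply: le_trans (dy J) _.
have E : (\sum_(0 <= h < J) q ^+ h) * (1 - q) = 1 - q ^+ J.
  rewrite big_mkord; elim: (J) => [|i IH]; first by rewrite big_ord0 mul0r expr0 subrr.
  by rewrite big_ord_recr/= mulrDl IH exprSr; ring.
by rewrite -[leRHS]mul1r ler_pdivlMr ?subr_gt0// E gerBl exprn_ge0// ltW.
Qed.

(** This is where the decay of the coefficients is used: frequencies that are
    multiples of [N] are aliased with the frequency 0, so that the squares of their
    waves are of order [N] instead of 1. *)
Lemma multiples_tail (b : nat -> R) (C delta : R) (k0 N K : nat) :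
  0 < delta -> 0 <= C -> (0 < N)%N -> (k0 <= N)%N ->
  (forall k, (k0 <= k)%N -> `|b k| <= C * k%:R `^ (- (1 + delta))) ->
  N%:R * \sum_(0 <= k < K | (N %| k.+1)%N) `|b k.+1| <=
  C * (1 - 2 `^ (- delta))^-1 * N%:R `^ (- delta).
Proof.
move=> d0 C0 N0 kN bC; have NR : 0 < N%:R :> R by rewrite ltr0n.
have KN : (K <= K * N)%N by rewrite leq_pmulr.
apply: (@le_trans _ _ (N%:R * \sum_(0 <= k < K * N | (N %| k.+1)%N) `|b k.+1|)).
  rewrite ler_wpM2l// [leRHS](big_cat_nat (n := K))//= lerDl.
  by rewrite sumr_ge0.
rewrite (sum_multiples (fun k => `|b k|))//.
apply: (@le_trans _ _ (N%:R * \sum_(0 <= j < K)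
    (C * N%:R `^ (- (1 + delta)) * j.+1%:R `^ (- (1 + delta))))).
  rewrite ler_wpM2l//; apply: ler_sum => j _.
  rewrite -mulrA -powRM// [_%:R * _]mulrC -natrM; apply: bC.
  by apply: leq_trans kN _; rewrite leq_pmull.
rewrite -mulr_sumr.
have -> : N%:R `^ (- (1 + delta)) = N%:R^-1 * N%:R `^ (- delta) :> R.
  by rewrite opprD powRD ?(gt_eqF NR) ?implybT// powR_inv1.
rewrite !mulrA [N%:R * C]mulrC mulfK ?gt_eqF//.
rewrite -mulrA [_ * \sum_(_ <= _ < _) _]mulrC mulrA ler_wpM2r ?powR_ge0//.
by rewrite ler_wpM2l// pseries_le.
Qed.

End MultiplesTail.

(** * Truncation of the rank statistic *)

Section RankStatistic.
Context {R : realType} {c : nat} (n : 'I_c -> nat).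
Hypothesis n0 : forall l, (0 < n l)%N.
Notation I := {l : 'I_c & 'I_(n l)}.
Notation N := (total_size n).

(** [S_stat] as a function of the ranks, for which [rho] may be any family of
    integers: the ranks will be replaced by a random permutation. *)
Definition rank_stat (phi : R -> R) (rho : I -> nat) (l : 'I_c) : R :=
  (n l)%:R^-1 * \sum_(i < n l) \sum_(j < n l)
    phi (cos (2 * pi * (rho (Tagged (fun l => 'I_(n l)) i))%:R / N%:R
            - 2 * pi * (rho (Tagged (fun l => 'I_(n l)) j))%:R / N%:R)).

Definition perm_rank (s : {perm I}) (i : I) : nat := (enum_rank (s i)).+1.

Context (phi : R -> R) (b : nat -> R).
Hypothesis expand : forall theta : R,
  \sum_(1 <= k < K) b k * cos (k%:R * theta) @[K --> \oo] --> phi (cos theta).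

(** The addition formula for [cos (x - y)]: the two phases give the cosine and the
    sine of the same angle. *)
Lemma sum_sqr_rank_wave k l s : \sum_(r < 2) rank_wave (n := n) k r l s ^+ 2 =
  (n l)%:R^-1 * \sum_(i < n l) \sum_(j < n l)
    cos (k%:R * (2 * pi * (perm_rank s (Tagged (fun l => 'I_(n l)) i))%:R / N%:R
            - 2 * pi * (perm_rank s (Tagged (fun l => 'I_(n l)) j))%:R / N%:R)) :> R.
Proof.
rewrite big_ord_recl big_ord1 /rank_wave !exprMn exprVn sqr_sqrtr// -mulrDr.
congr (_ * _); rewrite !expr2 !mulr_suml -big_split/=; apply: eq_bigr => i _.
rewrite !mulr_sumr -big_split/=; apply: eq_bigr => j _.
rewrite /score_wave /= mul0r !subr0 mul1r !cosBpihalf mulrBr [RHS]cosB.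
by rewrite /perm_rank.
Qed.

Lemma cvg_rank_stat s l :
  \sum_(k < K) b k.+1 * \sum_(r < 2) rank_wave (n := n) k.+1 r l s ^+ 2 @[K --> \oo] -->
  rank_stat phi (perm_rank s) l.
Proof.
pose th (i j : 'I_(n l)) : R :=
  2 * pi * (perm_rank s (Tagged (fun l => 'I_(n l)) i))%:R / N%:R
  - 2 * pi * (perm_rank s (Tagged (fun l => 'I_(n l)) j))%:R / N%:R.
rewrite (_ : (fun K => _) = fun K => (n l)%:R^-1 * \sum_(i < n l) \sum_(j < n l)
    \sum_(k < K) b k.+1 * cos (k.+1%:R * th i j)); last first.
  apply/funext => K.
  transitivity ((n l)%:R^-1 * \sum_(k < K) \sum_(i < n l) \sum_(j < n l)
      b k.+1 * cos (k.+1%:R * th i j)).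
    rewrite mulr_sumr; apply: eq_bigr => k _; rewrite sum_sqr_rank_wave mulrCA.
    congr (_ * _); rewrite mulr_sumr; apply: eq_bigr => i _.
    by rewrite mulr_sumr.
  congr (_ * _); rewrite exchange_big/=; apply: eq_bigr => i _.
  by rewrite exchange_big.
apply: cvgMr; apply: cvg_fsum => i; apply: cvg_fsum => j.
have := @expand (th i j); rewrite -(cvg_shiftS (fun K => \sum_(1 <= k < K) _)).
rewrite (_ : (fun K => \sum_(1 <= k < K.+1) _) =
   (fun K => \sum_(k < K) b k.+1 * cos (k.+1%:R * th i j)))//.
by apply/funext => K; rewrite big_add1 big_mkord.
Qed.

(** The error of truncating at level [K]: regular frequencies contribute their
    coefficients, aliased ones [N] times their coefficients. *)
Lemma avg_rank_stat_tail l (K : nat) (B e M : R) : 0 <= B ->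
  N%:R <= B * (n l)%:R ->
  (forall K', \sum_(K <= k < K') `|b k.+1| <= e) ->
  (forall K', N%:R * \sum_(0 <= k < K' | (N %| k.+1)%N) `|b k.+1| <= M) ->
  avg (fun s => `|rank_stat phi (perm_rank s) l -
     \sum_(k < K) b k.+1 * \sum_(r < 2) rank_wave (n := n) k.+1 r l s ^+ 2|)
  <= 8 * B * e + 2 * M.
Proof.
move=> B0 NB he hM; have n0R : 0 < (n l)%:R :> R by rewrite ltr0n.
pose S K s : R := \sum_(k < K) b k.+1 * \sum_(r < 2) rank_wave (n := n) k.+1 r l s ^+ 2.
have lim : avg (fun s => `|S K' s - S K s|) @[K' --> \oo] -->
    avg (fun s => `|rank_stat phi (perm_rank s) l - S K s|).
  apply: cvgMl; apply: cvg_fsum => s; apply: cvg_norm.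
  by apply: cvgB; [exact: cvg_rank_stat|exact: cvg_cst].
apply: (cvgr_to_le lim); exists K => // K' /= KK'.
have SE s : S K' s - S K s =
    \sum_(K <= k < K') b k.+1 * \sum_(r < 2) rank_wave (n := n) k.+1 r l s ^+ 2.
  by rewrite /S -!(big_mkord xpredT (fun k => b k.+1 * \sum_(r < 2) rank_wave (n := n) k.+1 r l s ^+ 2))
    (big_cat_nat (n := K))//= addrAC subrr add0r.
under eq_avg => s do rewrite SE.
apply: (@le_trans _ _ (\sum_(K <= k < K') `|b k.+1| *
    \sum_(r < 2) avg (fun s => rank_wave (n := n) k.+1 r l s ^+ 2))).
  apply: (@le_trans _ _ (avg (fun s => \sum_(K <= k < K') `|b k.+1| *
    \sum_(r < 2) rank_wave (n := n) k.+1 r l s ^+ 2))).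
    apply: ler_avg => s; apply: le_trans (ler_norm_sum _ _ _) _.
    apply: ler_sum => k _; rewrite normrM ler_wpM2l// ger0_norm//.
    by apply: sumr_ge0 => r _; exact: sqr_ge0.
  rewrite avg_sum; apply: ler_sum => k _.
  by rewrite avgZ avg_sum.
apply: (@le_trans _ _ (\sum_(K <= k < K') (8 * B * `|b k.+1| +
   (if (N %| k.+1)%N then 2 * (N%:R * `|b k.+1|) else 0)))).
  apply: ler_sum => k _; rewrite big_ord_recl big_ord1.
  case: ifPn => Nk.
    have h r : avg (fun s => rank_wave (n := n) k.+1 r l s ^+ 2) <= N%:R :> R.
      rewrite -[leRHS](@avg_cst R I); apply: ler_avg => s.
      apply: le_trans (sqr_rank_wave_le n0 _ _ _ _) _.
      by rewrite ler_nat /total_size (bigD1 l)//= leq_addr.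
    have -> : 2 * (N%:R * `|b k.+1|) = `|b k.+1| * (N%:R + N%:R) by ring.
    rewrite -[leLHS]add0r lerD ?mulr_ge0//.
    by rewrite ler_wpM2l// lerD.
  have h r : avg (fun s => rank_wave (n := n) k.+1 r l s ^+ 2) <= 4 * B :> R.
    apply: le_trans (avg_sqr_rank_wave_le n0 r l Nk) _.
    by rewrite ler_pdivrMr// -mulrA ler_wpM2l.
  rewrite addr0 mulrC (_ : 8 * B = 4 * B + 4 * B); last by ring.
  by rewrite ler_wpM2r// lerD.
rewrite big_split/= -mulr_sumr -big_mkcond/=; apply: lerD.
  by rewrite ler_wpM2l ?he// mulr_ge0.
rewrite -mulr_sumr ler_wpM2l// -mulr_sumr; apply: le_trans (hM K').
rewrite ler_wpM2l// [leRHS](big_cat_nat (n := K))//= lerDr.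
by rewrite sumr_ge0.
Qed.

End RankStatistic.

(** * The limiting series *)

Section SummableSeries.
Context d (T : measurableType d) {R : realType} (P : probability T R).

(** By monotone convergence the sum has a finite expectation, hence is almost
    surely finite. *)
Lemma ae_cvg_series (g : nat -> T -> R) (M : R) :
  (forall k w, 0 <= g k w) ->
  (forall k, P.-integrable setT (EFin \o g k)) ->
  (forall K, \sum_(k < K) \int[P]_w g k w <= M) ->
  {ae P, forall w, cvgn (series (g ^~ w))}.
Proof.
move=> g0 gi gM.
have mg k : measurable_fun setT (EFin \o g k) by exact: (measurable_int _ (gi k)).
have g0' k w : setT w -> (0 <= (EFin \o g k) w)%E by move=> _; rewrite lee_fin.
have iE : (\int[P]_w (\sum_(k <oo) (EFin \o g k) w) <= M%:E)%E.
  rewrite integral_nneseries//; apply: lime_le.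
    by apply: is_cvg_nneseries => k _ _; apply: integral_ge0 => w; exact: g0'.
  apply: nearW => K; rewrite big_mkord.
  apply: le_trans (_ : ((\sum_(k < K) \int[P]_w g k w)%:E <= M%:E)%E); last by rewrite lee_fin.
  rewrite -sumEFin; apply: lee_sum => k _.
  by rewrite /Rintegral fineK//; exact: (integrable_fin_num measurableT (gi k)).
have iS : P.-integrable setT (fun w => \sum_(k <oo) (EFin \o g k) w)%E.
  apply/integrableP; split.
    by apply: ge0_emeasurable_sum => // k w wT _; exact: g0'.
  apply: le_lt_trans (le_lt_trans iE (ltry _)).
  rewrite le_eqVlt; apply/orP; left; apply/eqP; apply: eq_integral => w _.
  by rewrite gee0_abs//; apply: nneseries_ge0 => k _ _; exact: g0'.
apply: filterS (integrable_ae measurableT iS) => w /(_ I) wfin.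
apply: nondecreasing_is_cvgn; first exact: nondecreasing_series.
exists (fine (\sum_(k <oo) (EFin \o g k) w)%E) => _ [K _ <-].
rewrite -lee_fin fineK// /series/= -sumEFin.
by apply: (nneseries_lim_ge (u_ := fun k => (g k w)%:E)) => k _ _; rewrite lee_fin.
Qed.

End SummableSeries.

Section LimitSeries.
Context {R : realType} {c : nat} (p : 'I_c -> R).
Hypothesis p0 : forall l, 0 < p l.
Hypothesis p1 : \sum_l p l = 1.
Context d (T : measurableType d) (P : probability T R).
Context (Z : nat -> 'I_2 -> T -> c.-tuple (measurableTypeR R)).
Hypothesis hZ : forall k r, (1 <= k)%N -> is_mvnormal P (Z k r) 0 (limit_cov p).
Context (b : nat -> R).
Hypothesis bsum : cvgn (series (fun k => `|b k.+1|)).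

Let G k w : R := \sum_l \sum_(r < 2) limit_var p Z w k.+1 r l ^+ 2.

Let integrable_sqr_limit_var k r l :
  P.-integrable setT (EFin \o (fun w => limit_var p Z w k.+1 r l ^+ 2)) /\
  \int[P]_w (limit_var p Z w k.+1 r l ^+ 2) = p l / 2 * normal_sqr ((p l)^-1 - 1).
Proof.
have [iZ EZ] := integrable_sqr_tnth p0 p1 hZ r l (ltn0Sn k).
rewrite (_ : (fun w => _) = fun w => p l / 2 * (tnth (Z k.+1 r w) l : R) ^+ 2).
  split; first exact: (integrableZl measurableT (p l / 2) iZ).
  by rewrite RintegralZl// EZ.
apply/funext => w; rewrite /limit_var exprMn sqr_sqrtr//.
by rewrite divr_ge0// ltW.
Qed.

Let V : R := \sum_l \sum_(r < 2) p l / 2 * normal_sqr ((p l)^-1 - 1).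

Let iG k : P.-integrable setT (EFin \o G k) /\ \int[P]_w G k w = V.
Proof.
have h l := Rintegral_fsum (index_enum 'I_2) (fun r => (integrable_sqr_limit_var k r l).1).
have [h1 h2] := Rintegral_fsum (index_enum 'I_c) (fun l => (h l).1).
split=> //; rewrite h2; apply: eq_bigr => l _; rewrite (h l).2.
by apply: eq_bigr => r _; rewrite (integrable_sqr_limit_var k r l).2.
Qed.

(** The variables [G k], which up to the coefficients dominate the terms of all
    samples, have the same expectation for all [k]; the coefficients are summable. *)
Lemma ae_cvg_limit_series : {ae P, forall w, forall l,
  cvgn (fun K => \sum_(k < K) b k.+1 * \sum_(r < 2) limit_var p Z w k.+1 r l ^+ 2)}.
Proof.
have G0 k w : 0 <= G k w.
  by apply: sumr_ge0 => l _; apply: sumr_ge0 => r _; exact: sqr_ge0.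
have V0 : 0 <= V by rewrite -(iG 0).2; apply: Rintegral_ge0.
have bG K : \sum_(k < K) \int[P]_w (`|b k.+1| * G k w) <=
    limn (series (fun k => `|b k.+1|)) * V.
  have E k : \int[P]_w (`|b k.+1| * G k w) = `|b k.+1| * V.
    by rewrite RintegralZl// ?(iG k).2//; exact: (iG k).1.
  under eq_bigr do rewrite E.
  rewrite -mulr_suml ler_wpM2r// -(big_mkord xpredT (fun k => `|b k.+1|)).
  by apply: (nondecreasing_cvgn_le _ bsum); exact: nondecreasing_series.
have h0 k w : 0 <= `|b k.+1| * G k w by rewrite mulr_ge0.
have hi k : P.-integrable setT (EFin \o (fun w => `|b k.+1| * G k w)).
  exact: (integrableZl measurableT `|b k.+1| (iG k).1).
apply: filterS (ae_cvg_series h0 hi bG) => w wG l.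
rewrite (_ : (fun K => _) =
  series (fun k => b k.+1 * \sum_(r < 2) limit_var p Z w k.+1 r l ^+ 2)); last first.
  by apply/funext => K; rewrite /series/= big_mkord.
have bd k : `|b k.+1 * \sum_(r < 2) limit_var p Z w k.+1 r l ^+ 2| <= `|b k.+1| * G k w.
  rewrite normrM ler_wpM2l// ger0_norm; last by apply: sumr_ge0 => r _; exact: sqr_ge0.
  rewrite /G (bigD1 l)//= lerDl; apply: sumr_ge0 => l' _.
  by apply: sumr_ge0 => r _; exact: sqr_ge0.
by apply: (@normed_cvg R R^o); apply: series_le_cvg wG => k //=; exact: bd.
Qed.

Context (F : 'rV[R]_c -> R) (B L : R).
Hypothesis FB : forall x, `|F x| <= B.
Hypothesis L0 : 0 <= L.
Hypothesis FL : forall x y, `|F x - F y| <= L * `|x - y|.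

Let S (K : nat) w l : R :=
  \sum_(k < K) b k.+1 * \sum_(r < 2) limit_var p Z w k.+1 r l ^+ 2.

Lemma measurable_limit_sum K l : measurable_fun setT (fun w => S K w l).
Proof.
apply: measurable_sum => k; apply: measurable_funM => //.
apply: measurable_sum => r; apply: measurable_funX.
by apply: measurable_funM => //; exact: (measurable_tnth_Z hZ).
Qed.

Lemma measurable_limit_series :
  measurable_fun setT (fun w => F (\row_l limn (fun K => S K w l))).
Proof.
apply: (measurable_lipschitz_row (h := fun l w => limn (fun K => S K w l)) FL) => l.
by apply: measurable_limn => K; exact: measurable_limit_sum.
Qed.

(** Dominated convergence: [F] is bounded and continuous. *)
Lemma cvg_limit_series :
  \int[P]_w F (\row_l S K w l) @[K --> \oo] -->
  \int[P]_w F (\row_l limn (fun K => S K w l)).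
Proof.
have mS K : measurable_fun setT (fun w => F (\row_l S K w l)).
  apply: (measurable_lipschitz_row (h := fun l w => S K w l) FL) => l.
  exact: measurable_limit_sum.
have i : P.-integrable setT (EFin \o (fun w => F (\row_l limn (fun K => S K w l)))).
  apply: (@integrable_bounded _ _ _ _ _ B); first exact: measurable_limit_series.
  by move=> w; exact: FB.
have [_ _] : [/\ P.-integrable setT (EFin \o (fun w => F (\row_l limn (fun K => S K w l)))),
    (fun K => \int[P]_w `|(F (\row_l S K w l))%:E - (F (\row_l limn (fun K => S K w l)))%:E|)%E
      @ \oo --> 0%E &
    (fun K => \int[P]_w (F (\row_l S K w l))%:E)%E @ \oo -->
      (\int[P]_w (F (\row_l limn (fun K => S K w l)))%:E)%E].
  apply: (@dominated_convergence _ _ _ P _ measurableT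
     (fun K w => (F (\row_l S K w l))%:E) _ (fun=> B%:E)).
  - by move=> K; exact/measurable_EFinP.
  - exact/measurable_EFinP/measurable_limit_series.
  - apply: filterS ae_cvg_limit_series => w wS _; apply: cvg_EFin; first exact: nearW.
    have h0 : L * \sum_l `|S K w l - limn (fun K => S K w l)| @[K --> \oo] --> L * \sum_(l < c) (0 : R).
      apply: cvgMr; apply: cvg_fsum => l; apply/norm_cvg0P.
      rewrite -(subrr (limn (fun K => S K w l))).
      by apply: cvgB; [exact: wS|exact: cvg_cst].
    rewrite big1// mulr0 in h0.
    set u := (fun K => _); rewrite /comp/= in u *.
    apply/cvgrPdist_le => e e0; move/cvgr_le: h0 => /(_ _ e0); apply: filterS => K.
    by apply: le_trans; rewrite distrC; exact: (lipschitz_row_le L0 FL).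
  - by apply: (@integrable_bounded _ _ _ P (fun=> B) `|B|).
  - by apply: aeW => w K _; rewrite lee_fin.
by rewrite -[X in _ --> X](fineK (integrable_fin_num measurableT i)) => /fine_cvg.
Qed.

End LimitSeries.

(** * Passage to infinitely many frequencies *)

Section NullLimit.
Context {R : realType} {c : nat} (p : 'I_c -> R).
Hypothesis p0 : forall l, 0 < p l.
Hypothesis p1 : \sum_l p l = 1.
Context d (T : measurableType d) (P : probability T R).
Context (Z : nat -> 'I_2 -> T -> c.-tuple (measurableTypeR R)).
Hypothesis hZmeas : forall k r, (1 <= k)%N -> measurable_fun [set: T] (Z k r).
Hypothesis hZ : forall k r, (1 <= k)%N -> is_mvnormal P (Z k r) 0 (limit_cov p).
Hypothesis hZindep : mutually_independent P (fun s : nat * 'I_2 => Z s.1.+1 s.2).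
Context (n : nat -> 'I_c -> nat).
Hypothesis n0 : forall nu l, (0 < n nu l)%N.
Hypothesis hN : (fun nu => total_size (n nu)) @ \oo --> \oo.
Hypothesis hnp : forall l,
  (n nu l)%:R / (total_size (n nu))%:R @[nu --> \oo] --> p l.
Local Notation N nu := (total_size (n nu)).

Context (phi : R -> R) (b : nat -> R).
Hypothesis expand : forall theta : R,
  \sum_(1 <= k < K) b k * cos (k%:R * theta) @[K --> \oo] --> phi (cos theta).
Hypothesis bsum : cvgn (series (fun k => `|b k.+1|)).
Context (delta C : R) (k0 : nat).
Hypothesis delta0 : 0 < delta.
Hypothesis C0 : 0 <= C.
Hypothesis bC : forall k, (k0 <= k)%N -> `|b k| <= C * k%:R `^ (- (1 + delta)).

Context (F : 'rV[R]_c -> R) (B L : R).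
Hypothesis FB : forall x, `|F x| <= B.
Hypothesis L0 : 0 <= L.
Hypothesis FL : forall x y, `|F x - F y| <= L * `|x - y|.

Lemma near_total_powR_le (e : R) : 0 < e ->
  \forall nu \near \oo, (N nu)%:R `^ (- delta) <= e.
Proof.
move=> e0; pose x := e^-1 `^ delta^-1.
apply: filterS (near_total_size_gt hN (Num.bound x)) => nu hK.
have N0 : 0 < (N nu)%:R :> R by rewrite ltr0n; exact: leq_ltn_trans hK.
have x0 : 0 <= x by exact: powR_ge0.
rewrite powRN invf_ple ?posrE ?powR_gt0//.
have -> : e^-1 = x `^ delta.
  by rewrite -powRrM mulVf ?gt_eqF// powRr1// invr_ge0 ltW.
apply: ge0_ler_powR; rewrite ?nnegrE ?(ltW delta0) ?(ltW N0)//.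
by apply: ltW; apply: lt_trans (archi_boundP x0) _; rewrite ltr_nat.
Qed.

Lemma near_tail_le (e : R) : 0 < e ->
  \forall K \near \oo, forall K', \sum_(K <= k < K') `|b k.+1| <= e.
Proof.
move=> e0; have /cvgrPdist_le/(_ _ e0) := bsum; apply: filterS => K hK K'.
have [KK'|K'K] := leqP K K'; last by rewrite big_geq ?ltW// ltnW.
apply: le_trans hK; apply: le_trans (ler_norm _).
rewrite lerBrDl /series/= -big_cat_nat//=.
by apply: (nondecreasing_cvgn_le _ bsum); exact: nondecreasing_series.
Qed.

Local Notation trunc nu K s := (\row_l \sum_(k < K) b k.+1 *
  \sum_(r < 2) rank_wave (n := n nu) k.+1 r l s ^+ 2).
Local Notation full nu s := (\row_l rank_stat (n := n nu) phi (perm_rank s) l).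

(** The regular frequencies are controlled by the tail of the coefficients, whatever
    the sample sizes, and the aliased ones vanish as [N] grows; the level [K] can
    therefore be chosen before [nu]. *)
Lemma avg_truncation (e : R) : 0 < e -> \forall K \near \oo, \forall nu \near \oo,
  `|avg (fun s => F (full nu s)) - avg (fun s => F (trunc nu K s))| <= e.
Proof.
move=> e0; have [A A0 nA] := near_ratio_le p0 hN hnp.
pose D := L * (c%:R * (8 * A)) + 1.
have D0 : 0 < D.
  by rewrite ltr_wpDl// mulr_ge0// mulr_ge0// mulr_ge0// ltW.
pose C1 := C * (1 - 2 `^ (- delta))^-1.
pose D' : R := `|L * (c%:R * (2 * C1))| + 1.
have D'0 : 0 < D' by rewrite ltr_wpDl.
have e1 : 0 < e / 2 / D by rewrite !divr_gt0.
have e2 : 0 < e / 2 / D' by rewrite !divr_gt0.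
apply: filterS (near_tail_le e1) => K tail.
near=> nu.
have KN : (k0 < N nu)%N by near: nu; exact: near_total_size_gt.
have NA : forall l, (N nu)%:R <= A * (n nu l)%:R by near: nu; exact: nA.
have Ne : (N nu)%:R `^ (- delta) <= e / 2 / D'.
  by near: nu; exact: near_total_powR_le.
rewrite -avgB; apply: le_trans (ler_norm_avg _) _.
apply: (@le_trans _ _ (avg (fun s => L * \sum_l `|rank_stat (n := n nu) phi (perm_rank s) l -
    \sum_(k < K) b k.+1 * \sum_(r < 2) rank_wave (n := n nu) k.+1 r l s ^+ 2|))).
  by apply: ler_avg => s; exact: (lipschitz_row_le L0 FL).
rewrite avgZ avg_sum.
apply: (@le_trans _ _ (L * \sum_(l < c) (8 * A * (e / 2 / D) + 2 * (C1 * (N nu)%:R `^ (- delta))))).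
  rewrite ler_wpM2l//; apply: ler_sum => l _.
  apply: (avg_rank_stat_tail (n0 nu) expand (ltW A0) (NA l) tail) => K'.
  exact: (multiples_tail _ delta0 C0 (leq_ltn_trans (leq0n _) KN) (ltnW KN) bC).
rewrite sumr_const card_ord -[X in L * X]mulr_natl.
have -> : L * (c%:R * (8 * A * (e / 2 / D) + 2 * (C1 * (N nu)%:R `^ (- delta)))) =
    (L * (c%:R * (8 * A))) * (e / 2 / D) + L * (c%:R * (2 * C1)) * (N nu)%:R `^ (- delta) by ring.
rewrite [leRHS](splitr e); apply: lerD.
  rewrite -[leRHS](divfK (lt0r_neq0 D0)) [leRHS]mulrC ler_wpM2r ?(ltW e1)//.
  by rewrite /D lerDl.
rewrite -[leRHS](divfK (lt0r_neq0 D'0)) [leRHS]mulrC.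
apply: le_trans (_ : D' * (N nu)%:R `^ (- delta) <= _); last by rewrite ler_wpM2l// ltW.
by rewrite ler_wpM2r ?powR_ge0// (le_trans (ler_norm _))// lerDl.
Unshelve. all: by end_near. Qed.

(** Exchange of the limits in [K] and [nu], which the uniformity in
    [avg_truncation] justifies. *)
Lemma cvg_avg_rank_stat :
  avg (fun s => F (full nu s)) @[nu --> \oo] -->
  \int[P]_w F (\row_l limn (fun K =>
    \sum_(k < K) b k.+1 * \sum_(r < 2) limit_var p Z w k.+1 r l ^+ 2)).
Proof.
apply/cvgrPdist_le => e e0; have e3 : 0 < e / 3 by rewrite divr_gt0.
have /cvgrPdist_le/(_ _ e3) lim := cvg_limit_series p0 p1 hZ bsum FB L0 FL.
have [K _ /(_ K (leqnn K))[near_trunc near_lim]] := filterI (avg_truncation e3) lim.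
have /cvgrPdist_le/(_ _ e3) := cvg_truncated p0 p1 hZmeas hZ hZindep n0 hN hnp (b := b) FB L0 FL (K := K).
apply: filterS2 near_trunc => nu.
set u := avg _; set v := avg _; move: near_lim; set x := \int[P]_w _; set y := \int[P]_w _.
move=> h1 h2 h3; have -> : x - u = (x - y) + (y - v) - (u - v) by ring.
apply: le_trans (ler_normB _ _) _.
apply: le_trans (lerD (ler_normD _ _) (lexx _)) _.
apply: le_trans (lerD (lerD h1 h3) h2) _.
by lra.
Qed.

End NullLimit.

(** * The statistic and its limit *)

Lemma T_statE (R : realType) (c : nat) (n : 'I_c -> nat)
    (theta : forall l : 'I_c, 'I_(n l) -> R) (phi : R -> R) (m : 'rV[R]_c -> R) :
  T_stat theta phi m =
  m (\row_l rank_stat (n := n) phi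
       (rank_of (fun s : {l : 'I_c & 'I_(n l)} => theta (tag s) (tagged s))) l).
Proof.
rewrite /T_stat; congr m; apply/rowP => l; rewrite !mxE /S_stat /rank_stat.
have E (i : 'I_(n l)) : pooled_rank theta i =
    rank_of (fun s : {l : 'I_c & 'I_(n l)} => theta (tag s) (tagged s))
      (Tagged (fun l => 'I_(n l)) i).
  by rewrite /pooled_rank /rank_of sig_big_dep.
congr (_ * _); apply: eq_bigr => i _; apply: eq_bigr => j _.
by rewrite /uniform_score !E.
Qed.

Section LimitStatistic.
Context {R : realType} {c : nat} (p : 'I_c -> R).
Hypothesis p0 : forall l, 0 < p l.
Hypothesis p1 : \sum_l p l = 1.
Context d (T : measurableType d) (P : probability T R).
Context (Z : nat -> 'I_2 -> T -> c.-tuple (measurableTypeR R)).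
Hypothesis hZ : forall k r, (1 <= k)%N -> is_mvnormal P (Z k r) 0 (limit_cov p).
Context (phi : R -> R) (m : 'rV[R]_c -> R) (L : R).
Hypothesis mL : forall x y, `|m x - m y| <= L * `|x - y|.

Local Notation b := (chebyshev_coef phi).
Local Notation lim_stat w := (T_limit p phi m (fun k r => Z k r w)).

Lemma measurable_T_limit : measurable_fun setT (fun w => lim_stat w).
Proof.
apply: (measurable_lipschitz_row (h := fun l w => p l * limn (fun K =>
  \sum_(1 <= k < K) \sum_(r < 2) 2^-1 * b k * (tnth (Z k r w) l : R) ^+ 2)) mL) => l.
apply: measurable_funM => //; apply: measurable_limn => K.
under eq_fun do rewrite big_add1.
apply: measurable_sum => k; apply: measurable_sum => r.
apply: measurable_funM => //; apply: measurable_funX.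
exact: (measurable_tnth_Z hZ).
Qed.

Hypothesis bsum : cvgn (series (fun k => `|b k.+1|)).

(** The equality holds where the series converges; elsewhere both limits are default
    values, and the factor [p l] has a different place on the two sides. *)
Lemma ae_T_limit : {ae P, forall w, lim_stat w =
  m (\row_l limn (fun K =>
    \sum_(k < K) b k.+1 * \sum_(r < 2) limit_var p Z w k.+1 r l ^+ 2))}.
Proof.
apply: filterS (ae_cvg_limit_series p0 p1 hZ bsum) => w cw.
rewrite /T_limit; congr m; apply/rowP => l; rewrite !mxE.
set v := (fun K => \sum_(1 <= k < K) _); set u := (fun K => \sum_(k < K) _).
have uv K : u K = p l * v K.+1.
  rewrite /u /v big_add1 big_mkord mulr_sumr; apply: eq_bigr => k _.
  rewrite !mulr_sumr; apply: eq_bigr => r _.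
  rewrite /limit_var exprMn sqr_sqrtr; last by rewrite divr_ge0// ltW.
  by ring.
have vu : v K.+1 @[K --> \oo] --> (p l)^-1 * limn u.
  rewrite (_ : (fun K => _) = (fun K => (p l)^-1 * u K)).
    by apply: cvgMr; exact: cw.
  by apply/funext => K; rewrite uv mulKf// gt_eqF.
rewrite (cvg_shiftS v) in vu.
by rewrite (cvg_lim _ vu)// mulVKf// gt_eqF.
Qed.

End LimitStatistic.

Theorem theorem5p1 (R : realType) (c : nat) (hc : (2 <= c)%N)
  (phi : R -> R) (hphi : admissible_kernel phi)
  (hb : exists2 delta : R, 0 < delta &
     (fun k : nat => `|chebyshev_coef phi k| : R^o) =O_\oo
     (fun k : nat => k%:R `^ (- (1 + delta)) : R^o))
  (* the norm of ['rV_c] is the supremum norm *)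
  (m : 'rV[R]_c -> R)
  (hm : exists2 L : R, 0 < L &
     forall x y : 'rV[R]_c, `|m x - m y| <= L * `|x - y|)
  (Q : 'I_c -> probability (measurableTypeR R) R)
  (hQ : forall l, ac_circular (Q l))
  (n : nat -> 'I_c -> nat) (hn : forall nu l, (2 <= n nu l)%N)
  (hN : (fun nu => total_size (n nu)) @ \oo --> \oo)
  (p : 'I_c -> R) (hp : forall l, 0 < p l < 1)
  (hnp : forall l,
     (n nu l)%:R / (total_size (n nu))%:R @[nu --> \oo] --> p l)
  (d : nat -> measure_display) (Omega : forall nu, measurableType (d nu))
  (P : forall nu, probability (Omega nu) R)
  (Theta : forall nu (l : 'I_c), 'I_(n nu l) -> Omega nu -> measurableTypeR R)
  (hrange : forall nu l (i : 'I_(n nu l)) w, 0 <= Theta nu l i w < 2 * pi)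
  (hlaw : forall nu l (i : 'I_(n nu l)), has_law (P nu) (Theta nu l i) (Q l))
  (hindep : forall nu, mutually_independent (P nu)
     (fun s : {l : 'I_c & 'I_(n nu l)} => Theta nu (tag s) (tagged s)))
  (d' : measure_display) (Omega' : measurableType d')
  (P' : probability Omega' R)
  (Z : nat -> 'I_2 -> Omega' -> c.-tuple (measurableTypeR R))
  (hZmeas : forall k r, (1 <= k)%N -> measurable_fun [set: Omega'] (Z k r))
  (hZ : forall k r, (1 <= k)%N -> is_mvnormal P' (Z k r) 0 (limit_cov p))
  (hZindep : mutually_independent P'
     (fun s : nat * 'I_2 => Z s.1.+1 s.2))
  (H0 : forall (l l' : 'I_c) (A : set (measurableTypeR R)),
     measurable A -> Q l A = Q l' A) :
  cvg_in_distribution P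
    (fun nu w => T_stat (fun l i => Theta nu l i w) phi m)
    P' (fun w => T_limit p phi m (fun k r => Z k r w)).
Proof.
have [L L0 mL] := hm.
have [delta delta0 /eqO_exP[C C0 nC]] := hb.
have [_ _ _ bsum expand] := hphi.
have p0 l : 0 < p l by have /andP[] := hp l.
have n0 nu l : (0 < n nu l)%N by exact: leq_trans (hn nu l).
have p1 : \sum_l p l = 1.
  have h := cvg_fsum (s := index_enum 'I_c) hnp.
  have h1 : (fun nu => \sum_l (n nu l)%:R / (total_size (n nu))%:R : R) @ \oo --> (1 : R).
    apply: cvg_near_cst; apply: filterS (near_total_size_gt hN 0) => nu N0.
    by rewrite -mulr_suml -natr_sum divff// pnatr_eq0 -lt0n.
  exact: (cvg_unique _ h h1).
have bsum' : cvgn (series (fun k => `|chebyshev_coef phi k.+1|)).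
  rewrite (_ : series _ = (fun K => \sum_(1 <= k < K.+1) `|chebyshev_coef phi k|)).
    apply: cvgP; rewrite (cvg_shiftS (fun K => \sum_(1 <= k < K) `|chebyshev_coef phi k|)).
    exact: bsum.
  by apply/funext => K; rewrite big_add1.
have [k0 _ bC] := nC.
have bC' k : (k0 <= k)%N -> `|chebyshev_coef phi k| <= C * k%:R `^ (- (1 + delta)).
  by move=> /bC; rewrite /= normr_id [X in C * X]ger0_norm// powR_ge0.
(* a representative of the common law *)
pose l0 : 'I_c := Ordinal (ltnW hc).
have law nu (s : {l : 'I_c & 'I_(n nu l)}) :
    has_law (P nu) (Theta nu (tag s) (tagged s)) (Q l0).
  have [mT law] := hlaw nu (tag s) (tagged s); split=> // A mA.
  by rewrite law//; exact: H0.
have atomless (x : R) : Q l0 [set x] = 0%E.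
  have [_ /null_content_dominatesP Qdom] := hQ l0; apply: Qdom => //.
  exact: lebesgue_measure_set1.
have rank nu := Rintegral_rank (law nu) (hindep nu) atomless.
have mX nu : measurable_fun setT (fun w => T_stat (fun l i => Theta nu l i w) phi m).
  under eq_fun do rewrite T_statE.
  exact: (rank nu (fun rho => m (\row_l rank_stat (n := n nu) phi rho l))).1.
have mY := measurable_T_limit hZ phi mL.
split=> // f cf bf.
have [B fB] : exists B, forall x, `|f x| <= B.
  have [M [_ hM]] := bf; exists (M + 1) => x.
  by apply: hM => //; rewrite ltrDl.
have int dd (S : measurableType dd) (PS : probability S R) (W : S -> R) :
    measurable_fun setT W -> ('E_PS[f \o W] = (\int[PS]_w f (W w))%:E)%E.
  move=> mW; rewrite unlock fineK//; apply: (integrable_fin_num measurableT).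
  apply: (@integrable_bounded _ _ _ _ _ B) => //.
  by apply: (measurableT_comp _ mW); exact: continuous_measurable_fun.
under eq_fun do rewrite int//.
rewrite int//; apply: cvg_EFin; first exact: nearW.
apply: (portmanteau mX mY) cf fB => {bf int} {}f {}B Lf fB fL.
pose F x := f (m x).
have FL x y : `|F x - F y| <= `|Lf| * L * `|x - y|.
  apply: le_trans (fL _ _) _; rewrite -mulrA.
  by apply: le_trans (ler_wpM2r (normr_ge0 _) (ler_norm Lf)) _; rewrite ler_wpM2l.
have L0' : 0 <= `|Lf| * L by rewrite mulr_ge0// ltW.
have := cvg_avg_rank_stat p0 p1 hZmeas hZ hZindep n0 hN hnp expand bsum' delta0 (ltW C0) bC'
  (F := F) (fun x => fB (m x)) L0' FL.
rewrite (_ : (fun nu => avg _) =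
    (fun nu => \int[P nu]_w f (T_stat (fun l i => Theta nu l i w) phi m))); last first.
  apply/funext => nu; under eq_Rintegral do rewrite T_statE.
  by rewrite (rank nu (fun rho => F (\row_l rank_stat (n := n nu) phi rho l))).2.
rewrite (_ : \int[P']_w F _ = \int[P']_w f (T_limit p phi m (fun k r => Z k r w)))//.
rewrite /Rintegral; congr fine; apply: ae_eq_integral => //.
- by apply/measurable_EFinP; exact: (measurable_limit_series hZ (chebyshev_coef phi) FL).
- apply/measurable_EFinP; apply: (measurableT_comp _ mY).
  apply: continuous_measurable_fun; exact: lipschitz_continuous fL.
- by apply: filterS (ae_T_limit p0 p1 hZ m bsum') => w -> _.
Qed.
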